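(* For every positive integer $n \neq 1,2,3,5$, there exists a closed 3-manifold triangulation of size $n$ whose admissible vertex count $\sigma$ is as follows: \[ \begin{array}{lll} n = 4k & (k \geq 1) & \Longrightarrow\quad \sigma = 17^k + k, \\ n = 4k+1 & (k \geq 2) & \Longrightarrow\quad \sigma = 581\cdot 17^{k-2} + k + 1, \\ n = 4k+2 & (k \geq 1) & \Longrightarrow\quad \sigma = 69\cdot 17^{k-1} + k, \\ n = 4k+3 & (k \geq 1) & \Longrightarrow\quad \sigma = 141\cdot 17^{k-1} + k + 2. \end{array} \]
   Context: A closed 3-manifold triangulation of size $n$ is a collection of $n$ tetrahedra whose $4n$ triangular faces are affinely identified in $2n$ pairs so that the resulting topological space is a closed 3-manifold. (Faces of the same tetrahedron may be identified, and several vertices or edges of the same tetrahedron may become identified as a consequence of the face gluings.) In each tetrahedron there are four types of normal triangle (one for each vertex $v$, separating $v$ from the other three vertices) and three types of normal quadrilateral (one for each way of splitting the four vertices into two pairs, separating the two pairs). Use coordinates in $\mathbb{R}^{7n}$ indexed by these $7n$ types. The matching equations are the following homogeneous linear equations: for each pair of identified faces $F \leftrightarrow F'$ and each vertex $v$ of $F$, corresponding to the vertex $v'$ of $F'$, let $\Delta,\Delta'$ be the tetrahedra containing $F,F'$ on the two sides of the gluing. Then $t+q = t'+q'$, where $t$ is the coordinate of the triangle type at $v$ in $\Delta$, $q$ is the coordinate of the quadrilateral type in $\Delta$ that pairs $v$ with the vertex of $\Delta$ opposite $F$, and $t',q'$ are defined likewise from $v',F',\Delta'$. The quadrilateral constraints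 require that, for each tetrahedron, at most one of its three quadrilateral coordinates is non-zero. The projective solution space is the polytope in $\mathbb{R}^{7n}$ obtained as the cross-section $\sum_i x_i = 1$ of the cone of non-negative vectors satisfying the matching equations. The admissible vertex count $\sigma$ of the triangulation is the number of vertices of this polytope that satisfy the quadrilateral constraints. (These are in bijection with the vertex normal surfaces of the triangulation.) *)

(* Defs.v *)
From HB Require Import structures.
From Stdlib Require Import Relation_Operators.
From mathcomp Require Import all_boot all_order all_algebra all_fingroup.
From mathcomp Require Import all_classical all_reals all_analysis.
Import Order.TTheory GRing.Theory Num.Theory.
Import numFieldNormedType.Exports.

Set Implicit Arguments.
Unset Strict Implicit.
Unset Printing Implicit Defensive.

Local Open Scope classical_set_scope.
Local Open Scope ring_scope.

Definition homeomorphic (X Y : topologicalType) : Prop :=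
  exists (f : X -> Y) (g : Y -> X),
    [/\ continuous f, continuous g, cancel f g & cancel g f].

Definition locally_euclidean (R : realType) (d : nat) (X : topologicalType) :
    Prop :=
  forall x : X, exists (U : set X) (V : set 'rV[R]_d),
    [/\ open U, U x, open V & homeomorphic U V].

(* Closed = compact and without boundary; connectedness is not required. *)
Definition closed_manifold (R : realType) (d : nat) (X : topologicalType) :
    Prop :=
  [/\ hausdorff_space X, second_countable (T := X), compact [set: X]
    & locally_euclidean R d X].

(* The vertices of each tetrahedron are labelled by 'I_4, and its face i is the
   one opposite vertex i.  If glue t i = (t', p), then face i of t is identified
   with face p i of t', each vertex v != i of the former going to the vertex
   p v of the latter: an affine bijection between two triangles is a bijection
   between their vertices, and it extends uniquely to p : 'S_4 with p i the
   vertex opposite the target face. *)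
Record face_gluing (n : nat) := FaceGluing {
  glue :> 'I_n -> 'I_4 -> 'I_n * 'S_4;
  glueK : forall t i,
    glue (glue t i).1 ((glue t i).2 i) = (t, ((glue t i).2^-1)%g);
  glue_neq : forall t i, ((glue t i).1, (glue t i).2 i) <> (t, i)
}.

(* Barycentric coordinates. *)
Definition tetrahedron (R : realType) : set 'rV[R]_4 :=
  [set x | (forall v, 0 <= x 0 v) /\ \sum_v x 0 v = 1].
Arguments tetrahedron R : clear implicits.

Section Realization.
Variables (R : realType) (n : nat) (T : face_gluing n).

Definition tetrahedra : topologicalType := {t : 'I_n & tetrahedron R}.

Definition glued (x y : tetrahedra) : Prop :=
  exists i : 'I_4,
    [/\ \val (tagged x) 0 i = 0,
        tag y = (T (tag x) i).1
      & forall v, \val (tagged y) 0 ((T (tag x) i).2 v) = \val (tagged x) 0 v].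

Definition glue_equiv (x y : tetrahedra) : bool :=
  `[< clos_refl_sym_trans tetrahedra glued x y >].

Lemma glue_equiv_refl : reflexive glue_equiv.
Proof. by move=> x; apply/asboolP; exact: rst_refl. Qed.

Lemma glue_equiv_sym : symmetric glue_equiv.
Proof.
by move=> x y; apply/asboolP/asboolP => xy; exact: rst_sym.
Qed.

Lemma glue_equiv_trans : transitive glue_equiv.
Proof.
move=> y x z /asboolP xy /asboolP yz; apply/asboolP.
exact: rst_trans xy yz.
Qed.

Canonical glue_equiv_rel :=
  EquivRel glue_equiv glue_equiv_refl glue_equiv_sym glue_equiv_trans.

Definition realization : topologicalType :=
  quotient_topology {eq_quot glue_equiv}%qT.

End Realization.

Definition closed_3manifold_triangulation (R : realType) (n : nat)
    (T : face_gluing n) : Prop :=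
  closed_manifold R 3 (realization R T).

(* The quadrilateral types of a tetrahedron are numbered by 'I_3: type j
   corresponds to the splitting that pairs vertex 0 with vertex j.+1.  For
   v != w, quad_type v w is the type that pairs v with w; when neither is 0,
   the vertex paired with 0 is 6 - v - w. *)
Definition quad_type (v w : 'I_4) : 'I_3 :=
  inord (if v == 0 :> nat then w.-1
         else if w == 0 :> nat then v.-1 else 5 - v - w)%N.

Lemma quad_typeE (v w a b : 'I_4) : v != w -> a != b ->
  (quad_type v w == quad_type a b) =
  ((v \in [:: a; b]) == (w \in [:: a; b])).
Proof.
rewrite -!val_eqE /quad_type !inE -!val_eqE.
by move: v w a b => [[|[|[|[|?]]]] ?] [[|[|[|[|?]]]] ?]
  [[|[|[|[|?]]]] ?] [[|[|[|[|?]]]] ?] //=; rewrite !inordK.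
Qed.

(* Vertices are taken as the extreme points. *)
Definition polytope_vertices (R : realType) (I : finType)
    (P : set {ffun I -> R}) : set {ffun I -> R} :=
  [set x | P x /\ forall (y z : {ffun I -> R}) (s : R),
      P y -> P z -> 0 < s < 1 ->
      (forall c, x c = s * y c + (1 - s) * z c) -> y = x /\ z = x].

Section NormalSurfaces.
Variables (R : realType) (n : nat) (T : face_gluing n).
(* (t, inl v) is the triangle type of t at v, (t, inr q) its quadrilateral type q. *)
Local Notation vec := {ffun 'I_n * ('I_4 + 'I_3) -> R}.

Definition matching_equations (x : vec) : Prop :=
  forall (t : 'I_n) (i v : 'I_4), v != i ->
    let t' := (T t i).1 in let p := (T t i).2 in
    x (t, inl v) + x (t, inr (quad_type v i)) =
    x (t', inl (p v)) + x (t', inr (quad_type (p v) (p i))).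

Definition quadrilateral_constraints (x : vec) : Prop :=
  forall (t : 'I_n) (q q' : 'I_3),
    x (t, inr q) != 0 -> x (t, inr q') != 0 -> q = q'.

Definition projective_solution_space : set vec :=
  [set x : vec | [/\ forall c, 0 <= x c, matching_equations x & \sum_c x c = 1]].

Definition admissible_vertices : set vec :=
  polytope_vertices projective_solution_space
    `&` [set x | quadrilateral_constraints x].

Definition admissible_vertex_count (sigma : nat) : Prop :=
  (admissible_vertices #= `I_sigma)%card.

End NormalSurfaces.
Arguments projective_solution_space R {n} T.
Arguments admissible_vertices R {n} T.
Arguments admissible_vertex_count R {n} T sigma.

(* Main.v *)
From Stdlib Require Import Relation_Operators.
Require Import Defs.
From mathcomp Require Import all_boot all_order all_algebra all_fingroup.
From mathcomp Require Import all_classical all_reals all_analysis.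
From mathcomp Require Import ring lra zify.
Import Order.TTheory GRing.Theory Num.Theory.
Import numFieldNormedType.Exports.
Set Implicit Arguments.
Unset Strict Implicit.
Unset Printing Implicit Defensive.
Local Open Scope classical_set_scope.
Local Open Scope ring_scope.

(** The triangulations are rings.  A _block_ is a string of tetrahedra glued
    along faces, with two faces left over, its ports; the pieces are [blockF]
    (one tetrahedron), [blockT] (the same, with its bottom port rotated by a
    third of a turn) and [blockP] (two tetrahedra).  For each residue of [n]
    modulo 4 there is a head, a stack of copies of [blockF] and [blockP] with 4,
    9, 6 or 7 tetrahedra; on top of it lie [j] copies of the [layer] T P F, which
    has four tetrahedra, and the top port is finally glued to the bottom port
    with a rotation.

    Why the result is a closed 3-manifold.  A bistellar move replaces some facets
    of a 4-simplex by the complementary ones and does not change the space that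
    is glued ([bistellar_homeomorphic]).  Such moves turn each of the stacks F P,
    F F and F T into F, whatever surrounds them ([FP_F], [FF_F], [FT_F]), so every
    ring can be shortened until a single F is left ([ring_collapses]); further
    moves turn the ring made of one F into two tetrahedra glued along their whole
    boundaries ([C_D], [ring_double]).  This double is a manifold by explicit
    charts ([double_manifold]).  That a list of moves is legal and leads to the
    expected block is a finite computation on codes of blocks.

    Why the vertices can be counted.  A point of the solution space that
    satisfies the quadrilateral constraints is a vertex exactly when its support
    is minimal, so it is enough to exhibit solutions with incomparable supports
    such that every admissible solution contains one of these supports
    ([vertex_count]).  In a ring the equations decouple.  The matching equations
    at a port compare the weights of three arcs.  The fold inside F makes two of
    the three weights equal, and because of the rotations it is not the same pair
    on the two sides of a port between two blocks: all three weights are equal.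
    The equations inside a block give its two ports the same weight, so one number
    [c] is the weight of all arcs on all ports ([part_solution],
    [bottoms_equal]).  Thus the solutions on the ring are the families of
    solutions on the head and on the layers, with equal arcs on the ports and with
    a common [c].

    The minimal supports in a single block are enumerated by the double
    description method, run inside the logic and proved correct
    ([extreme_rays_describe]).  A layer has 17 rays with [c = 1] and one with
    [c = 0]; the heads, in the order above, have 17, 581, 69 and 141 rays with
    [c = 1], and 1, 3, 1 and 3 with [c = 0].  A minimal support on the ring is either a choice of a ray
    with [c = 1] in every block, or a single ray with [c = 0] in one block.  With
    [m] and [z] rays of the two sorts in the head this makes
    [m * 17 ^ j + (z + j)] vertices ([ring_vertex_count]). *)

(** * Quotients, subspaces and transport of manifolds *)

Lemma homeomorphic_sym (X Y : topologicalType) :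
  homeomorphic X Y -> homeomorphic Y X.
Proof. by case=> f [g [cf cg fK gK]]; exists g, f. Qed.

Lemma homeomorphic_trans (X Y Z : topologicalType) :
  homeomorphic X Y -> homeomorphic Y Z -> homeomorphic X Z.
Proof.
case=> f [g [cf cg fK gK]] [f' [g' [cf' cg' fK' gK']]].
exists (f' \o f), (g \o g'); split.
- by move=> x; apply: continuous_comp; [exact: cf|exact: cf'].
- by move=> x; apply: continuous_comp; [exact: cg'|exact: cg].
- exact: can_comp.
- exact: can_comp.
Qed.

Lemma pi_eqP (S : topologicalType) (E : equiv_rel S) (x y : S) :
  \pi_(quotient_topology {eq_quot E})%qT x =
  \pi_(quotient_topology {eq_quot E})%qT y <-> E x y.
Proof. by split=> [/eqmodP|h]; [|apply/eqmodP]. Qed.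

(** The maps [f] and [g] may be discontinuous, provided that the target
    relation glues the points across each jump. *)
Lemma quotient_homeomorphic (S S' : topologicalType) (E : equiv_rel S)
    (E' : equiv_rel S') (f : S -> S') (g : S' -> S) :
  continuous (\pi_(quotient_topology {eq_quot E'})%qT \o f) ->
  continuous (\pi_(quotient_topology {eq_quot E})%qT \o g) ->
  (forall x y, E x y -> E' (f x) (f y)) ->
  (forall x y, E' x y -> E (g x) (g y)) ->
  (forall x, E (g (f x)) x) -> (forall y, E' (f (g y)) y) ->
  homeomorphic (quotient_topology {eq_quot E})%qT
               (quotient_topology {eq_quot E'})%qT.
Proof.
move=> cf cg fE gE fgK gfK.
pose pi := \pi_(quotient_topology {eq_quot E})%qT.
pose pi' := \pi_(quotient_topology {eq_quot E'})%qT.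
exists ((pi' \o f) \o generic_quotient.repr), ((pi \o g) \o generic_quotient.repr); split.
- apply: repr_comp_continuous => // x y /eqP /pi_eqP xy.
  by apply/eqP/pi_eqP/fE.
- apply: repr_comp_continuous => // x y /eqP /pi_eqP xy.
  by apply/eqP/pi_eqP/gE.
- move=> x; rewrite /= -[RHS]reprK -(proj2 (pi_eqP _ _ _) (fgK _)).
  by apply/pi_eqP/gE/pi_eqP; rewrite reprK.
- move=> x; rewrite /= -[RHS]reprK -(proj2 (pi_eqP _ _ _) (gfK _)).
  by apply/pi_eqP/fE/pi_eqP; rewrite reprK.
Qed.

Lemma val_continuous (T : topologicalType) (A : set T) :
  continuous (set_val : A -> T).
Proof. exact: initial_continuous. Qed.

Lemma continuous_to_subset (X T : topologicalType) (A : set T) (f : X -> A) :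
  continuous (set_val \o f) -> continuous f.
Proof. by move=> cf; apply: continuous_comp_initial. Qed.

Lemma closed_in_subset (T : topologicalType) (A : set T) (C : set A) :
  closed C -> exists2 D : set T, closed D & C = set_val @^-1` D.
Proof.
rewrite -openC => -[D oD DC]; exists (~` D); first by rewrite closedC.
by rewrite -preimage_setC DC setCK.
Qed.

Definition to_subset (T : Type) (A : set T) (x : T) (Ax : A x) : A :=
  exist (fun z => z \in A) x (mem_set Ax).

Lemma preimage_homeomorphic (X Y : topologicalType) (f : X -> Y) (g : Y -> X)
    (U : set Y) :
  continuous f -> continuous g -> cancel f g -> cancel g f ->
  homeomorphic (f @^-1` U) U.
Proof.
move=> cf cg fK gK.
have fU (y : f @^-1` U) : U (f (\val y)) by exact: set_valP y.
have gU (y : U) : (f @^-1` U) (g (\val y)) by rewrite /= gK; exact: set_valP y.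
exists (fun y => to_subset (fU y)), (fun y => to_subset (gU y)); split.
- apply: continuous_to_subset => y.
  by apply: (@continuous_comp _ _ _ set_val f); [exact: val_continuous|exact: cf].
- apply: continuous_to_subset => y.
  by apply: (@continuous_comp _ _ _ set_val g); [exact: val_continuous|exact: cg].
- by move=> y; apply: val_inj => /=; rewrite fK.
- by move=> y; apply: val_inj => /=; rewrite gK.
Qed.

Lemma closed_manifold_homeomorphic (R : realType) d (X Y : topologicalType) :
  homeomorphic X Y -> closed_manifold R d Y -> closed_manifold R d X.
Proof.
case=> f [g [cf cg fK gK]] [hY [B cB [oB nB]] cY eY]; split.
- move=> p q clpq; apply: (can_inj fK); apply: hY => U V Up Vq.
  have [z [Uz Vz]] : f @^-1` U `&` f @^-1` V !=set0.
    by apply: clpq; [exact: cf|exact: cf].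
  by exists (f z).
- exists [set f @^-1` U | U in B].
    by apply: sub_countable cB; exact: card_image_le.
  split; first by move=> _ [U BU <-]; apply: open_comp => //; exact: oB.
  move=> x V Vx.
  have /nB [U /= [BU Ufx] UV] : nbhs (f x) (g @^-1` V).
    by apply: cg; rewrite fK.
  exists (f @^-1` U); first by split => //=; exists U.
  by move=> z /= /UV; rewrite /= fK.
- have -> : [set: X] = g @` [set: Y].
    by apply/seteqP; split=> x _ //; exists (f x).
  apply: continuous_compact => //.
  exact: continuous_subspaceT.
- move=> x; have [U [V [oU Ufx oV UV]]] := eY (f x).
  exists (f @^-1` U), V; split => //; first by apply: open_comp.
  by apply: homeomorphic_trans UV; exact: preimage_homeomorphic gK.
Qed.

(** * Barycentric coordinates *)

Lemma continuous_to_rV (R : realType) (X : topologicalType) n (f : X -> 'rV[R]_n) :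
  (forall j, continuous (fun x => f x 0 j)) -> continuous f.
Proof.
move=> cf x A [P Pf PA].
have : \forall y \near x, forall j, P 0 j (f y 0 j).
  by apply: filter_forall => j; apply: cf; exact: Pf.
apply: filterS => y Py; apply: PA => i j; rewrite ord1; exact: Py.
Qed.

Section Points.
Variable R : realType.
Local Notation tet := (tetrahedron R).

Definition bary (n : nat) (a : nat -> R) : Prop :=
  (forall v, (v < n)%N -> 0 <= a v) /\ \sum_(v <- iota 0 n) a v = 1.

Definition coord (x : tet) (v : nat) : R := \val x 0 (inord v).

Definition row4 (a : nat -> R) : 'rV[R]_4 := \row_(j < 4) a j.

Lemma sum_iota4 (a : nat -> R) : \sum_(v <- iota 0 4) a v = \sum_(j < 4) a j.
Proof. by rewrite -[4%N]/(4 - 0)%N -/(index_iota 0 4) big_mkord. Qed.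

Lemma row4_bary a : bary 4 a -> tetrahedron R (row4 a).
Proof.
move=> [a0 a1]; split=> [v|]; first by rewrite mxE a0.
by rewrite -a1 sum_iota4; apply: eq_bigr => j _; rewrite mxE.
Qed.

Lemma coord_bary (x : tet) : bary 4 (coord x).
Proof.
case: (set_valP x) => x0 x1; split=> [v _|]; first exact: x0.
rewrite sum_iota4 -x1; apply: eq_bigr => j _.
by rewrite /coord inord_val.
Qed.

Definition corner0 (v : nat) : R := (v == 0%N)%:R.

Lemma corner0_bary : bary 4 corner0.
Proof.
by split=> [v _|]; rewrite ?ler0n// !big_cons big_nil /corner0 /= !addr0.
Qed.

(* Total, so that piecewise formulas can be written without side conditions. *)
Definition point_of (a : nat -> R) : tet :=
  match pselect (bary 4 a) with
  | left h => to_subset (row4_bary h)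
  | right _ => to_subset (row4_bary corner0_bary)
  end.

Lemma point_ofE a : bary 4 a -> \val (point_of a) = row4 a.
Proof. by rewrite /point_of; case: pselect. Qed.

Lemma coord_point a v : bary 4 a -> (v < 4)%N -> coord (point_of a) v = a v.
Proof. by move=> ba v4; rewrite /coord point_ofE// mxE inordK. Qed.

Lemma coord_inj (x y : tet) :
  (forall v, (v < 4)%N -> coord x v = coord y v) -> x = y.
Proof.
move=> xy; apply/val_inj/rowP => j.
by have := xy j (ltn_ord j); rewrite /coord inord_val.
Qed.

Lemma point_coord (x : tet) : point_of (coord x) = x.
Proof.
by apply: coord_inj => v v4; rewrite coord_point//; exact: coord_bary.
Qed.

Lemma eq_bary n a b : (forall v, (v < n)%N -> a v = b v) -> bary n a -> bary n b.
Proof.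
move=> ab [a0 a1]; split=> [v vn|]; first by rewrite -ab// a0.
rewrite -a1; apply: eq_big_seq => v; rewrite mem_iota => /andP[_ vn].
by rewrite ab.
Qed.

Lemma eq_point a b : (forall v, (v < 4)%N -> a v = b v) ->
  point_of a = point_of b.
Proof.
move=> ab; have ba v (v4 : (v < 4)%N) : b v = a v by rewrite ab.
rewrite /point_of; case: pselect => [h|nh]; case: pselect => [h'|nh'] //.
- apply: val_inj => /=; apply/rowP => j; rewrite !mxE; exact: ab.
- by case: nh'; exact: eq_bary h.
- by case: nh; exact: eq_bary h'.
Qed.

Lemma coord_continuous4 v : continuous (fun x : tet => coord x v).
Proof.
move=> x; apply: (@continuous_comp _ _ _ set_val (fun M : 'rV[R]_4 => M 0 (inord v))).
  exact: val_continuous.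
exact: coord_continuous.
Qed.

Lemma point_continuous (X : topologicalType) (a : X -> nat -> R) :
  (forall x, bary 4 (a x)) -> (forall v, (v < 4)%N -> continuous (a ^~ v)) ->
  continuous (fun x => point_of (a x)).
Proof.
move=> ba ca; apply: continuous_to_subset.
rewrite [X in continuous X](_ : _ = fun x => row4 (a x)); last first.
  by apply/funext => x /=; rewrite -point_ofE.
apply: continuous_to_rV => j; under eq_fun do rewrite mxE.
exact: ca.
Qed.

End Points.

(** * Gluings of tetrahedra *)

Section Gluings.
Variable R : realType.
Local Notation tet := (tetrahedron R).

(** In [G t i t' p] face [i] of [t] is glued to face [p i] of [t'].  Permutations of
    the vertices are sequences of their values, so that concrete gluings compute. *)
Definition gluing (J : Type) := J -> nat -> J -> seq nat -> Prop.

Definition cells (J : choiceType) : topologicalType := {t : J & tet}.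

Definition cell (J : choiceType) (t : J) (z : tet) : cells J := existT _ t z.

Lemma cell_continuous (J : choiceType) (t : J) : continuous (@cell J t).
Proof. exact: (@existT_continuous J (fun=> tet : topologicalType) t). Qed.

Definition face_glued (J : choiceType) (G : gluing J) (x y : cells J) : Prop :=
  exists i p, [/\ (i < 4)%N, G (tag x) i (tag y) p, coord (tagged x) i = 0 &
    forall v, (v < 4)%N -> coord (tagged y) (nth 0%N p v) = coord (tagged x) v].

Section Space.
Variables (J : choiceType) (G : gluing J).

Definition same_point (x y : cells J) : bool :=
  `[< clos_refl_sym_trans _ (face_glued G) x y >].

Lemma same_point_refl : reflexive same_point.
Proof. by move=> x; apply/asboolP; exact: rst_refl. Qed.

Lemma same_point_sym : symmetric same_point.
Proof. by move=> x y; apply/asboolP/asboolP => xy; exact: rst_sym. Qed.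

Lemma same_point_trans : transitive same_point.
Proof.
by move=> y x z /asboolP xy /asboolP yz; apply/asboolP; exact: rst_trans xy yz.
Qed.

Canonical same_point_equiv :=
  EquivRel same_point same_point_refl same_point_sym same_point_trans.

Definition space : topologicalType :=
  quotient_topology {eq_quot same_point}%qT.

Definition to_space (x : cells J) : space := \pi_space%qT x.

Lemma to_spaceP x y : to_space x = to_space y <-> same_point x y.
Proof. exact: (pi_eqP same_point_equiv). Qed.

Lemma to_space_continuous : continuous to_space.
Proof. exact: pi_continuous. Qed.

Lemma glued_same x y : face_glued G x y -> same_point x y.
Proof. by move=> xy; apply/asboolP; exact: rst_step. Qed.

End Space.

Lemma same_point_min (J J' : choiceType) (G : gluing J) (G' : gluing J')
    (f : cells J -> cells J') :
  (forall x y, face_glued G x y -> same_point G' (f x) (f y)) ->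
  forall x y, same_point G x y -> same_point G' (f x) (f y).
Proof.
move=> fG x y /asboolP; elim=> {x y} [x y /fG //|x|x y _|x y z _ xy _].
- exact: same_point_refl.
- by rewrite same_point_sym.
- exact: same_point_trans xy.
Qed.

Lemma space_homeomorphic (J J' : choiceType) (G : gluing J) (G' : gluing J')
    (f : cells J -> cells J') (g : cells J' -> cells J) :
  continuous (to_space G' \o f) -> continuous (to_space G \o g) ->
  (forall x y, face_glued G x y -> same_point G' (f x) (f y)) ->
  (forall x y, face_glued G' x y -> same_point G (g x) (g y)) ->
  (forall x, same_point G (g (f x)) x) ->
  (forall y, same_point G' (f (g y)) y) ->
  homeomorphic (space G) (space G').
Proof.
move=> cf cg fG gG fgK gfK.
apply: (@quotient_homeomorphic _ _ (same_point_equiv G) (same_point_equiv G') f g) => //.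
- exact: same_point_min.
- exact: same_point_min.
Qed.

End Gluings.

Section Moves.
Variable R : realType.
Local Notation tet := (tetrahedron R).

Section Slide.
Variables (I Ic : seq nat).
Hypothesis IIc : perm_eq (I ++ Ic) (iota 0 5).
Hypothesis I_gt0 : (0 < size I)%N.
Hypothesis Ic_gt0 : (0 < size Ic)%N.

Definition argmin (y : nat -> R) : nat :=
  head 0%N [seq i <- Ic | all (fun j => y i <= y j) Ic].

(** Let [y] be a point of the boundary of a 4-simplex, in barycentric coordinates.
    The facets opposite the vertices of [I] and those opposite the vertices of [Ic]
    fill two balls with the same boundary.  Subtracting the smallest coordinate
    [y k] with index in [Ic] from all of these, and sharing the excess equally among
    the coordinates with index in [I], carries the first ball onto the second. *)
Definition slide (k : nat) (y : nat -> R) (j : nat) : R :=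
  if j \in Ic then y j - y k else y j + y k * (size Ic)%:R / (size I)%:R.

Lemma argminP y : argmin y \in Ic /\ forall j, j \in Ic -> y (argmin y) <= y j.
Proof.
have [k kI kmin] : exists2 k, k \in Ic & forall j, j \in Ic -> y k <= y j.
  move: Ic_gt0; elim: Ic => // a [|b s] IH _.
    by exists a; rewrite ?mem_head// => j; rewrite inE => /eqP->.
  have [k ks kmin] := IH isT.
  have [ak|ka] := leP (y a) (y k).
    exists a; rewrite ?mem_head// => j; rewrite inE => /predU1P[->//|/kmin].
    exact: le_trans.
  exists k; first by rewrite inE ks orbT.
  by move=> j; rewrite inE => /predU1P[->|/kmin//]; exact: ltW.
have : k \in [seq i <- Ic | all (fun j => y i <= y j) Ic].
  by rewrite mem_filter kI andbT; apply/allP.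
rewrite /argmin; case E : [seq _ <- _ | _] => [//|m s] _ /=.
have : m \in [seq i <- Ic | all (fun j => y i <= y j) Ic].
  by rewrite E mem_head.
by rewrite mem_filter => /andP[/allP mmin mI].
Qed.

Lemma mem5 j : (j < 5)%N = (j \in I) || (j \in Ic).
Proof. by rewrite -mem_cat (perm_mem IIc) mem_iota. Qed.

Lemma IcP j : (j < 5)%N -> (j \in Ic) = (j \notin I).
Proof.
rewrite mem5; have : uniq (I ++ Ic) by rewrite (perm_uniq IIc) iota_uniq.
rewrite cat_uniq => /and3P[_ /hasPn H _] /orP[jI|jI]; rewrite jI.
  by apply/negP => /H; rewrite /= jI.
exact/esym/H.
Qed.

Lemma slide_bary k y : bary 5 y -> k \in Ic ->
  (forall j, j \in Ic -> y k <= y j) -> bary 5 (slide k y).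
Proof.
move=> [y0 y1] kIc kmin; split=> [j j5|].
  rewrite /slide; case: ifPn => [/kmin|_]; first by rewrite subr_ge0.
  rewrite addr_ge0 ?y0// divr_ge0 ?mulr_ge0 ?ler0n// y0//.
  by rewrite mem5 kIc orbT.
rewrite -y1 -!(perm_big _ IIc) /= !big_cat /=.
have -> : \sum_(i <- Ic) slide k y i = \sum_(i <- Ic) y i - y k *+ size Ic.
  rewrite (eq_big_seq (fun i => y i - y k)); last by move=> j jI; rewrite /slide jI.
  by rewrite big_split /= sumrN big_const_seq count_predT iter_addr_0.
have -> : \sum_(i <- I) slide k y i =
    \sum_(i <- I) y i + (y k * (size Ic)%:R / (size I)%:R) *+ size I.
  rewrite (eq_big_seq (fun i => y i + y k * (size Ic)%:R / (size I)%:R)).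
    by rewrite big_split /= big_const_seq count_predT iter_addr_0.
  by move=> j jI; rewrite /slide IcP ?jI// mem5 jI.
rewrite -[X in _ + X + _]mulr_natr -[X in _ - X]mulr_natr divfK.
  by rewrite addrACA subrr addr0.
by rewrite pnatr_eq0 -lt0n.
Qed.

End Slide.

(** The point [x] of a tetrahedron as a point of the facet of the 4-simplex whose
    vertices are listed by [lab]. *)
Definition lift5 (lab : seq nat) (x : tet) (j : nat) : R :=
  if j \in lab then coord x (index j lab) else 0.

Definition missing (lab : seq nat) : nat :=
  head 0%N [seq j <- iota 0 5 | j \notin lab].

Definition facet (lab : seq nat) (z : nat -> R) : tet :=
  point_of (fun w => z (nth 0%N lab w)).

Definition is_facet (m : nat) (lab : seq nat) : bool :=
  perm_eq (m :: lab) (iota 0 5).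

Lemma facet_size m lab : is_facet m lab -> size lab = 4%N.
Proof. by move=> /perm_size []. Qed.

Lemma facet_uniq m lab : is_facet m lab -> uniq (m :: lab).
Proof. by move=> /perm_uniq ->. Qed.

Lemma mem_facet m lab j : is_facet m lab -> (j \in lab) = (j < 5)%N && (j != m).
Proof.
move=> h; have /andP[/negPf mlab _] := facet_uniq h.
have := perm_mem h j; rewrite mem_iota inE /= add0n => <-.
by have [->|] := eqVneq j m; rewrite ?mlab ?andbT.
Qed.

Lemma lift5_bary m lab x : is_facet m lab -> bary 5 (lift5 lab x).
Proof.
move=> h; have [x0 x1] := coord_bary x; have lab4 := facet_size h.
have /andP[mlab ulab] := facet_uniq h.
split=> [j _|].
  by rewrite /lift5; case: ifP => // jl; rewrite x0// -lab4 index_mem.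
rewrite -(perm_big _ h) big_cons {1}/lift5 (negPf mlab) /= add0r -x1 -lab4.
rewrite (eq_big_seq (fun j => coord x (index j lab))); last first.
  by move=> j jl; rewrite /lift5 jl.
rewrite -{1}(mkseq_nth 0%N lab) big_map; apply: eq_big_seq => j.
by rewrite mem_iota => /andP[_ jl]; rewrite index_uniq.
Qed.

Lemma facet_bary m lab (z : nat -> R) : is_facet m lab -> bary 5 z -> z m = 0 ->
  bary 4 (fun w => z (nth 0%N lab w)).
Proof.
move=> h [z0 z1] zm; have lab4 := facet_size h; split=> [w w4|].
  apply: z0; have : nth 0%N lab w \in lab by rewrite mem_nth// lab4.
  by rewrite (mem_facet _ h) => /andP[].
have zE : \sum_(v <- iota 0 5) z v = \sum_(v <- lab) z v.
  by rewrite -(perm_big _ h) big_cons /= zm add0r.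
by rewrite -z1 zE -[in RHS](mkseq_nth 0%N lab) lab4 big_map.
Qed.

Lemma eq_facet m lab (y z : nat -> R) : is_facet m lab ->
  (forall j, (j < 5)%N -> j != m -> y j = z j) -> facet lab y = facet lab z.
Proof.
move=> h yz; apply: eq_point => w w4; have lab4 := facet_size h.
have : nth 0%N lab w \in lab by rewrite mem_nth// lab4.
by rewrite (mem_facet _ h) => /andP[]; exact: yz.
Qed.

Lemma facet_lift m lab x : is_facet m lab -> facet lab (lift5 lab x) = x.
Proof.
move=> h; rewrite -[RHS]point_coord; apply: eq_point => w w4.
have lab4 := facet_size h; have /andP[_ ulab] := facet_uniq h.
by rewrite /lift5 mem_nth ?lab4// index_uniq ?lab4.
Qed.

Lemma lift_facet m lab (z : nat -> R) j : is_facet m lab -> bary 5 z -> z m = 0 ->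
  (j < 5)%N -> lift5 lab (facet lab z) j = z j.
Proof.
move=> h zb zm j5; rewrite /lift5 (mem_facet _ h) j5 /=.
have [->//|jm /=] := eqVneq j m.
have jl : j \in lab by rewrite (mem_facet _ h) j5.
rewrite coord_point ?nth_index//; first exact: facet_bary h _ _.
by rewrite -(facet_size h) index_mem.
Qed.

Definition relabel (q : seq nat) (x : tet) : tet :=
  point_of (fun w => coord x (index w q)).

Lemma relabel_bary q (x : tet) : perm_eq q (iota 0 4) ->
  bary 4 (fun w => coord x (index w q)).
Proof.
move=> h; have [x0 x1] := coord_bary x; have q4 : size q = 4%N := perm_size h.
split=> [w w4|].
  by rewrite x0// -q4 index_mem (perm_mem h) mem_iota.
rewrite -(perm_big _ h) /= -{1}(mkseq_nth 0%N q) big_map -x1 q4.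
apply: eq_big_seq => w; rewrite mem_iota => /andP[_ w4].
by rewrite index_uniq ?q4// (perm_uniq h) iota_uniq.
Qed.

Lemma coord_relabel q (x : tet) v : perm_eq q (iota 0 4) -> (v < 4)%N ->
  coord (relabel q x) (nth 0%N q v) = coord x v.
Proof.
move=> h v4; have q4 : size q = 4%N := perm_size h.
rewrite coord_point; first by rewrite index_uniq ?q4// (perm_uniq h) iota_uniq.
  exact: relabel_bary.
have : nth 0%N q v \in q by rewrite mem_nth ?q4.
by rewrite (perm_mem h) mem_iota.
Qed.

Lemma relabelK q q' (x : tet) : perm_eq q (iota 0 4) -> perm_eq q' (iota 0 4) ->
  (forall v, (v < 4)%N -> nth 0%N q' (nth 0%N q v) = v) ->
  relabel q' (relabel q x) = x.
Proof.
move=> h h' qK; apply: coord_inj => v v4.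
have q4 : size q = 4%N := perm_size h.
have qv : (nth 0%N q v < 4)%N.
  have : nth 0%N q v \in q by rewrite mem_nth ?q4.
  by rewrite (perm_mem h) mem_iota.
by rewrite -{1}(qK v v4) coord_relabel// coord_relabel.
Qed.

End Moves.

(** * Bistellar moves *)

Lemma perm4_lt p v : perm_eq p (iota 0 4) -> (v < 4)%N -> (nth 0%N p v < 4)%N.
Proof.
move=> pp v4; have : nth 0%N p v \in p by rewrite mem_nth// (perm_size pp).
by rewrite (perm_mem pp) mem_iota.
Qed.

Section HalfMove.
Variable R : realType.
Local Notation tet := (tetrahedron R).
Variables (J J' : choiceType) (G : gluing J) (G' : gluing J').
Variables (rho : J -> (J' * seq nat) + seq nat) (I Ic : seq nat).
Variables (fac : nat -> J') (flab : nat -> seq nat).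

(** The tetrahedron that carries face [i] of [t] after the move, with the relabelling.
    If [t] is a facet of the 4-simplex, its face [i] lies on the new facet opposite
    the vertex [nth 0 lab i]; there the vertex that [t] misses takes the free place. *)
Definition shadow (t : J) (i : nat) : J' * seq nat :=
  match rho t with
  | inl kept => kept
  | inr lab => let b := nth 0%N lab i in
    (fac b, [seq index (if v == i then missing lab else nth 0%N lab v) (flab b)
            | v <- iota 0 4])
  end.

(** One direction of a bistellar move.  A tetrahedron [t] is either kept, with
    [rho t = inl (t', q)], or is the facet of the 4-simplex with vertices
    [lab], when [rho t = inr lab]; [fac i] with vertices [flab i] is the new facet opposite [i].
    An old gluing is either one between two old facets of the 4-simplex, or a gluing
    of their shadows in the new complex. *)
Record half_move : Prop := HalfMove {
  hm_split : perm_eq (I ++ Ic) (iota 0 5);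
  hm_I : (0 < size I)%N;
  hm_Ic : (0 < size Ic)%N;
  hm_keep : forall t t' q, rho t = inl (t', q) -> perm_eq q (iota 0 4);
  hm_facet : forall t lab, rho t = inr lab ->
    missing lab \in I /\ is_facet (missing lab) lab;
  hm_flab : forall i, i \in Ic -> is_facet i (flab i);
  hm_inner : forall i j, i \in Ic -> j \in Ic -> i != j ->
    exists2 p, G' (fac i) (index j (flab i)) (fac j) p &
      forall k, (k < 5)%N -> k != i ->
      nth 0%N p (index k (flab i)) = index (if k == j then i else k) (flab j);
  hm_glue : forall t i t2 p, (i < 4)%N -> G t i t2 p ->
    perm_eq p (iota 0 4) /\
    ((exists lab lab2, [/\ rho t = inr lab, rho t2 = inr lab2 &
        forall v, (v < 4)%N -> v != i ->
        nth 0%N lab2 (nth 0%N p v) = nth 0%N lab v]) \/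
     [/\ forall lab, rho t = inr lab -> nth 0%N lab i \in Ic,
         forall lab, rho t2 = inr lab -> nth 0%N lab (nth 0%N p i) \in Ic &
      exists2 p', G' (shadow t i).1 (nth 0%N (shadow t i).2 i)
                     (shadow t2 (nth 0%N p i)).1 p' &
        forall v, (v < 4)%N -> nth 0%N p' (nth 0%N (shadow t i).2 v) =
          nth 0%N (shadow t2 (nth 0%N p i)).2 (nth 0%N p v)])
}.

Definition place (y : nat -> R) : cells R J' :=
  existT _ (fac (argmin Ic y)) (facet (flab (argmin Ic y)) (slide I Ic (argmin Ic y) y)).

Definition carry (x : cells R J) : cells R J' :=
  match rho (tag x) with
  | inl kept => existT _ kept.1 (relabel kept.2 (tagged x))
  | inr lab => place (lift5 lab (tagged x))
  end.

Hypothesis hm : half_move.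

Let IIc := hm_split hm.

Lemma slide_self k y : k \in Ic -> slide I Ic k y k = 0 :> R.
Proof. by move=> kI; rewrite /slide kI subrr. Qed.

Lemma same_point_facets (z : nat -> R) i j : bary 5 z ->
  i \in Ic -> j \in Ic -> z i = 0 -> z j = 0 ->
  same_point G' (existT _ (fac i) (facet (flab i) z) : cells R J')
                (existT _ (fac j) (facet (flab j) z)).
Proof.
move=> zb iI jI zi zj; have [->|ij] := eqVneq i j; first exact: same_point_refl.
have [p Gp pE] := hm_inner hm iI jI ij.
have fi := hm_flab hm iI; have fj := hm_flab hm jI.
have i5 : (i < 5)%N by rewrite (mem5 IIc) iI orbT.
have j5 : (j < 5)%N by rewrite (mem5 IIc) jI orbT.
have jl : j \in flab i by rewrite (mem_facet _ fi) j5 eq_sym.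
have si := facet_size fi; have sj := facet_size fj.
have bi := facet_bary fi zb zi; have bj := facet_bary fj zb zj.
apply: glued_same; exists (index j (flab i)), p; split => //=.
- by rewrite -si index_mem.
- by rewrite coord_point ?nth_index// -si index_mem.
move=> v v4.
have kl : nth 0%N (flab i) v \in flab i by rewrite mem_nth ?si.
have := kl; rewrite (mem_facet _ fi) => /andP[k5 ki].
have /andP[_ ui] := facet_uniq fi.
have vE : v = index (nth 0%N (flab i) v) (flab i) by rewrite index_uniq ?si.
rewrite [in RHS]coord_point// [in LHS]vE pE//.
set k := nth 0%N (flab i) v.
have wl : (if k == j then i else k) \in flab j.
  by rewrite (mem_facet _ fj); have [_|kj] := eqVneq k j; rewrite ?i5 ?k5.
rewrite coord_point//; last by rewrite -sj index_mem.
rewrite nth_index//.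
by have [->|] := eqVneq k j; rewrite ?zi ?zj.
Qed.

(** When several coordinates are smallest, the choice made by [argmin] does not matter:
    the candidate images lie on two new facets and are glued together. *)
Lemma place_at y j : bary 5 y -> j \in Ic -> (forall k, k \in Ic -> y j <= y k) ->
  same_point G' (place y) (existT _ (fac j) (facet (flab j) (slide I Ic j y)) : cells R J').
Proof.
move=> yb jI jmin; have [aI amin] := argminP (hm_Ic hm) y.
set a := argmin Ic y in aI amin *.
have yaj : y a = y j by apply/eqP; rewrite eq_le amin// jmin.
have zE k : slide I Ic a y k = slide I Ic j y k by rewrite /slide yaj.
rewrite (_ : slide I Ic j y = slide I Ic a y); last by apply/funext => k; rewrite zE.
apply: same_point_facets => //; last 2 first.
- exact: slide_self.
- by rewrite zE; exact: slide_self.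
exact: slide_bary (hm_I hm) _ _ yb aI amin.
Qed.

Lemma carry_shadow (x : cells R J) i : (i < 4)%N -> coord (tagged x) i = 0 ->
  (forall lab, rho (tag x) = inr lab -> nth 0%N lab i \in Ic) ->
  perm_eq (shadow (tag x) i).2 (iota 0 4) /\
  same_point G' (carry x)
    (existT _ (shadow (tag x) i).1 (relabel (shadow (tag x) i).2 (tagged x)) : cells R J').
Proof.
case: x => t x /= i4 xi; rewrite /carry /shadow /=.
case E : (rho t) => [[t' q]|lab] bI /=.
  by split; [exact: hm_keep hm _ _ _ E|exact: same_point_refl].
have [aI fl] := hm_facet hm E; set a := missing lab in aI fl *.
move: bI => /(_ _ erefl); set b := nth 0%N lab i => bI.
have b5 : (b < 5)%N by rewrite (mem5 IIc) bI orbT.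
have a5 : (a < 5)%N by rewrite (mem5 IIc) aI.
have sl := facet_size fl; have /andP[al ul] := facet_uniq fl.
have fb := hm_flab hm bI; have sb := facet_size fb; have /andP[bl ub] := facet_uniq fb.
have blab : b \in lab by rewrite mem_nth ?sl.
have ab : a != b by apply: contraNneq al => ->.
have yb := lift5_bary x fl.
have y0 : lift5 lab x b = 0 by rewrite /lift5 blab index_uniq ?sl.
set m := (X in perm_eq X _).
have mE v : (v < 4)%N -> nth 0%N m v = index (if v == i then a else nth 0%N lab v) (flab b).
  by case: v => [|[|[|[|]]]].
have labb v : (v < 4)%N -> (if v == i then a else nth 0%N lab v) \in flab b.
  move=> v4; rewrite (mem_facet _ fb); have [_|vi] := eqVneq v i; first by rewrite a5.
  have : nth 0%N lab v \in lab by rewrite mem_nth ?sl.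
  rewrite (mem_facet _ fl) => /andP[-> _] /=.
  by rewrite /b nth_uniq ?sl.
have lw u : (u < 4)%N -> nth 0%N lab u != a.
  by move=> u4; apply: contraNneq al => <-; rewrite mem_nth ?sl.
have um : uniq m.
  apply/(uniqP 0%N) => v w; rewrite !inE -[size m]/4%N => v4 w4.
  rewrite !mE// => /(congr1 (nth 0%N (flab b))); rewrite !nth_index ?labb//.
  have [->|vi] := eqVneq v i; have [->|wi] := eqVneq w i => //.
  - by move=> aw; have := lw _ w4; rewrite -aw eqxx.
  - by move=> va; have := lw _ v4; rewrite va eqxx.
  - by move/eqP; rewrite nth_uniq ?sl// => /eqP.
have mperm : perm_eq m (iota 0 4).
  have m4 : {subset m <= iota 0 4}.
    move=> w /(nthP 0%N)[v]; rewrite -[size m]/4%N => v4 <-.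
    by rewrite mem_iota mE//= add0n -[X in (_ < X)%N]sb index_mem labb.
  have [_ mi] := uniq_min_size um m4 (leqnn 4).
  by apply: uniq_perm => //; rewrite iota_uniq.
split => //; apply: same_point_trans (place_at yb bI _) _.
  by move=> k kI; rewrite y0 yb.1// (mem5 IIc) kI orbT.
rewrite (_ : facet _ _ = relabel m x); first exact: same_point_refl.
apply: eq_point => w w4.
set k := nth 0%N (flab b) w.
have kf : k \in flab b by rewrite mem_nth ?sb.
have wE : index k (flab b) = w by rewrite index_uniq ?sb.
have -> : slide I Ic b (lift5 lab x) k = lift5 lab x k.
  by rewrite /slide y0 subr0 !mul0r addr0 if_same.
have [ka|ka] := eqVneq k a.
  rewrite ka /lift5 (negPf al) -wE ka.
  have <- : nth 0%N m i = index a (flab b) by rewrite mE// eqxx.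
  by rewrite index_uniq// xi.
have kl : k \in lab.
  by move: kf; rewrite (mem_facet _ fb) (mem_facet _ fl) => /andP[-> _].
have v4 : (index k lab < 4)%N by rewrite -sl index_mem.
have vi : index k lab != i.
  apply/eqP => vi; have := kf; rewrite (mem_facet _ fb) => /andP[_ /negP[]].
  by rewrite /b -vi nth_index.
rewrite /lift5 kl -wE.
have <- : nth 0%N m (index k lab) = index k (flab b).
  by rewrite mE// (negPf vi) nth_index.
by rewrite index_uniq.
Qed.

Lemma eq_place y z : (forall j, (j < 5)%N -> y j = z j) -> place y = place z.
Proof.
move=> yz; have yzI j : j \in Ic -> y j = z j.
  by move=> jI; rewrite yz// (mem5 IIc) jI orbT.
have aE : argmin Ic y = argmin Ic z.
  rewrite /argmin; congr head; apply: eq_in_filter => i iI.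
  by apply: eq_in_all => j jI; rewrite !yzI.
rewrite /place aE; have [aI _] := argminP (hm_Ic hm) z.
congr existT; apply: (eq_facet (hm_flab hm aI)) => j j5 _.
by rewrite /slide !yz// (mem5 IIc) aI orbT.
Qed.

(** Faces inside the ball disappear because the slide only depends on the point
    of the 4-simplex.  The other faces are not moved by the slide: one coordinate
    with index in [Ic] is zero there. *)
Lemma carry_glued (x y : cells R J) :
  face_glued G x y -> same_point G' (carry x) (carry y).
Proof.
case=> i [p [i4 Gp xi yx]].
have [pp [[lab [lab2 [Ex Ey labE]]]|[xI yI [p' Gp' p'E]]]] := hm_glue hm i4 Gp.
  rewrite /carry Ex Ey (@eq_place (lift5 lab2 (tagged y)) (lift5 lab (tagged x))).
    exact: same_point_refl.
  have [_ fx] := hm_facet hm Ex; have [_ fy] := hm_facet hm Ey.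
  have sx := facet_size fx; have sy := facet_size fy.
  have /andP[_ ux] := facet_uniq fx; have /andP[_ uy] := facet_uniq fy.
  have sp : size p = 4%N := perm_size pp.
  have p4 v : (v < 4)%N -> (nth 0%N p v < 4)%N := perm4_lt pp.
  move=> k k5; rewrite /lift5.
  have [kx|kx] := boolP (k \in lab).
    have v4 : (index k lab < 4)%N by rewrite -sx index_mem.
    have [vi|vi] := eqVneq (index k lab) i.
      rewrite vi xi; case: ifP => // ky.
      have w4 : (index k lab2 < 4)%N by rewrite -sy index_mem.
      have : index k lab2 \in p by rewrite (perm_mem pp) mem_iota.
      move=> /(nthP 0%N)[u]; rewrite sp => u4 uE.
      have [ui|ui] := eqVneq u i; first by rewrite -uE ui yx.
      have := labE u u4 ui; rewrite uE nth_index// -(nth_index 0%N kx) vi => /eqP.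
      by rewrite nth_uniq ?sx// eq_sym (negPf ui).
    have := labE _ v4 vi; rewrite nth_index// => kE.
    rewrite (_ : k \in lab2); last by rewrite -kE mem_nth ?sy ?p4.
    by rewrite -[in LHS]kE index_uniq ?sy ?p4// yx.
  case: ifP => // ky.
  have w4 : (index k lab2 < 4)%N by rewrite -sy index_mem.
  have : index k lab2 \in p by rewrite (perm_mem pp) mem_iota.
  move=> /(nthP 0%N)[u]; rewrite sp => u4 uE.
  have [ui|ui] := eqVneq u i; first by rewrite -uE ui yx.
  have := labE u u4 ui; rewrite uE nth_index// => kE.
  by move: kx; rewrite kE mem_nth ?sx.
have sp : size p = 4%N := perm_size pp.
have pi4 : (nth 0%N p i < 4)%N := perm4_lt pp i4.
have [mx sx] := carry_shadow i4 xi xI.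
have ypi : coord (tagged y) (nth 0%N p i) = 0 by rewrite yx.
have [my sy] := carry_shadow pi4 ypi yI.
apply: same_point_trans sx _; rewrite same_point_sym; apply: same_point_trans sy _.
rewrite same_point_sym; apply: glued_same.
exists (nth 0%N (shadow (tag x) i).2 i), p'; split => //=.
- have : nth 0%N (shadow (tag x) i).2 i \in (shadow (tag x) i).2.
    by rewrite mem_nth// (perm_size mx).
  by rewrite (perm_mem mx) mem_iota.
- by rewrite coord_relabel.
move=> w w4.
have : w \in (shadow (tag x) i).2 by rewrite (perm_mem mx) mem_iota.
move=> /(nthP 0%N)[v]; rewrite (perm_size mx) -[size _]/4%N => v4 <-.
have pv4 : (nth 0%N p v < 4)%N := perm4_lt pp v4.
by rewrite (p'E _ v4) (coord_relabel _ my pv4) (coord_relabel _ mx v4) yx.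
Qed.

(** On the closed set where the coordinate [i] is the smallest, the slide is
    given by one formula; these finitely many sets cover a cell. *)
Lemma carry_continuous : continuous (to_space G' \o carry).
Proof.
have cts t : continuous (fun x : tet => to_space G' (carry (cell t x))).
  case E : (rho t) => [[t' q]|lab].
    rewrite (_ : (fun x : tet => _) = to_space G' \o (@cell R J' t' \o relabel q)).
      move=> x; apply: continuous_comp; last exact: to_space_continuous.
      apply: continuous_comp; last exact: cell_continuous.
      apply: point_continuous => [y|v _]; last exact: coord_continuous4.
      by apply: relabel_bary; exact: hm_keep hm _ _ _ E.
    by apply/funext => x; rewrite /carry /= E.
  have [_ fl] := hm_facet hm E.
  have lift_cts j : continuous (fun x : tet => lift5 lab x j).
    have [jl|jl] := boolP (j \in lab); rewrite /lift5.
      by under eq_fun do rewrite jl; exact: coord_continuous4.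
    by under eq_fun do rewrite (negPf jl); exact: cst_continuous.
  have slide_cts i j : continuous (fun x : tet => slide I Ic i (lift5 lab x) j).
    have [jI|jI] := boolP (j \in Ic); rewrite /slide.
      under eq_fun do rewrite jI.
      by move=> x; exact: cvgB (lift_cts j x) (lift_cts i x).
    under eq_fun do rewrite (negPf jI) -mulrA.
    by move=> x; exact: cvgD (lift_cts j x) (cvgMr_tmp (lift_cts i x)).
  apply/continuous_closedP => C cC.
  pose P i := [set x : tet | (forall j, j \in Ic -> lift5 lab x i <= lift5 lab x j) /\
    C (to_space G' (cell (fac i) (facet (flab i) (slide I Ic i (lift5 lab x)))))].
  rewrite (_ : _ @^-1` C = \bigcup_(i in [set` Ic]) P i).
    apply: closed_bigcup => [|i iI]; first exact: finite_seq.
    have fi := hm_flab hm iI.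
    have cell_cts : continuous (to_space G' \o @cell R J' (fac i)).
      move=> z; apply: continuous_comp; first exact: cell_continuous.
      exact: to_space_continuous.
    have /closed_in_subset[D cD DE] : closed ((to_space G' \o cell (fac i)) @^-1` C).
      by move/continuous_closedP: cell_cts => /(_ _ cC).
    pose row (x : tet) : 'rV[R]_4 := row4 (fun w => slide I Ic i (lift5 lab x) (nth 0%N (flab i) w)).
    have row_cts : continuous row.
      by apply: continuous_to_rV => j; under eq_fun do rewrite mxE; exact: slide_cts.
    rewrite (_ : P i = \bigcap_(j in [set` Ic])
        [set x | 0 <= lift5 lab x j - lift5 lab x i] `&` row @^-1` D); last first.
      have rowE x : (forall j, j \in Ic -> lift5 lab x i <= lift5 lab x j) ->
          D (row x) = C (to_space G' (cell (fac i) (facet (flab i) (slide I Ic i (lift5 lab x))))).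
        move=> imin; transitivity (((to_space G' \o cell (fac i)) @^-1` C)
            (facet (flab i) (slide I Ic i (lift5 lab x)))) => //.
        rewrite DE /preimage /=; congr D; apply/esym; rewrite set_valE.
        apply: point_ofE; apply: facet_bary fi _ _.
          exact: slide_bary (hm_I hm) _ _ (lift5_bary x fl) iI imin.
        exact: slide_self.
      apply/seteqP; split=> [x [imin Cx]|x [imin Dx]].
        by split; [move=> j jI /=; rewrite subr_ge0 imin|rewrite /= rowE].
      have imin' j : j \in Ic -> lift5 lab x i <= lift5 lab x j.
        by move=> jI; have := imin j jI; rewrite /= subr_ge0.
      by split => //; rewrite -rowE.
    apply: closedI; last by move/continuous_closedP: row_cts => /(_ _ cD).
    apply: closed_bigI => j jI.
    rewrite (_ : [set x | _] = (fun x => lift5 lab x j - lift5 lab x i) @^-1` [set r | 0 <= r])//.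
    have /continuous_closedP : continuous (fun x : tet => lift5 lab x j - lift5 lab x i).
      by move=> x; exact: cvgB (lift_cts j x) (lift_cts i x).
    by move=> /(_ _ (@closed_ge R 0)).
  apply/seteqP; split=> [x Cx|x [i /= iI [imin Cx]]].
    have [aI amin] := argminP (hm_Ic hm) (lift5 lab x).
    by exists (argmin Ic (lift5 lab x)) => //; split => //; move: Cx; rewrite /= /carry /= E.
  rewrite /= /carry /= E.
  by rewrite (proj2 (to_spaceP G' _ _) (place_at (lift5_bary x fl) iI imin)).
by move=> [t x] A nA; exact: (cts t x A nA).
Qed.

End HalfMove.

Section BistellarMove.
Variable R : realType.

Definition inverse_half (J J' : choiceType) (rho : J -> (J' * seq nat) + seq nat)
    (rho' : J' -> (J * seq nat) + seq nat) (I Ic : seq nat)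
    (fac : nat -> J') (flab : nat -> seq nat)
    (fac' : nat -> J) (flab' : nat -> seq nat) : Prop :=
  [/\ forall t t' q, rho t = inl (t', q) -> exists2 q', rho' t' = inl (t, q') &
        perm_eq q' (iota 0 4) /\
        forall v, (v < 4)%N -> nth 0%N q' (nth 0%N q v) = v,
      forall t lab, rho t = inr lab ->
        t = fac' (missing lab) /\ lab = flab' (missing lab) &
      forall i, i \in Ic -> rho' (fac i) = inr (flab i)].

(** The slide of the inverse move subtracts from the coordinates with index in [I] what
    the slide has added to them. *)
Lemma carryK (J J' : choiceType) (G : gluing J) (G' : gluing J') rho rho' I Ic
    fac flab fac' flab' :
  half_move G G' rho I Ic fac flab -> half_move G' G rho' Ic I fac' flab' ->
  inverse_half rho rho' I Ic fac flab fac' flab' ->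
  forall x : cells R J,
    same_point G (carry rho' Ic I fac' flab' (carry rho I Ic fac flab x)) x.
Proof.
move=> hm hm' [keepK facetE facE] [t x]; rewrite {2}/carry /=.
have IIc := hm_split hm; have cII := hm_split hm'.
case E : (rho t) => [[t' q]|lab].
  have [q' E' [q'4 qK]] := keepK _ _ _ E.
  have q4 := hm_keep hm E.
  by rewrite /carry /= E' /= relabelK//; exact: same_point_refl.
have [aI fl] := hm_facet hm E; have [tE labE] := facetE _ _ E.
set a := missing lab in aI fl tE labE.
have yb := lift5_bary x fl; set y := lift5 lab x in yb *.
have ya : y a = 0.
  by have /andP[/negPf al _] := facet_uniq fl; rewrite /y /lift5 al.
have [bI bmin] := argminP (hm_Ic hm) y.
rewrite /place; set b := argmin Ic y in bI bmin *.
have zb := slide_bary IIc (hm_I hm) yb bI bmin; set z := slide I Ic b y in zb *.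
have zself : z b = 0 by rewrite /z slide_self.
rewrite /carry /= facE//.
have aIc : (a \in Ic) = false.
  by rewrite (IcP IIc) ?aI// (mem5 IIc) aI.
rewrite (@eq_place _ _ _ _ _ _ _ _ _ _ hm' _ z); last first.
  by move=> j j5; rewrite (lift_facet (hm_flab hm bI)).
have za : z a = y b * (size Ic)%:R / (size I)%:R.
  by rewrite /z /slide aIc ya add0r.
have zI j : j \in I -> z j = y j + z a.
  move=> jI; rewrite za /z /slide ifN//.
  by rewrite (IcP IIc) ?jI// (mem5 IIc) jI.
apply: same_point_trans (place_at hm' zb aI _) _.
  move=> k kI; rewrite (zI k)// lerDr yb.1//.
  by rewrite (mem5 IIc) kI.
rewrite -tE -labE (_ : facet lab _ = x); first exact: same_point_refl.
rewrite -[RHS](facet_lift x fl); apply: eq_facet fl _ => j j5 ja.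
rewrite /slide; have := j5; rewrite (mem5 IIc); have [jI _|jI /= jIc] := boolP (j \in I).
  by rewrite zI// addrK.
rewrite za /z /slide jIc divfK; last by rewrite pnatr_eq0 -lt0n (hm_I hm).
by rewrite mulfK ?subrK// pnatr_eq0 -lt0n (hm_Ic hm).
Qed.

Lemma bistellar_homeomorphic (J J' : choiceType) (G : gluing J) (G' : gluing J')
    rho rho' I Ic fac flab fac' flab' :
  half_move G G' rho I Ic fac flab -> half_move G' G rho' Ic I fac' flab' ->
  inverse_half rho rho' I Ic fac flab fac' flab' ->
  inverse_half rho' rho Ic I fac' flab' fac flab ->
  homeomorphic (space R G) (space R G').
Proof.
move=> hm hm' inv inv'.
apply: (@space_homeomorphic _ _ _ _ _ (carry rho I Ic fac flab) (carry rho' Ic I fac' flab')).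
- exact: carry_continuous hm.
- exact: carry_continuous hm'.
- exact: carry_glued hm.
- exact: carry_glued hm'.
- exact: carryK hm hm' inv.
- exact: carryK hm' hm inv'.
Qed.

End BistellarMove.

(** * Blocks of tetrahedra and their surroundings *)

Definition face_code := (nat * seq nat)%type.
(** In [entry B t i = (k, p)] the numbers 0 and 1 for [k] stand for the bottom and the
    top port, and [k.+2] for the tetrahedron [k].  In [port B b = (t, s)] the port is
    the face of [t] opposite the vertex [nth 0 s 0], and its corners [nth 0 s w] carry
    the labels [w = 1, 2, 3]. *)
Record block := Block { tets : seq (seq face_code); port : bool -> face_code }.

Definition entry (B : block) (t i : nat) : face_code :=
  nth (0%N, [::]) (nth [::] (tets B) t) i.

Definition pcomp (s p : seq nat) : seq nat := [seq nth 0%N s v | v <- p].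

Lemma comp_nth s p v : size p = 4%N -> (v < 4)%N ->
  nth 0%N (pcomp s p) v = nth 0%N s (nth 0%N p v).
Proof. by move=> sp v4; rewrite (nth_map 0%N) ?sp. Qed.

Lemma perm4_comp s p : perm_eq s (iota 0 4) -> perm_eq p (iota 0 4) ->
  perm_eq (pcomp s p) (iota 0 4).
Proof.
move=> ps pp; apply: perm_trans (ps); rewrite /pcomp.
apply: perm_trans (perm_map (nth 0%N s) pp) _.
by rewrite -[X in iota _ X](perm_size ps) -/(mkseq _ _) mkseq_nth.
Qed.

(** The tetrahedra around a block, and what the two ports are glued to: a face of one
    of these tetrahedra, or again a port of the block. *)
Record context (A : choiceType) := Context {
  outer_face : A -> nat -> (A * seq nat) + (bool * seq nat);
  outer_port : bool -> (A * seq nat) + (bool * seq nat)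
}.

Definition plug (m : nat) (B : block) (A : choiceType) (K : context A) :
    gluing ('I_m + A)%type :=
  fun x i y p => match x, y with
  | inl t, inl t' =>
      entry B t i = (t'.+2, p) \/
      exists b q b' r s, [/\ entry B t i = (nat_of_bool b, q),
        outer_port K b = inr (b', r), port B b' = (val t', s) &
        p = pcomp s (pcomp r q)]
  | inl t, inr a =>
      exists b q r, [/\ entry B t i = (nat_of_bool b, q),
        outer_port K b = inl (a, r) & p = pcomp r q]
  | inr a, inl t =>
      exists b q s, [/\ outer_face K a i = inr (b, q),
        port B b = (val t, s) & p = pcomp s q]
  | inr a, inr a' => outer_face K a i = inl (a', p)
  end.

Record context_wf (A : choiceType) (K : context A) : Prop := ContextWf {
  wf_face : forall a i a' p, (i < 4)%N -> outer_face K a i = inl (a', p) ->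
    perm_eq p (iota 0 4);
  wf_face_port : forall a i b p, (i < 4)%N -> outer_face K a i = inr (b, p) ->
    perm_eq p (iota 0 4) /\ nth 0%N p i = 0%N;
  wf_port : forall b a p, outer_port K b = inl (a, p) -> perm_eq p (iota 0 4);
  wf_port_port : forall b b' p, outer_port K b = inr (b', p) ->
    perm_eq p (iota 0 4) /\ nth 0%N p 0 = 0%N
}.

Definition new_facet := (nat * (nat * seq nat))%type.
Definition tet_move := ((nat * seq nat) + seq nat)%type.

Section HalfCheck.
Variables (B B' : block) (rho : seq tet_move) (new : seq new_facet).
Let m := size (tets B).
Let m' := size (tets B').

Definition old_labels : seq nat :=
  pmap (fun r : tet_move => if r is inr lab then Some (missing lab) else None) rho.
Definition new_labels : seq nat := [seq x.1 | x <- new].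
Definition rho_at (t : nat) : tet_move := nth (inr [::]) rho t.
Definition find_new (i : nat) : nat * seq nat :=
  (nth (0%N, (0%N, [::])) new (index i new_labels)).2.

Definition shadow_code (t i : nat) : face_code :=
  match rho_at t with
  | inl kept => kept
  | inr lab => let b := nth 0%N lab i in
    ((find_new b).1, [seq index (if v == i then missing lab else nth 0%N lab v) (find_new b).2
                     | v <- iota 0 4])
  end.

Definition outer_ok (t i : nat) : bool :=
  if rho_at t is inr lab then nth 0%N lab i \in new_labels else true.

Definition check_face (t i : nat) : bool :=
  let: (k, p) := entry B t i in
  let: (t1, m1) := shadow_code t i in
  let: (k', p') := entry B' t1 (nth 0%N m1 i) in
  perm_eq p (iota 0 4) &&
  if (k < 2)%N then
    [&& nth 0%N p i == 0%N, outer_ok t i, perm_eq m1 (iota 0 4), size p' == 4%N, k' == k &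
        all (fun v => nth 0%N p' (nth 0%N m1 v) == nth 0%N p v) (iota 0 4)]
  else
    let t2 := k.-2 in
    (t2 < m)%N &&
    ((if rho_at t is inr lab then if rho_at t2 is inr lab2 then
       all (fun v => (v == i) || (nth 0%N lab2 (nth 0%N p v) == nth 0%N lab v)) (iota 0 4)
      else false else false) ||
     let: (t3, m2) := shadow_code t2 (nth 0%N p i) in
     [&& outer_ok t i, outer_ok t2 (nth 0%N p i), k' == t3.+2 &
         all (fun v => nth 0%N p' (nth 0%N m1 v) == nth 0%N m2 (nth 0%N p v)) (iota 0 4)]).

Definition check_port (b : bool) : bool :=
  let: (t, s) := port B b in
  let: (t1, m1) := shadow_code t (nth 0%N s 0) in
  [&& (t < m)%N, perm_eq s (iota 0 4), outer_ok t (nth 0%N s 0) &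
      port B' b == (t1, pcomp m1 s)].

Definition check_tet (t : nat) : bool :=
  match rho_at t with
  | inl (t', q) => (t' < m')%N && perm_eq q (iota 0 4)
  | inr lab => (missing lab \in old_labels) && is_facet (missing lab) lab
  end.

Definition check_inner (i j : nat) : bool :=
  (i == j) ||
  let: (k, p) := entry B' (find_new i).1 (index j (find_new i).2) in
  (k == (find_new j).1.+2) &&
  all (fun l => (l == i) || (nth 0%N p (index l (find_new i).2) ==
                             index (if l == j then i else l) (find_new j).2)) (iota 0 5).

Definition no_ports : bool :=
  all (fun t => all (fun i => 1 < (entry B t i).1)%N (iota 0 4)) (iota 0 m).

(** The conditions of [half_move], for two blocks in an unknown common context.
    The context meets them only at the ports, where the labels must not change. *)
Definition check_half : bool :=
  [&& perm_eq (old_labels ++ new_labels) (iota 0 5),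
      (0 < size old_labels)%N, (0 < size new_labels)%N, all check_tet (iota 0 m),
      all (fun i => is_facet i (find_new i).2 && ((find_new i).1 < m')%N) new_labels,
      all (fun i => all (check_inner i) new_labels) new_labels &
      all (fun t => all (check_face t) (iota 0 4)) (iota 0 m)].

End HalfCheck.

(** * Bistellar moves of blocks, checked by computation *)

Section PlugMove.
Variables (m m' : nat) (B B' : block) (rho : seq tet_move) (new : seq new_facet).
Variables (A : choiceType) (K : context A).

Definition plug_rho (x : 'I_m.+1 + A) : (('I_m'.+1 + A) * seq nat) + seq nat :=
  match x with
  | inl t => match rho_at rho t with
             | inl (t', q) => inl (inl (inord t'), q)
             | inr lab => inr lab
             end
  | inr a => inl (inr a, iota 0 4)
  end.

Definition plug_facet (i : nat) : 'I_m'.+1 + A := inl (inord (find_new new i).1).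

Hypotheses (Bm : size (tets B) = m.+1) (Bm' : size (tets B') = m'.+1).
Hypothesis Kwf : context_wf K.
Hypothesis BB' : check_half B B' rho new.
Hypothesis ports : (forall b, check_port B B' rho new b) \/ (no_ports B /\ (A -> False)).

Let chk_face (t : 'I_m.+1) i : (i < 4)%N -> check_face B B' rho new t i.
Proof.
case/and5P: BB' => _ _ _ _ /and3P[_ _ /allP H] i4.
have /H /allP : nat_of_ord t \in iota 0 (size (tets B)) by rewrite mem_iota Bm ltn_ord.
by apply; rewrite mem_iota.
Qed.

Let chk_tet (t : 'I_m.+1) : check_tet B' rho t.
Proof.
case/and5P: BB' => _ _ _ /allP H _.
by apply: H; rewrite mem_iota Bm ltn_ord.
Qed.

Lemma shadow_plug (t : 'I_m.+1) i :
  shadow plug_rho plug_facet (fun i => (find_new new i).2) (inl t) i =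
  (inl (inord (shadow_code rho new t i).1), (shadow_code rho new t i).2).
Proof. by rewrite /shadow /shadow_code /=; case: (rho_at rho t) => [[]|]. Qed.

Lemma plug_outer (t : 'I_m.+1) i : outer_ok rho new t i ->
  forall lab, plug_rho (inl t) = inr lab -> nth 0%N lab i \in new_labels new.
Proof. by rewrite /outer_ok /=; case: (rho_at rho t) => [[t' q]|lab] // H _ [<-]. Qed.

Lemma shadow_lt (t : 'I_m.+1) i : (i < 4)%N -> outer_ok rho new t i ->
  ((shadow_code rho new t i).1 < m'.+1)%N.
Proof.
have := chk_tet t; rewrite /check_tet /outer_ok /shadow_code -Bm'.
case: (rho_at rho t) => [[t' q] /andP[]//|lab] _ i4 /= bI.
case/and5P: BB' => _ _ _ _ /and3P[/allP H _ _].
by have /andP[] := H _ bI.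
Qed.

Lemma face_port (t : 'I_m.+1) i (b : bool) q : (i < 4)%N ->
  entry B t i = (nat_of_bool b, q) ->
  [/\ perm_eq q (iota 0 4), nth 0%N q i = 0%N, outer_ok rho new t i,
    perm_eq (shadow_code rho new t i).2 (iota 0 4) &
    exists2 q', size q' = 4%N /\ entry B' (shadow_code rho new t i).1
                      (nth 0%N (shadow_code rho new t i).2 i) = (nat_of_bool b, q') &
      forall v, (v < 4)%N ->
        nth 0%N q' (nth 0%N (shadow_code rho new t i).2 v) = nth 0%N q v].
Proof.
move=> i4 E; have := chk_face t i4; rewrite /check_face E.
case: (shadow_code rho new t i) => t1 m1.
cbv beta iota zeta; case: (entry B' t1 (nth 0%N m1 i)) => k' q'.
rewrite ifT; last by case: (b).
move=> /andP[q4 /and5P[/eqP qi oi m14 /eqP q'4 /andP[/eqP-> /allP H]]]; split => //.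
by exists q' => // v v4; apply/eqP/H; rewrite mem_iota.
Qed.

Lemma face_tet (t : 'I_m.+1) i t2 p : (i < 4)%N -> entry B t i = (t2.+2, p) ->
  [/\ perm_eq p (iota 0 4), (t2 < m.+1)%N &
    (exists lab lab2, [/\ rho_at rho t = inr lab, rho_at rho t2 = inr lab2 &
        forall v, (v < 4)%N -> v != i ->
        nth 0%N lab2 (nth 0%N p v) = nth 0%N lab v]) \/
    [/\ outer_ok rho new t i, outer_ok rho new t2 (nth 0%N p i) &
      exists2 p', entry B' (shadow_code rho new t i).1
                      (nth 0%N (shadow_code rho new t i).2 i) =
                  ((shadow_code rho new t2 (nth 0%N p i)).1.+2, p') &
      forall v, (v < 4)%N ->
        nth 0%N p' (nth 0%N (shadow_code rho new t i).2 v) =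
        nth 0%N (shadow_code rho new t2 (nth 0%N p i)).2 (nth 0%N p v)]].
Proof.
move=> i4 E; have := chk_face t i4; rewrite /check_face E.
case: (shadow_code rho new t i) => t1 m1.
case: (shadow_code rho new t2 (nth 0%N p i)) => t3 m2.
cbv beta iota zeta; case: (entry B' t1 (nth 0%N m1 i)) => k' p'.
rewrite -[(t2.+2 < 2)%N]/false -[t2.+2.-2]/t2 Bm.
move=> /andP[p4 /andP[tm H]]; split => //.
case/orP: H => [|/and4P[ok1 ok2 /eqP-> /allP H]]; last first.
  by right; split => //; exists p' => // v v4; apply/eqP/H; rewrite mem_iota.
case: (rho_at rho t) => [//|lab]; case: (rho_at rho t2) => [//|lab2] /allP H.
left; exists lab, lab2; split => // v v4 vi; apply/eqP.
by have := H v; rewrite mem_iota (negPf vi); apply.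
Qed.

Lemma port_ok (b : bool) : (exists2 t : 'I_m.+1, exists2 i, (i < 4)%N &
      ((entry B t i).1 < 2)%N & True) \/ (exists _ : A, True) ->
  let t := (port B b).1 in let s := (port B b).2 in
  let sh := shadow_code rho new t (nth 0%N s 0) in
  [/\ (t < m.+1)%N, perm_eq s (iota 0 4), outer_ok rho new t (nth 0%N s 0) &
     port B' b = (sh.1, pcomp sh.2 s)].
Proof.
move=> used; have : check_port B B' rho new b.
  case: ports => [//|[noB noA]]; case: used => [[t [j j4 tj] _]|[a _]]; last by case: (noA a).
  have /allP/(_ (t : nat)) := noB; rewrite mem_iota Bm ltn_ord => /(_ isT) /allP /(_ j).
  by rewrite mem_iota j4 => /(_ isT); rewrite ltnNge -ltnS tj.
rewrite /check_port; case: (port B b) => t s; cbv beta iota zeta.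
case: (shadow_code rho new t (nth 0%N s 0)) => t1 m1; rewrite Bm => /and4P[tm s4 os /eqP->].
by [].
Qed.

Lemma check_halfP : half_move (plug (m := m.+1) B K) (plug (m := m'.+1) B' K) plug_rho
  (old_labels rho) (new_labels new) plug_facet (fun i => (find_new new i).2).
Proof.
case/and5P: (BB') => H1 H2 H3 H4 /and3P[/allP H5 /allP H6 H7].
split=> //.
- move=> [t|a] t' q /=.
    have := chk_tet t; rewrite /check_tet; case: (rho_at rho t) => [[t1 q1]|//].
    by move=> /andP[_ ?] [_ <-].
  by move=> [_ <-].
- move=> [t|//] lab /=; have := chk_tet t; rewrite /check_tet.
  by case: (rho_at rho t) => [[]//|lab1] /andP[? ?] [<-].
- by move=> i /H5 /andP[].
- move=> i j iI jI ij; have /allP /(_ _ jI) := H6 _ iI.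
  rewrite /check_inner (negPf ij) orFb.
  case E : (entry _ _ _) => [k p] /andP[/eqP kE /allP pE]; exists p.
    rewrite /plug_facet /=; left.
    have /andP[_ fi] := H5 _ iI; have /andP[_ fj] := H5 _ jI.
    by rewrite !inordK -?Bm'// -kE -E.
  move=> l l5 li; apply/eqP; have := pE l; rewrite mem_iota /= (negPf li) /=.
  by apply.
have idE v : (v < 4)%N -> nth 0%N (iota 0 4) v = v by move=> v4; rewrite nth_iota.
have ord_eq (t : 'I_m.+1) (t1 : nat) : val t = t1 -> t1 = t by [].
move=> [t|a] i [t2|a2] p i4 /=; rewrite -/(iota 0 4).
- case=> [E|[b [q [b' [r [s [E Kb PB ->]]]]]]].
    have [p4 tm H] := face_tet i4 E; split => //.
    case: H => [[lab [lab2 [E1 E2 H]]]|[ok1 ok2 [p' E' pE]]].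
      by left; exists lab, lab2; rewrite E1 E2.
    right; split; [exact: plug_outer|exact: plug_outer|exists p'].
      rewrite !shadow_plug /=; left.
      have pi4 := perm4_lt p4 i4.
      by rewrite !inordK ?shadow_lt// E'.
    by move=> v v4; rewrite !shadow_plug pE.
  have [q4 qi oi m14 [q' [sq' E'] qE]] := face_port i4 E.
  have [] := @port_ok b'; first by left; exists t => //; exists i => //; rewrite E; case: (b).
  rewrite PB /= => _ s4 os PB'.
  have [r4 r0] := wf_port_port Kwf Kb.
  have p4 := perm4_comp s4 (perm4_comp r4 q4).
  have pE v : (v < 4)%N -> nth 0%N (pcomp s (pcomp r q)) v = nth 0%N s (nth 0%N r (nth 0%N q v)).
    by move=> v4; rewrite !comp_nth ?(perm_size q4) ?size_map ?(perm_size q4).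
  split => //; right; rewrite !pE// qi r0.
  split; [exact: plug_outer|exact: plug_outer|].
  have s04 : (nth 0%N s 0 < 4)%N by exact: perm4_lt.
  rewrite !shadow_plug /=.
  exists (pcomp (pcomp (shadow_code rho new t2 (nth 0%N s 0)).2 s) (pcomp r q')).
    right; exists b, q', b', r, (pcomp (shadow_code rho new t2 (nth 0%N s 0)).2 s).
    by rewrite !inordK ?shadow_lt//.
  move=> v v4; have w4 := perm4_lt m14 v4; have qv4 := perm4_lt q4 v4.
  have rq4 := perm4_lt r4 qv4.
  rewrite pE// [LHS]comp_nth ?size_map//.
  by rewrite (comp_nth r sq' w4) qE// comp_nth// (perm_size s4).
- case=> b [q [r [E Kb ->]]].
  have [q4 qi oi m14 [q' [sq' E'] qE]] := face_port i4 E.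
  have r4 := wf_port Kwf Kb; split; first exact: perm4_comp.
  right; split; [exact: plug_outer|by []|].
  rewrite shadow_plug; exists (pcomp r q').
    by exists b, q', r; rewrite /= !inordK ?shadow_lt.
  move=> v v4; have w4 := perm4_lt m14 v4; have qv4 := perm4_lt q4 v4.
  rewrite (comp_nth r (perm_size q4) v4) idE ?perm4_lt//.
  by rewrite (comp_nth r sq' w4) qE.
- case=> b [q [s [Ka PB ->]]].
  have [q4 qi] := wf_face_port Kwf i4 Ka.
  have [] := @port_ok b; first by right; exists a.
  rewrite PB /= => _ s4 os PB'.
  have s04 : (nth 0%N s 0 < 4)%N by exact: perm4_lt.
  have pE v : (v < 4)%N -> nth 0%N (pcomp s q) v = nth 0%N s (nth 0%N q v).
    by move=> v4; rewrite comp_nth ?(perm_size q4).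
  split; first exact: perm4_comp.
  right; rewrite pE// qi; split; [by []|exact: plug_outer|].
  rewrite shadow_plug; exists (pcomp (pcomp (shadow_code rho new t2 (nth 0%N s 0)).2 s) q).
    exists b, q, (pcomp (shadow_code rho new t2 (nth 0%N s 0)).2 s).
    by rewrite /= !inordK ?shadow_lt// idE.
  move=> v v4; have qv4 := perm4_lt q4 v4.
  rewrite idE// pE// (comp_nth _ (perm_size q4) v4).
  by rewrite comp_nth// (perm_size s4).
- move=> E; have p4 := wf_face Kwf i4 E; split => //; right; split => //.
  exists p; first by rewrite idE.
  by move=> v v4; rewrite !idE// perm4_lt.
Qed.

End PlugMove.

Definition inverse_perm (q : seq nat) : seq nat := [seq index v q | v <- iota 0 4].

(** The inverse move, computed from the move. *)
Definition back_rho (m' : nat) (rho : seq tet_move) (new : seq new_facet) : seq tet_move :=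
  [seq (let j := index t' [seq x.2.1 | x <- new] in
        if (j < size new)%N then inr (nth (0%N, (0%N, [::])) new j).2.2
        else let k := find (fun r : tet_move => if r is inl (u, _) then u == t' else false) rho in
             inl (k, if rho_at rho k is inl (_, q) then inverse_perm q else [::]))
  | t' <- iota 0 m'].

Definition back_new (rho : seq tet_move) : seq new_facet :=
  pmap (fun t => if rho_at rho t is inr lab then Some (missing lab, (t, lab)) else None)
       (iota 0 (size rho)).

Definition check_inverse (rho : seq tet_move) (new : seq new_facet)
    (rho' : seq tet_move) (new' : seq new_facet) (m : nat) : bool :=
  all (fun t => match rho_at rho t with
    | inl (t', q) => if rho_at rho' t' is inl (t1, q') then
         [&& t1 == t, perm_eq q' (iota 0 4) &
             all (fun v => nth 0%N q' (nth 0%N q v) == v) (iota 0 4)] else false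
    | inr lab => find_new new' (missing lab) == (t, lab)
    end) (iota 0 m) &&
  all (fun i => rho_at rho' (find_new new i).1 == inr (find_new new i).2) (new_labels new).

Definition check_move (B B' : block) (rho : seq tet_move) (new : seq new_facet) : bool :=
  let rho' := back_rho (size (tets B')) rho new in
  let new' := back_new rho in
  [&& (0 < size (tets B))%N, (0 < size (tets B'))%N,
      check_half B B' rho new, check_half B' B rho' new',
      old_labels rho == new_labels new', new_labels new == old_labels rho',
      check_inverse rho new rho' new' (size (tets B)) &
      check_inverse rho' new' rho new (size (tets B'))].

Definition check_ports (B B' : block) (rho : seq tet_move) (new : seq new_facet) : bool :=
  let rho' := back_rho (size (tets B')) rho new in
  let new' := back_new rho in
  [&& check_port B B' rho new false, check_port B B' rho new true,
      check_port B' B rho' new' false & check_port B' B rho' new' true].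

Definition fill (B : block) (A : choiceType) (K : context A) :
  gluing ('I_(size (tets B)) + A)%type := plug B K.
Arguments fill B {A} K.

Section MoveHomeo.
Variables (A : choiceType) (K : context A).
Hypothesis Kwf : context_wf K.

Lemma check_inverseP (m m' : nat) (rho rho' : seq tet_move) (new new' : seq new_facet) :
  (forall i, i \in new_labels new -> ((find_new new i).1 < m'.+1)%N) ->
  (forall t t' q, rho_at rho t = inl (t', q) -> (t < m.+1)%N -> (t' < m'.+1)%N) ->
  check_inverse rho new rho' new' m.+1 ->
  inverse_half (@plug_rho m m' rho A) (@plug_rho m' m rho' A)
    (old_labels rho) (new_labels new)
    (plug_facet m' new A) (fun i => (find_new new i).2)
    (plug_facet m new' A) (fun i => (find_new new' i).2).
Proof.
move=> newlt rholt /andP[/allP H /allP H'].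
have {}H (t : 'I_m.+1) := H t; split.
- move=> [t|a] [t'|a'] q //=.
  + have := H t; rewrite mem_iota ltn_ord => /(_ isT).
    case E : (rho_at rho t) => [[t1 q1]|//] + [<- <-].
    have t1m := rholt _ _ _ E (ltn_ord t).
    rewrite inordK//; case: (rho_at rho' t1) => [[t2 q2]|//].
    case/and3P => /eqP-> q24 /allP qK; exists q2; first by rewrite inord_val.
    by split => // v v4; apply/eqP/qK; rewrite mem_iota.
  + by case: (rho_at rho t) => [[]|].
  + by move=> [<- <-]; exists (iota 0 4) => //; split => //; case=> [|[|[|[|]]]].
- move=> [t|//] lab /=; have := H t; rewrite mem_iota ltn_ord => /(_ isT).
  case: (rho_at rho t) => [[]//|lab1] + [<-].
  by rewrite /plug_facet => /eqP-> /=; rewrite inord_val.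
- move=> i iI; rewrite /plug_facet /= inordK ?newlt//.
  by have /eqP-> := H' i iI.
Qed.

Lemma check_move_homeomorphic (R : realType) (B B' : block) rho new :
  check_move B B' rho new ->
  check_ports B B' rho new \/ [/\ no_ports B, no_ports B' & A -> False] ->
  homeomorphic (space R (fill B K)) (space R (fill B' K)).
Proof.
rewrite /fill => /and5P[].
case Bm : (size (tets B)) => [//|m] _; case Bm' : (size (tets B')) => [//|m'] _.
set rho' := back_rho _ _ _; set new' := back_new _.
move=> H1 H2 /and4P[/eqP E1 /eqP E2 I1 I2] ports.
have h1 : half_move (plug (m := m.+1) B K) (plug (m := m'.+1) B' K) (@plug_rho m m' rho A)
    (old_labels rho) (new_labels new) (plug_facet m' new A) (fun i => (find_new new i).2).
  apply: check_halfP => //; case: ports => [/and4P[p1 p2 _ _]|[? _ ?]]; last by right.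
  by left; case.
have h2 : half_move (plug (m := m'.+1) B' K) (plug (m := m.+1) B K) (@plug_rho m' m rho' A)
    (new_labels new) (old_labels rho) (plug_facet m new' A) (fun i => (find_new new' i).2).
  rewrite E1 E2.
  apply: check_halfP => //; case: ports => [/and4P[_ _ p1 p2]|[_ ? ?]]; last by right.
  by left; case; rewrite /rho' Bm' in p1 p2 *.
have lt1 i : i \in new_labels new -> ((find_new new i).1 < m'.+1)%N.
  by case/and5P: H1 => _ _ _ _ /and3P[/allP H _ _] /H /andP[_]; rewrite Bm'.
have lt2 i : i \in new_labels new' -> ((find_new new' i).1 < m.+1)%N.
  by case/and5P: H2 => _ _ _ _ /and3P[/allP H _ _] /H /andP[_]; rewrite Bm.
have rl1 t t' q : rho_at rho t = inl (t', q) -> (t < m.+1)%N -> (t' < m'.+1)%N.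
  case/and5P: H1 => _ _ _ /allP/(_ t) + _; rewrite mem_iota Bm /check_tet => H E tm.
  by move: H; rewrite tm E => /(_ isT) /andP[]; rewrite Bm'.
have rl2 t t' q : rho_at rho' t = inl (t', q) -> (t < m'.+1)%N -> (t' < m.+1)%N.
  case/and5P: H2 => _ _ _ /allP/(_ t) + _; rewrite mem_iota Bm' /check_tet => H E tm.
  by move: H; rewrite tm E => /(_ isT) /andP[]; rewrite Bm.
apply: (bistellar_homeomorphic _ h1 h2).
- by have := check_inverseP lt1 rl1 I1.
- by rewrite E1 E2; exact: check_inverseP lt2 rl2 I2.
Qed.

End MoveHomeo.

(** * The pieces of the rings and their reductions *)

Definition old_facet (rho : seq tet_move) (i : nat) : nat * seq nat :=
  find_new (back_new rho) i.

(** A recipe that needs no proof: [check_move] examines its result. *)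
Definition apply_move (B : block) (rho : seq tet_move) (new : seq new_facet) (m' : nat) : block :=
  let rho' := back_rho m' rho new in
  let moved t i :=
    let: (k, p) := entry B t i in
    let p' := pcomp p (inverse_perm (shadow_code rho new t i).2) in
    if (k < 2)%N then (k, p') else
    let: (t3, m2) := shadow_code rho new k.-2 (nth 0%N p i) in
    (t3.+2, pcomp m2 p') in
  let face t' j :=
    match rho_at rho' t' with
    | inl (t, q) => moved t (nth 0%N q j)
    | inr lab =>
        let i := missing lab in let b := nth 0%N lab j in
        if b \in new_labels new then
          let: (tb, labb) := find_new new b in
          (tb.+2, [seq index (if l == b then i else l) labb | l <- lab])
        else let: (t, labt) := old_facet rho b in moved t (index i labt)
    end in
  Block [seq [seq face t' j | j <- iota 0 4] | t' <- iota 0 m']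
        (fun b => if no_ports B then port B b else
                  let: (t, s) := port B b in
                  let: (t1, m1) := shadow_code rho new t (nth 0%N s 0) in (t1, pcomp m1 s)).

Definition bistellar := (seq tet_move * seq new_facet)%type.

Definition moved_size (mv : bistellar) : nat :=
  (count (fun r : tet_move => if r is inl _ then true else false) mv.1 + size mv.2)%N.

Fixpoint run_moves (ok : block -> block -> seq tet_move -> seq new_facet -> bool)
    (B : block) (mvs : seq bistellar) (C : block) : bool :=
  match mvs with
  | [::] => [&& tets B == tets C, port B false == port C false & port B true == port C true]
  | mv :: mvs' =>
      let B' := apply_move B mv.1 mv.2 (moved_size mv) in
      [&& check_move B B' mv.1 mv.2, ok B B' mv.1 mv.2 & run_moves ok B' mvs' C]
  end.

(** In the lists of moves the vertices of the 4-simplex are numbered from 0 to 4.  An old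
    tetrahedron is kept, as tetrahedron [t], or is the facet [drop4 a b c d];
    [add i t a b c d] is the new facet opposite [i], which becomes tetrahedron [t]. *)
Definition keep t a b c d : tet_move := inl (t, [:: a; b; c; d]).
Definition drop4 a b c d : tet_move := inr [:: a; b; c; d].
Definition add i t a b c d : new_facet := (i, (t, [:: a; b; c; d])).

Definition bool_pair (x y : face_code) (b : bool) : face_code := if b then y else x.

(** Two faces of the tetrahedron are folded together about their common edge; the
    other two are the ports. *)
Definition blockF : block := Block
  [:: [:: (0, [:: 0; 1; 2; 3]); (2, [:: 0; 2; 1; 3]); (2, [:: 0; 2; 1; 3]); (1, [:: 3; 1; 2; 0])]]%N
  (bool_pair (0, [:: 0; 1; 2; 3]) (0, [:: 3; 1; 2; 0]))%N.

(** The second tetrahedron has two faces folded together, and the other two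
    glued to faces of the first. *)
Definition blockP : block := Block
  [:: [:: (0, [:: 0; 1; 2; 3]); (1, [:: 1; 0; 2; 3]); (3, [:: 1; 0; 2; 3]); (3, [:: 1; 0; 2; 3])];
      [:: (3, [:: 1; 0; 2; 3]); (3, [:: 1; 0; 2; 3]); (2, [:: 1; 0; 2; 3]); (2, [:: 1; 0; 2; 3])]]%N
  (bool_pair (0, [:: 0; 1; 2; 3]) (0, [:: 1; 0; 2; 3]))%N.

(** [blockF] with the labels of its bottom port rotated. *)
Definition blockT : block := Block
  [:: [:: (0, [:: 0; 3; 1; 2]); (2, [:: 0; 2; 1; 3]); (2, [:: 0; 2; 1; 3]); (1, [:: 3; 1; 2; 0])]]%N
  (bool_pair (0, [:: 0; 2; 3; 1]) (0, [:: 3; 1; 2; 0]))%N.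

Definition stack (B S : block) : block :=
  let m := size (tets B) in
  let up (x : face_code) : face_code :=
    if x.1 == 1%N then ((port S false).1 + m + 2, pcomp (port S false).2 x.2)%N else x in
  let down (x : face_code) : face_code :=
    if x.1 == 0%N then ((port B true).1 + 2, pcomp (port B true).2 x.2)%N
    else if x.1 == 1%N then x else (x.1 + m, x.2)%N in
  Block (map (map up) (tets B) ++ map (map down) (tets S))
        (bool_pair (port B false) ((port S true).1 + m, (port S true).2)%N).

(** [blockF] with its two ports glued by the rotation that closes the rings. *)
Definition blockC : block := Block
  [:: [:: (2, [:: 3; 0; 1; 2]); (2, [:: 0; 2; 1; 3]); (2, [:: 0; 2; 1; 3]); (2, [:: 1; 2; 3; 0])]]%N
  (bool_pair (0, [:: 0; 1; 2; 3]) (0, [:: 0; 1; 2; 3]))%N.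

Definition blockD : block := Block
  [:: nseq 4 (3, [:: 0; 1; 2; 3]); nseq 4 (2, [:: 0; 1; 2; 3])]%N
  (bool_pair (0, [:: 0; 1; 2; 3]) (0, [:: 0; 1; 2; 3]))%N.

Definition moves_FP : seq bistellar :=
[:: ([:: drop4 0 1 2 3; drop4 4 1 2 0; keep 0 0 1 2 3], [:: add 0 1 1 2 3 4; add 1 2 0 2 3 4; add 2 3 0 1 3 4]);
  ([:: drop4 4 3 0 1; drop4 4 0 2 3; keep 0 0 1 2 3; drop4 1 4 2 3], [:: add 3 1 0 1 2 4; add 4 2 0 1 2 3]);
  ([:: drop4 4 0 3 1; drop4 2 4 3 0; drop4 2 4 3 1], [:: add 3 0 0 1 2 4; add 4 1 0 1 2 3]);
  ([:: keep 0 0 1 2 3; drop4 0 1 2 3], [:: add 0 1 1 2 3 4; add 1 2 0 2 3 4; add 2 3 0 1 3 4; add 3 4 0 1 2 4]);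
  ([:: keep 0 0 1 2 3; drop4 0 4 1 3; drop4 2 4 1 3; keep 1 0 1 2 3; drop4 2 0 4 3], [:: add 3 2 0 1 2 4; add 4 3 0 1 2 3]);
  ([:: keep 0 0 1 2 3; drop4 0 4 3 1; drop4 4 3 2 0; drop4 4 3 2 1], [:: add 3 1 0 1 2 4; add 4 2 0 1 2 3]);
  ([:: drop4 0 1 2 3; drop4 2 4 0 1; keep 0 0 1 2 3], [:: add 0 1 1 2 3 4; add 1 2 0 2 3 4; add 2 3 0 1 3 4]);
  ([:: drop4 0 1 2 3; keep 0 0 1 2 3; drop4 2 0 4 1; keep 1 0 1 2 3], [:: add 0 2 1 2 3 4; add 1 3 0 2 3 4; add 2 4 0 1 3 4]);
  ([:: drop4 0 4 3 1; keep 0 0 1 2 3; keep 1 0 1 2 3; drop4 4 0 2 3; drop4 4 1 2 3], [:: add 3 2 0 1 2 4; add 4 3 0 1 2 3]);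
  ([:: drop4 0 1 2 4; drop4 4 0 3 2; drop4 1 4 3 0; drop4 1 4 3 2], [:: add 4 0 2 1 0 3])]%N.

Definition moves_FF : seq bistellar :=
[:: ([:: drop4 0 1 2 3; drop4 4 1 2 0], [:: add 0 0 1 2 3 4; add 1 1 0 2 3 4; add 2 2 0 1 3 4]);
  ([:: drop4 3 0 1 2; drop4 4 0 1 2; keep 0 0 1 2 3], [:: add 0 1 1 2 3 4; add 1 2 0 2 3 4; add 2 3 0 1 3 4]);
  ([:: drop4 4 1 2 3; drop4 2 3 0 4; drop4 1 3 0 4; drop4 1 2 0 4], [:: add 4 0 3 0 1 2])]%N.

Definition moves_FT : seq bistellar :=
[:: ([:: drop4 0 1 2 3; keep 0 0 1 2 3], [:: add 0 1 1 2 3 4; add 1 2 0 2 3 4; add 2 3 0 1 3 4; add 3 4 0 1 2 4]);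
  ([:: keep 0 0 1 2 3; drop4 4 0 1 3; keep 1 0 1 2 3; drop4 2 4 1 3; drop4 2 4 0 3], [:: add 3 2 0 1 2 4; add 4 3 0 1 2 3]);
  ([:: keep 0 0 1 2 3; drop4 4 0 3 1; drop4 2 3 4 0; drop4 2 3 4 1], [:: add 3 1 0 1 2 4; add 4 2 0 1 2 3]);
  ([:: drop4 3 0 1 2; drop4 1 4 2 0; keep 0 0 1 2 3], [:: add 0 1 1 2 3 4; add 1 2 0 2 3 4; add 2 3 0 1 3 4]);
  ([:: drop4 0 1 2 3; drop4 0 2 4 1; keep 0 0 1 2 3; keep 1 0 1 2 3], [:: add 0 2 1 2 3 4; add 1 3 0 2 3 4; add 2 4 0 1 3 4]);
  ([:: drop4 0 4 3 1; keep 0 0 1 2 3; drop4 1 4 2 3; drop4 0 4 2 3; keep 1 0 1 2 3], [:: add 3 2 0 1 2 4; add 4 3 0 1 2 3]);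
  ([:: drop4 0 1 2 4; drop4 1 4 3 2; drop4 0 4 3 1; drop4 0 4 3 2], [:: add 4 0 2 0 1 3])]%N.

Definition moves_C : seq bistellar :=
[:: ([:: drop4 0 1 2 3], [:: add 0 0 1 2 3 4; add 1 1 0 2 3 4; add 2 2 0 1 3 4; add 3 3 0 1 2 4]);
  ([:: drop4 4 0 1 3; keep 0 0 1 2 3; drop4 2 4 1 3; drop4 2 4 0 3], [:: add 3 1 0 1 2 4; add 4 2 0 1 2 3]);
  ([:: drop4 4 0 3 1; drop4 2 3 4 0; drop4 2 3 4 1], [:: add 3 0 0 1 2 4; add 4 1 0 1 2 3]);
  ([:: drop4 0 1 2 3; keep 0 0 1 2 3], [:: add 0 1 1 2 3 4; add 1 2 0 2 3 4; add 2 3 0 1 3 4; add 3 4 0 1 2 4]);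
  ([:: keep 0 0 1 2 3; drop4 0 4 1 3; drop4 2 4 1 3; keep 1 0 1 2 3; drop4 2 0 4 3], [:: add 3 2 0 1 2 4; add 4 3 0 1 2 3]);
  ([:: keep 0 0 1 2 3; drop4 0 4 3 1; drop4 4 3 2 0; drop4 4 3 2 1], [:: add 3 1 0 1 2 4; add 4 2 0 1 2 3]);
  ([:: drop4 0 3 1 2; keep 0 0 1 2 3; drop4 2 4 1 0], [:: add 0 1 1 2 3 4; add 1 2 0 2 3 4; add 2 3 0 1 3 4]);
  ([:: drop4 0 3 1 2; keep 0 0 1 2 3; keep 1 0 1 2 3; drop4 1 0 2 4], [:: add 0 2 1 2 3 4; add 1 3 0 2 3 4; add 2 4 0 1 3 4]);
  ([:: keep 0 0 1 2 3; drop4 4 0 1 3; drop4 4 1 2 3; keep 1 0 1 2 3; drop4 0 4 2 3], [:: add 3 2 0 1 2 4; add 4 3 0 1 2 3]);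
  ([:: drop4 4 0 3 1; drop4 4 3 2 1; drop4 0 3 2 4; keep 0 0 1 2 3], [:: add 3 1 0 1 2 4; add 4 2 0 1 2 3]);
  ([:: drop4 0 1 4 3; drop4 2 3 4 0; drop4 2 3 4 1], [:: add 3 0 0 1 2 4; add 4 1 0 1 2 3]);
  ([:: drop4 0 1 2 3; keep 0 0 1 2 3], [:: add 0 1 1 2 3 4; add 1 2 0 2 3 4; add 2 3 0 1 3 4; add 3 4 0 1 2 4]);
  ([:: keep 0 0 1 2 3; drop4 0 4 1 3; drop4 2 4 1 3; keep 1 0 1 2 3; drop4 2 0 4 3], [:: add 3 2 0 1 2 4; add 4 3 0 1 2 3]);
  ([:: keep 0 0 1 2 3; drop4 0 4 3 1; drop4 4 3 2 0; drop4 4 3 2 1], [:: add 3 1 0 1 2 4; add 4 2 0 1 2 3]);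
  ([:: drop4 4 0 3 1; drop4 3 2 4 0; drop4 3 2 4 1], [:: add 3 0 0 1 2 4; add 4 1 0 1 2 3])]%N.

Definition ok_closed (B B' : block) (rho : seq tet_move) (new : seq new_facet) : bool :=
  no_ports B && no_ports B'.

(** The moves leave the ports where they are: [blockF] absorbs each of the three pieces
    when it is stacked on top. *)
Lemma FP_F : run_moves check_ports (stack blockF blockP) moves_FP blockF.
Proof. by vm_compute. Qed.
Lemma FF_F : run_moves check_ports (stack blockF blockF) moves_FF blockF.
Proof. by vm_compute. Qed.
Lemma FT_F : run_moves check_ports (stack blockF blockT) moves_FT blockF.
Proof. by vm_compute. Qed.
(** The ring of a single [blockF] becomes the double of a tetrahedron. *)
Lemma C_D : run_moves ok_closed blockC moves_C blockD.
Proof. by vm_compute. Qed.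

(** * Stacking blocks *)

Lemma homeomorphic_refl (X : topologicalType) : homeomorphic X X.
Proof. by exists id, id; split => // x; exact: cvg_id. Qed.

Lemma space_reindex (R : realType) (J J' : choiceType) (G : gluing J) (G' : gluing J')
    (f : J -> J') (g : J' -> J) :
  cancel f g -> cancel g f ->
  (forall x i y p, (i < 4)%N -> G x i y p <-> G' (f x) i (f y) p) ->
  homeomorphic (space R G) (space R G').
Proof.
move=> fK gK GG'.
pose F (x : cells R J) : cells R J' := cell (f (tag x)) (tagged x).
pose F' (x : cells R J') : cells R J := cell (g (tag x)) (tagged x).
apply: (@space_homeomorphic _ _ _ _ _ F F').
- move=> [t x] U nU; apply: (@continuous_comp _ _ _ (cell (f t)) (to_space G')) nU.
    exact: cell_continuous.
  exact: to_space_continuous.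
- move=> [t x] U nU; apply: (@continuous_comp _ _ _ (cell (g t)) (to_space G)) nU.
    exact: cell_continuous.
  exact: to_space_continuous.
- move=> x y [i [p [i4 Gp xi yx]]]; apply: glued_same; exists i, p; split => //.
  exact/GG'.
- move=> x y [i [p [i4 Gp xi yx]]]; apply: glued_same; exists i, p; split => //.
  by apply/GG' => //; rewrite !gK.
- by move=> [t x]; rewrite /F /F' /cell /= fK; exact: same_point_refl.
- by move=> [t x]; rewrite /F /F' /cell /= gK; exact: same_point_refl.
Qed.

Lemma run_moves_homeomorphic (R : realType)
    (ok : block -> block -> seq tet_move -> seq new_facet -> bool) (A : choiceType) (K : context A) :
  context_wf K ->
  (forall B B' rho new, ok B B' rho new ->
    check_ports B B' rho new \/ [/\ no_ports B, no_ports B' & A -> False]) ->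
  forall mvs B C, run_moves ok B mvs C ->
  homeomorphic (space R (fill B K)) (space R (fill C K)).
Proof.
move=> Kwf okP; elim=> [|mv mvs IH] B C /=.
  case: B C => [Bt Bp] [Ct Cp] /= /and3P[/eqP-> /eqP e0 /eqP e1].
  rewrite (_ : Bp = Cp); first exact: homeomorphic_refl.
  by apply/funext => -[].
case/and3P=> h okh /IH; apply: homeomorphic_trans.
exact: check_move_homeomorphic h (okP _ _ _ _ okh).
Qed.

Section Stack.
Variables (A : choiceType) (K : context A).

Definition plug_next (B : block) (x : nat + A) (i : nat) : (nat + A) * seq nat :=
  match x with
  | inl t =>
      let: (k, q) := entry B t i in
      if k is k'.+2 then (inl k', q) else
      match outer_port K (k == 1%N) with
      | inl (a, r) => (inr a, pcomp r q)
      | inr (b, r) => (inl (port B b).1, pcomp (port B b).2 (pcomp r q))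
      end
  | inr a =>
      match outer_face K a i with
      | inl (a', p) => (inr a', p)
      | inr (b, q) => (inl (port B b).1, pcomp (port B b).2 q)
      end
  end.

Definition raw m (x : 'I_m + A) : nat + A :=
  match x with inl t => inl (val t) | inr a => inr a end.

Lemma plugP m B (x y : 'I_m + A) i p :
  plug B K x i y p <-> plug_next B (raw x) i = (raw y, p).
Proof.
case: x y => [t|a] [t'|a'] /=.
- case: (entry B t i) => [[|[|k]] q]; split.
  + case=> [[]//|[b [q' [b' [r [s [[]]]]]]]]; case: b => //= _ <- -> -> ->.
    by [].
  + case E : (outer_port K _) => [[]//|[b r]] [e <-]; right.
    exists false, q, b, r, (port B b).2; split => //.
    by rewrite -e -surjective_pairing.
  + case=> [[]//|[b [q' [b' [r [s [[]]]]]]]]; case: b => //= _ <- -> -> ->.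
    by [].
  + case E : (outer_port K _) => [[]//|[b r]] [e <-]; right.
    exists true, q, b, r, (port B b).2; split => //.
    by rewrite -e -surjective_pairing.
  + by case=> [[-> ->]//|[b [q' [b' [r [s [[]]]]]]]]; case: b.
  + by move=> [-> ->]; left.
- case: (entry B t i) => [[|[|k]] q]; split.
  + by case=> b [q' [r [[]]]]; case: b => //= _ <- -> ->.
  + case E : (outer_port K _) => [[a r]|[]//] [<- <-].
    by exists false, q, r.
  + by case=> b [q' [r [[]]]]; case: b => //= _ <- -> ->.
  + case E : (outer_port K _) => [[a r]|[]//] [<- <-].
    by exists true, q, r.
  + by case=> b [q' [r [[]]]]; case: b.
  + by [].
- split; first by case=> b [q [s [-> -> ->]]].
  case: (outer_face K a i) => [[]//|[b q]] [e <-].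
  by exists b, q, (port B b).2; rewrite -e -surjective_pairing.
- split; first by move=> ->.
  by case: (outer_face K a i) => [[a2 q] [-> ->]|[]].
Qed.

End Stack.

Definition block_wf (B : block) : bool :=
  all (fun t => all (fun i => let: (k, p) := entry B t i in
         [&& (k < size (tets B) + 2)%N, perm_eq p (iota 0 4) &
             (k < 2)%N ==> (nth 0%N p i == 0%N)]) (iota 0 4)) (iota 0 (size (tets B))) &&
  all (fun b => ((port B b).1 < size (tets B))%N && perm_eq (port B b).2 (iota 0 4))
      [:: false; true] && all (fun r => size r == 4%N) (tets B).

Lemma block_wf_entry B t i k p : block_wf B -> (t < size (tets B))%N -> (i < 4)%N ->
  entry B t i = (k, p) -> [/\ (k < size (tets B) + 2)%N, perm_eq p (iota 0 4) &
    (k < 2)%N -> nth 0%N p i = 0%N].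
Proof.
move=> /andP[/andP[/allP H _] _] tB i4 E.
have tI : t \in iota 0 (size (tets B)) by rewrite mem_iota.
have iI : i \in iota 0 4 by rewrite mem_iota.
have /allP /(_ _ iI) := H t tI; rewrite E.
by case/and3P => ? ? /implyP h; split => // /h /eqP.
Qed.

Lemma block_wf_port B b : block_wf B ->
  ((port B b).1 < size (tets B))%N /\ perm_eq (port B b).2 (iota 0 4).
Proof. by case/andP => /andP[_ /and3P[/andP[? ?] /andP[? ?] _]] _; case: b. Qed.

Lemma pcompA s r q : size r = 4%N -> perm_eq q (iota 0 4) ->
  pcomp (pcomp s r) q = pcomp s (pcomp r q).
Proof.
move=> r4 q4; rewrite [RHS]/pcomp -map_comp; apply/eq_in_map => v.
by rewrite (perm_mem q4) mem_iota => /andP[_ v4]; rewrite /= (nth_map 0%N) ?r4.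
Qed.

Section Attach.
Variables (m : nat) (S : block) (A : choiceType) (K : context A).

Definition extended : choiceType := ('I_m.+1 + A)%type.

Definition close_port (x : (A * seq nat) + (bool * seq nat)) :
    (extended * seq nat) + (bool * seq nat) :=
  match x with
  | inl (a, r) => inl (inr a, r)
  | inr (b, r) =>
      if b then inl (inl (inord (port S true).1), pcomp (port S true).2 r)
      else inr (false, r)
  end.

Definition close_up (x : (A * seq nat) + (bool * seq nat)) (p : seq nat) :
    (extended * seq nat) + (bool * seq nat) :=
  match close_port x with
  | inl (j, r) => inl (j, pcomp r p)
  | inr (b, r) => inr (b, pcomp r p)
  end.

(** The surroundings of [B] in the stack of [S] on [B]: the tetrahedra of [S] join those
    of the context. *)
Definition attach : context extended := Context
  (fun (x : extended) i => match x with
    | inl t => let: (k, p) := entry S t i in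
        match k with
        | 0 => inr (true, p)
        | 1 => close_up (outer_port K true) p
        | k'.+2 => inl (inl (inord k'), p)
        end
    | inr a =>
        match outer_face K a i with
        | inl (a', p) => inl (inr a', p)
        | inr (b, p) =>
            if b then inl (inl (inord (port S true).1), pcomp (port S true).2 p)
            else inr (false, p)
        end
    end)
  (fun b => if b then inl (inl (inord (port S false).1), (port S false).2)
            else close_port (outer_port K false)).

Hypotheses (Sm : size (tets S) = m.+1) (Swf : block_wf S) (Kwf : context_wf K).

Lemma close_port_wf b :
  (forall j p, close_port (outer_port K b) = inl (j, p) -> perm_eq p (iota 0 4)) /\
  (forall b' p, close_port (outer_port K b) = inr (b', p) ->
    perm_eq p (iota 0 4) /\ nth 0%N p 0 = 0%N).
Proof.
rewrite /close_port; case E : (outer_port K b) => [[a r]|[[] r]]; split => // j p [_ <-].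
- exact: (wf_port Kwf E).
- exact: perm4_comp (block_wf_port true Swf).2 (wf_port_port Kwf E).1.
- exact: (wf_port_port Kwf E).
Qed.

Lemma attach_wf : context_wf attach.
Proof.
have P b := block_wf_port b Swf.
split.
- move=> [t|a] i a' p i4 /=.
    case E : (entry S t i) => [k q].
    have [] := block_wf_entry Swf _ i4 E; rewrite ?Sm// => _ q4 _.
    case: k E => [//|[|k]] E; last by move=> [_ <-].
    rewrite /close_up; have [H _] := close_port_wf true.
    case: (close_port _) H => [[j r]|[]//] H [_ <-].
    exact: perm4_comp (H _ _ erefl) q4.
  case E : (outer_face K a i) => [[a2 q]|[[] q]] // [_ <-].
    exact: (wf_face Kwf i4 E).
  exact: perm4_comp (P true).2 (wf_face_port Kwf i4 E).1.
- move=> [t|a] i b p i4 /=.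
    case E : (entry S t i) => [k q].
    have [] := block_wf_entry Swf _ i4 E; rewrite ?Sm// => _ q4 qi.
    case: k E qi => [|[|//]] E qi; first by move=> [_ <-]; split => //; exact: qi.
    rewrite /close_up; have [_ H] := close_port_wf true.
    case: (close_port _) H => [[]//|[b' r]] H [_ <-].
    have [r4 r0] := H _ _ erefl.
    split; first exact: perm4_comp r4 q4.
    by rewrite comp_nth ?(perm_size q4)// qi.
  case E : (outer_face K a i) => [[]//|[[]// q]] [_ <-].
  exact: (wf_face_port Kwf i4 E).
- move=> [] a p; first by move=> [_ <-]; exact: (P false).2.
  exact: (close_port_wf false).1.
- move=> [] b' p //; exact: (close_port_wf false).2.
Qed.

Variables (n : nat) (B : block).
Hypotheses (Bn : size (tets B) = n.+1) (Bwf : block_wf B).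

Definition unstack (x : 'I_(n.+1 + m.+1) + A) : 'I_n.+1 + ('I_m.+1 + A) :=
  match x with
  | inl t => match fintype.split t with inl u => inl u | inr v => inr (inl v) end
  | inr a => inr (inr a)
  end.

Definition restack (x : 'I_n.+1 + ('I_m.+1 + A)) : 'I_(n.+1 + m.+1) + A :=
  match x with
  | inl u => inl (lshift _ u)
  | inr (inl v) => inl (rshift _ v)
  | inr (inr a) => inr a
  end.

Lemma unstackK : cancel unstack restack.
Proof. by move=> [t|//] /=; case: splitP => j tj /=; congr inl; apply: val_inj. Qed.

Lemma restackK : cancel restack unstack.
Proof.
move=> [u|[v|//]] /=; case: splitP => j /= /eqP.
- by move=> /eqP uj; congr inl; apply: val_inj.
- by move=> /eqP uj; have := ltn_ord u; rewrite uj ltnNge leq_addr.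
- by move=> /eqP uj; have := ltn_ord j; rewrite -uj ltnNge leq_addr.
- by rewrite eqn_add2l => /eqP uj; congr (inr (inl _)); apply: val_inj.
Qed.

Definition flat (z : nat + ('I_m.+1 + A)) : nat + A :=
  match z with
  | inl t => inl t
  | inr (inl v) => inl (n.+1 + v)%N
  | inr (inr a) => inr a
  end.

Lemma flat_raw x : flat (raw x) = raw (restack x).
Proof. by case: x => [|[]]. Qed.

Definition up_face (x : face_code) : face_code :=
    if x.1 == 1%N then ((port S false).1 + size (tets B) + 2, pcomp (port S false).2 x.2)%N else x.
Definition down_face (x : face_code) : face_code :=
    if x.1 == 0%N then ((port B true).1 + 2, pcomp (port B true).2 x.2)%N
    else if x.1 == 1%N then x else (x.1 + size (tets B), x.2)%N.

Lemma entry_stack t i : (i < 4)%N -> (t < n.+1 + m.+1)%N ->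
  entry (stack B S) t i =
  if (t < n.+1)%N then up_face (entry B t i) else down_face (entry S (t - n.+1) i).
Proof.
move=> i4 tmn; rewrite /entry /stack /= nth_cat size_map Bn.
case: ltnP => tn.
  rewrite (nth_map [::]) ?Bn// (nth_map (0%N, [::])) /up_face ?Bn//.
  case/andP: Bwf => _ /allP H.
  by rewrite (eqP (H (nth [::] (tets B) t) _))// mem_nth// Bn.
have tm : (t - n.+1 < m.+1)%N by rewrite ltn_subLR.
rewrite (nth_map [::]) ?Sm// (nth_map (0%N, [::])) /down_face ?Bn//.
case/andP: Swf => _ /allP H.
by rewrite (eqP (H (nth [::] (tets S) (t - n.+1)) _))// mem_nth// Sm.
Qed.

Lemma stack_next (x : 'I_n.+1 + ('I_m.+1 + A)) i : (i < 4)%N ->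
  let z := plug_next attach B (raw x) i in
  plug_next K (stack B S) (flat (raw x)) i = (flat z.1, z.2) /\
  (if z.1 is inl t then (t < n.+1)%N else true).
Proof.
move=> i4; have P b := block_wf_port b Swf; have Q b := block_wf_port b Bwf.
rewrite Sm in P; rewrite Bn in Q.
case: x => [u|[v|a]]; rewrite /flat /raw /plug_next.
- rewrite entry_stack//; last exact: leq_trans (ltn_ord u) (leq_addr _ _).
  rewrite ltn_ord; case E : (entry B u i) => [k q].
  have [] := block_wf_entry Bwf _ i4 E; rewrite ?Bn// => kB q4 _.
  case: k E kB => [|[|k]] E kB; rewrite /up_face /=.
  + rewrite /close_port; case Kf : (outer_port K false) => [[a r]|[[] r]] //=.
    * have [r4 _] := wf_port_port Kwf Kf.
      split => //; congr (inl _, _); first by rewrite Bn addnC inordK ?(P true).1.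
      by rewrite pcompA// (perm_size r4).
    * by split => //; exact: (Q false).1.
  + rewrite addn2 Bn; split => //; congr (inl _, _).
    by rewrite addnC inordK ?(P false).1.
  + by split => //; move: kB; rewrite addn2.
- rewrite entry_stack ?ltn_add2l// ltnNge leq_addr /= addKn.
  case E : (entry S v i) => [k q].
  have [] := block_wf_entry Swf _ i4 E; rewrite ?Sm// => kS q4 _.
  case: k E kS => [|[|k]] E kS; rewrite /down_face /=.
  + by rewrite addn2; split => //; exact: (Q true).1.
  + rewrite /close_up /close_port; case Kt : (outer_port K true) => [[a r]|[[] r]] //=.
    * have [r4 _] := wf_port_port Kwf Kt.
      split => //; congr (inl _, _); first by rewrite Bn addnC inordK ?(P true).1.
      by rewrite pcompA// (perm_size r4).
    * by split => //; exact: (Q false).1.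
  + split => //; congr (inl _, _); rewrite Bn addnC inordK//.
    by move: kS; rewrite addn2.
- case E : (outer_face K a i) => [[a' p]|[[] p]]; rewrite /= E //=.
  + by rewrite Bn addnC inordK ?(P true).1.
  + by split => //; exact: (Q false).1.
Qed.

Lemma stack_homeomorphic (R : realType) :
  homeomorphic (space R (plug (m := n.+1 + m.+1) (stack B S) K))
               (space R (plug (m := n.+1) B attach)).
Proof.
apply: (space_reindex _ unstackK restackK) => x i y p i4.
rewrite !plugP; have [] := stack_next (unstack x) i4.
rewrite !flat_raw !unstackK => -> H.
split=> [[e <-]|e].
  rewrite [LHS]surjective_pairing; congr pair; move: H e.
  rewrite (_ : raw y = flat (raw (unstack y))); last by rewrite flat_raw unstackK.
  case: (plug_next _ _ _ _).1 => [t|[v|a]]; case: (unstack y) => [u|[v'|a']] //= H [].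
  - by move=> ->.
  - by move=> tv; move: H; rewrite tv ltnNge leq_addr.
  - by move=> vu; have := ltn_ord u; rewrite -vu ltnNge leq_addr.
  - by move/eqP; rewrite eqn_add2l => /eqP vv; congr (inr (inl _)); apply: val_inj.
  - by move=> ->.
by rewrite e /= flat_raw unstackK.
Qed.

End Attach.

(** * The double of a tetrahedron is a manifold *)

Section Double.
Variable R : realType.
Local Notation tet := (tetrahedron R).

Definition double_gluing : gluing bool :=
  fun b _ b' p => b' = ~~ b /\ p = iota 0 4.

Definition double : topologicalType := space R double_gluing.

(** All gluings fix the coordinates, so that the relation on the right is already an
    equivalence. *)
Lemma double_same (b b' : bool) (x x' : tet) :
  same_point double_gluing (cell b x) (cell b' x') <->
  x = x' /\ (b = b' \/ exists2 i, (i < 4)%N & coord x i = 0).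
Proof.
split; last first.
  move=> [<- [<-|[i i4 xi]]]; first exact: same_point_refl.
  have [->|bb'] := eqVneq b b'; first exact: same_point_refl.
  apply: glued_same; exists i, (iota 0 4); split => //=.
    by split => //; move: bb'; case: (b); case: (b').
  by case=> [|[|[|[|]]]].
pose P (y y' : cells R bool) := tagged y = tagged y' /\
  (tag y = tag y' \/ exists2 i, (i < 4)%N & coord (tagged y) i = 0).
suff H y y' : same_point double_gluing y y' -> P y y' by move=> /H.
move=> /asboolP; elim=> {y y'} [y y'|y|y y' _ [e h]|y y' z _ [e h] _ [e' h']].
- move=> [i [p [i4 [_ ->] yi yy]]]; split; last by right; exists i.
  by apply: coord_inj => v v4; rewrite -yy// (nth_iota _ _ v4).
- by split => //; left.
- by split => //; case: h => [->|[i i4 yi]]; [left|right; exists i; rewrite // -e].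
- split; first by rewrite e.
  case: h => [t|[i i4 yi]]; last by right; exists i.
  by case: h' => [t'|[i i4 yi]]; [left; rewrite t|right; exists i; rewrite // e].
Qed.

Definition side (b : bool) : R := if b then 1 else -1.

Lemma double_map (X : topologicalType) (F : cells R bool -> X) :
  (forall b, continuous (F \o cell b)) ->
  (forall x i, (i < 4)%N -> coord x i = 0 -> F (cell true x) = F (cell false x)) ->
  exists2 f : double -> X, continuous f & forall y, f (to_space double_gluing y) = F y.
Proof.
move=> cF F0.
have FF y y' : to_space double_gluing y = to_space double_gluing y' -> F y = F y'.
  case: y y' => [b x] [b' x'] /to_spaceP /double_same [<- [<- //|[i i4 xi]]].
  by case: (b); case: (b') => //; have := F0 _ _ i4 xi.
exists (F \o generic_quotient.repr).
  apply: repr_comp_continuous; last by move=> y y' /eqP /FF /eqP.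
  by move=> [b x] A nA; exact: (cF b x A nA).
move=> y /=; apply: FF; exact: reprK.
Qed.

End Double.

Lemma hausdorff_inj (X Y : topologicalType) (f : X -> Y) :
  hausdorff_space Y -> continuous f -> injective f -> hausdorff_space X.
Proof.
move=> hY cf fI p q clpq; apply: fI; apply: hY => U V Up Vq.
have [z [Uz Vz]] : f @^-1` U `&` f @^-1` V !=set0.
  by apply: clpq; [exact: cf|exact: cf].
by exists (f z).
Qed.

Lemma rV_second_countable (R : realType) n : second_countable (T := 'rV[R]_n).
Proof.
pose B := [set U : set 'rV[R]_n | exists (q : 'rV[rat]_n) (k : nat),
  U = ball (map_mx ratr q : 'rV[R]_n) k.+1%:R^-1].
exists B.
  have -> : B = (fun qk : 'rV[rat]_n * nat =>
      ball (map_mx ratr qk.1 : 'rV[R]_n) qk.2.+1%:R^-1) @` setT.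
    apply/seteqP; split=> [U [q [k ->]]|U [[q k] _ <-]]; first by exists (q, k).
    by exists q, k.
  apply: (@sub_countable _ _ _ [set: 'rV[rat]_n * nat]); first exact: card_image_le.
  exact: countableP.
split; first by move=> U [q [k ->]]; exact: ball_open.
move=> x A /nbhs_ballP [e /= e0 eA].
have [k ke] : exists k, k.+1%:R^-1 < e / 2.
  have [k] := ltr_add_invr (divr_gt0 e0 (ltr0n R 2)).
  by rewrite add0r => ke; exists k.
have [q qx] : exists q : 'rV[rat]_n, ball (map_mx ratr q : 'rV[R]_n) k.+1%:R^-1 x.
  have k0 : 0 < k.+1%:R^-1 :> R by rewrite invr_gt0.
  have qP (j : 'I_n) : exists q : rat, ball (ratr q : R) k.+1%:R^-1 (x 0 j).
    have xlt : x 0 j < x 0 j + k.+1%:R^-1 by rewrite ltrDl.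
    have [q] := rat_in_itvoo xlt; rewrite in_itv /= => /andP[q1 q2].
    by exists q; rewrite /ball /= gtr0_norm ?subr_gt0// ltrBlDl.
  pose q j := sval (cid (qP j)).
  exists (\row_j q j); split => // i j.
  by rewrite !mxE ord1; exact: svalP (cid (qP j)).
exists (ball (map_mx ratr q : 'rV[R]_n) k.+1%:R^-1).
  by split => //; exists q, k.
move=> y qy; apply: eA; rewrite [e]splitr.
apply: (@ball_triangle _ _ (map_mx ratr q : 'rV[R]_n)).
  by apply: ball_sym; apply: le_ball qx; exact: ltW.
by apply: le_ball qy; exact: ltW.
Qed.

(** A continuous injection of a compact space into a Hausdorff space
    is an embedding, so that a basis can be pulled back along it. *)
Lemma compact_second_countable_inj (R : realType) n (X : topologicalType)
    (f : X -> 'rV[R]_n) :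
  compact [set: X] -> continuous f -> injective f -> second_countable (T := X).
Proof.
move=> cX cf fI; have [B cB [oB nB]] := rV_second_countable R n.
exists [set f @^-1` U | U in B].
  by apply: sub_countable cB; exact: card_image_le.
split; first by move=> _ [U BU <-]; apply: open_comp => //; exact: oB.
move=> x A nA; have [U [oU Ux UA]] : exists U, [/\ open U, U x & U `<=` A].
  by move: nA; rewrite nbhsE => -[U [? ?] ?]; exists U.
have fC : closed (f @` (~` U)).
  apply: compact_closed; first exact: norm_hausdorff.
  apply: continuous_compact; first exact: continuous_subspaceT.
  by apply: (subclosed_compact _ cX) => //; exact: open_closedC.
have : nbhs (f x) (~` (f @` (~` U))).
  apply: open_nbhs_nbhs; split; first exact: closed_openC.
  by move=> [z nz /fI zx]; apply: nz; rewrite zx.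
move=> /nB [V /= [BV Vfx] VU].
exists (f @^-1` V); first by split => //=; exists V.
move=> z /= /VU nfz; apply: UA; apply: contrapT => nUz; apply: nfz.
by exists z.
Qed.

Section DoubleManifold.
Variable R : realType.
Local Notation tet := (tetrahedron R).

Lemma tetrahedron_compact : compact [set: tet].
Proof.
have cT : compact (tetrahedron R : set 'rV[R]_4).
  apply: bounded_closed_compact.
    exists 1; split => // M M1 x [x0 x1] /=.
    apply: le_trans (ltW M1).
    case: (eqVneq (mx_norm x) 0) => [e|/mx_norm_neq0[[i j] /= xE]].
      by rewrite [leLHS]e.
    rewrite [leLHS]xE ord1 ger0_norm ?x0// -x1 (bigD1 j)//= lerDl.
    by rewrite sumr_ge0.
  rewrite (_ : tetrahedron R = \bigcap_(v in [set: 'I_4]) [set x : 'rV[R]_4 | 0 <= x 0 v] `&`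
      (fun x : 'rV[R]_4 => \sum_v x 0 v) @^-1` [set 1]).
    apply: closedI.
      apply: closed_bigI => v _.
      have /continuous_closedP : continuous (fun x : 'rV[R]_4 => x 0 v).
        exact: coord_continuous.
      by move=> /(_ _ (@closed_ge R 0)).
    have /continuous_closedP : continuous (fun x : 'rV[R]_4 => \sum_v x 0 v).
      by apply: continuous_big => [|v _]; [exact: add_continuous|exact: coord_continuous].
    by move=> /(_ _ (@closed_eq R 1)).
  by apply/seteqP; split=> x [x0 x1]; split => // v; [move=> _; exact: x0|exact: x0].
pose f (v : 'rV[R]_4) : tet := point_of (fun j => v 0 (inord j)).
have -> : [set: tet] = f @` tetrahedron R.
  apply/seteqP; split=> x // _; exists (\val x); first exact: set_valP.
  by rewrite -[RHS]point_coord.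
apply: continuous_compact => //; apply/subspace_sigL_continuousP.
rewrite (_ : sigL _ _ = id); first by move=> x; exact: cvg_id.
by apply/funext => x; rewrite /sigL /= -[RHS]point_coord.
Qed.

Lemma double_compact : compact [set: double R].
Proof.
have -> : [set: double R] = to_space (double_gluing) @` [set: cells R bool].
  apply/seteqP; split=> x // _; exists (generic_quotient.repr x) => //; exact: reprK.
apply: continuous_compact; first exact/continuous_subspaceT/to_space_continuous.
by apply: sigT_compact => [|_]; [exact: finite_finset|exact: tetrahedron_compact].
Qed.

(** The product of the coordinates vanishes exactly on the boundary, where the two
    halves meet; its sign can therefore tell the interiors apart. *)
Definition signed_row (y : cells R bool) : 'rV[R]_5 :=
  \row_(j < 5) if (j < 4)%N then coord (tagged y) j
               else side R (tag y) * \prod_(i < 4) coord (tagged y) i.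

Lemma double_embedding : exists2 f : double R -> 'rV[R]_5, continuous f & injective f.
Proof.
have [|x i i4 xi|f cf fE] := @double_map R _ signed_row.
- move=> b; apply: continuous_to_rV => j.
  under eq_fun do rewrite /= mxE /=.
  case: (j < 4)%N; first exact: coord_continuous4.
  move=> x; apply: (@continuous_comp _ _ _ (fun z => \prod_(i < 4) coord z i)
    ( *%R (side R b))); last exact: mulrl_continuous.
  by apply: continuous_big => [|v _]; [exact: mul_continuous|exact: coord_continuous4].
- have p0 : \prod_(i < 4) coord x i = 0 by rewrite (bigD1 (Ordinal i4))//= xi mul0r.
  by apply/rowP => j; rewrite !mxE /= p0 !mulr0.
exists f => // p q; rewrite -[p]reprK -[q]reprK.
case: (generic_quotient.repr p) (generic_quotient.repr q) => [b x] [b' x'].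
rewrite -!/(to_space _ _) !fE => /rowP e; apply/to_spaceP/double_same.
have xx : x = x'.
  apply: coord_inj => v v4; have := e (inord v).
  by rewrite !mxE /= inordK ?v4// ltnW.
split => //; have [->|bb'] := eqVneq b b'; [by left|right].
have : \prod_(i < 4) coord x i = 0.
  have := e ord_max; rewrite !mxE /= -xx; move: bb'; rewrite /side.
  by case: (b); case: (b') => // _ /eqP; rewrite ?mul1r ?mulN1r; lra.
move=> /eqP; rewrite prodf_seq_eq0 => /hasP[i _ /eqP xi].
by exists i.
Qed.

End DoubleManifold.

Section Charts.
Variable R : realType.
Local Notation tet := (tetrahedron R).

Definition min3 (a b c : R) : R := Num.min a (Num.min b c).

Lemma min3P (a b c : R) :
  [/\ min3 a b c <= a, min3 a b c <= b, min3 a b c <= c &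
      [\/ min3 a b c = a, min3 a b c = b | min3 a b c = c]].
Proof.
rewrite /min3; have [bc|bc] := leP b c; have [ab|ab] := leP a _; split; try lra.
- by apply: Or31.
- by apply: Or32.
- by apply: Or31.
- by apply: Or33.
Qed.

Lemma min3_continuous (X : topologicalType) (f g h : X -> R) :
  continuous f -> continuous g -> continuous h ->
  continuous (fun x => min3 (f x) (g x) (h x)).
Proof.
move=> cf cg ch x.
apply: (@continuous_min _ _ f (fun x => Num.min (g x) (h x))); first exact: cf.
by apply: (@continuous_min _ _ g h); [exact: cg|exact: ch].
Qed.

Lemma add_fun_continuous (X : topologicalType) (f g : X -> R) :
  continuous f -> continuous g -> continuous (fun x => f x + g x).
Proof. by move=> cf cg x; exact: cvgD (cf x) (cg x). Qed.

Lemma sub_fun_continuous (X : topologicalType) (f g : X -> R) :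
  continuous f -> continuous g -> continuous (fun x => f x - g x).
Proof. by move=> cf cg x; exact: cvgB (cf x) (cg x). Qed.

Definition row3 (a b c : R) : 'rV[R]_3 := \row_(k < 3) nth 0 [:: a; b; c] k.

Lemma row3_continuous (X : topologicalType) (f g h : X -> R) :
  continuous f -> continuous g -> continuous h ->
  continuous (fun x => row3 (f x) (g x) (h x)).
Proof.
move=> cf cg ch; apply: continuous_to_rV => -[k k3].
under eq_fun do rewrite mxE /=.
by case: k k3 => [|[|[|]]].
Qed.

Section Chart.
Variables j a b c : nat.
Hypothesis jabc : perm_eq [:: j; a; b; c] (iota 0 4).

Lemma sum_chart (y : nat -> R) :
  \sum_(v <- iota 0 4) y v = y j + (y a + (y b + y c)).
Proof. by rewrite -(perm_big _ jabc) /= !big_cons big_nil addr0. Qed.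

Lemma chart_sum (x : tet) : coord x j + (coord x a + (coord x b + coord x c)) = 1.
Proof. by rewrite -sum_chart (coord_bary x).2. Qed.

Lemma chart_lt v : v \in [:: j; a; b; c] -> (v < 4)%N.
Proof. by rewrite (perm_mem jabc) mem_iota. Qed.

Lemma chart_ge0 (x : tet) v : v \in [:: j; a; b; c] -> 0 <= coord x v.
Proof. by move=> /chart_lt; exact: (coord_bary x).1. Qed.

Definition height (x : tet) : R := min3 (coord x a) (coord x b) (coord x c).

(** Near the vertex [j] the double is made of two octants glued along their boundaries.
    The differences of the other three coordinates, and their minimum
    with a sign for the half, unfold them onto the whole space.  The last factor is 1 where
    the chart is used, and makes the map well defined on the face opposite [j]. *)
Definition chart_cells (y : cells R bool) : 'rV[R]_3 :=
  let x := tagged y in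
  row3 (coord x a - coord x b) (coord x b - coord x c)
       (side R (tag y) * (height x * Num.min 1 (5 * coord x j))).



(** The three coordinates are recovered from their differences and their minimum. *)
Definition lifted (v : 'rV[R]_3) : seq R :=
  let base := `|v 0 2%:R| - min3 (v 0 0 + v 0 1) (v 0 1) 0 in
  [:: base + (v 0 0 + v 0 1); base + v 0 1; base].

Definition chart_coord (v : 'rV[R]_3) (w : nat) : R :=
  let u := lifted v in
  nth 0 (1 - (u`_0 + (u`_1 + u`_2)) :: u) (index w [:: j; a; b; c]).

Definition chart_image : set 'rV[R]_3 :=
  [set v | (lifted v)`_0 + ((lifted v)`_1 + (lifted v)`_2) < 4 / 5].

Lemma chart_coordE v : let u := lifted v in
  [/\ chart_coord v j = 1 - (u`_0 + (u`_1 + u`_2)), chart_coord v a = u`_0,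
      chart_coord v b = u`_1 & chart_coord v c = u`_2].
Proof.
have : uniq [:: j; a; b; c] by rewrite (perm_uniq jabc) iota_uniq.
rewrite /= !inE !negb_or => /and4P[/and3P[ja jb jc] /andP[ab ac] bc _].
rewrite /chart_coord /= !eqxx (negPf ja) (negPf jb) (negPf jc) (negPf ab).
by rewrite (negPf ac) (negPf bc).
Qed.

Lemma lifted_ge0 v k : 0 <= (lifted v)`_k.
Proof.
have [h1 h2 h3 _] := min3P (v 0 0 + v 0 1) (v 0 1) 0.
have := normr_ge0 (v 0 2%:R).
by case: k => [|[|[|k]]] /= n0; rewrite ?nth_nil//; lra.
Qed.

Lemma lifted_min v :
  min3 (lifted v)`_0 (lifted v)`_1 (lifted v)`_2 = `|v 0 2%:R|.
Proof.
have [h1 h2 h3 h4] := min3P (v 0 0 + v 0 1) (v 0 1) 0.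
have [g1 g2 g3 g4] := min3P (lifted v)`_0 (lifted v)`_1 (lifted v)`_2.
move: g1 g2 g3 g4; rewrite /=; move: (min3 _ _ 0) h1 h2 h3 h4 => m h1 h2 h3 h4.
by case: h4 => h4 g1 g2 g3 [] g4; lra.
Qed.

Lemma chart_bary v : chart_image v -> bary 4 (chart_coord v).
Proof.
rewrite /chart_image /mkset => sv; have [ej ea eb ec] := chart_coordE v.
have u0 k := lifted_ge0 v k.
split=> [w w4|].
  have : w \in [:: j; a; b; c] by rewrite (perm_mem jabc) mem_iota.
  rewrite !inE => /or4P[] /eqP->; rewrite ?ej ?ea ?eb ?ec ?u0//.
  by move: sv; lra.
by rewrite sum_chart ej ea eb ec; lra.
Qed.

Lemma lifted_continuous k : continuous (fun v => (lifted v)`_k).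
Proof.
have c0 : continuous (fun v : 'rV[R]_3 => v 0 0) by exact: coord_continuous.
have c1 : continuous (fun v : 'rV[R]_3 => v 0 1) by exact: coord_continuous.
have c01 := add_fun_continuous c0 c1.
have cn : continuous (fun v : 'rV[R]_3 => `|v 0 2%:R|).
  move=> v; apply: (@continuous_comp _ _ _ (fun v : 'rV[R]_3 => v 0 2%:R) Num.norm).
    exact: coord_continuous.
  exact: norm_continuous.
have cm := min3_continuous c01 c1 (@cst_continuous _ _ 0).
have cb := sub_fun_continuous cn cm.
case: k => [|[|[|k]]] /=.
- exact: add_fun_continuous cb c01.
- exact: add_fun_continuous cb c1.
- exact: cb.
- by under eq_fun do rewrite nth_nil; exact: cst_continuous.
Qed.

Lemma lifted_sum_continuous :
  continuous (fun v => (lifted v)`_0 + ((lifted v)`_1 + (lifted v)`_2)).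
Proof.
apply: add_fun_continuous; first exact: lifted_continuous.
by apply: add_fun_continuous; exact: lifted_continuous.
Qed.

Lemma chart_image_open : open chart_image.
Proof.
have /continuousP := lifted_sum_continuous.
by move=> /(_ _ (@open_lt R (4 / 5))).
Qed.

Lemma chart_coord_continuous w : continuous (chart_coord ^~ w).
Proof.
rewrite /chart_coord; case: (index w _) => [|k] /=; last first.
  exact: lifted_continuous.
apply: sub_fun_continuous; first exact: cst_continuous.
exact: lifted_sum_continuous.
Qed.

Definition unchart (v : chart_image) : tet := point_of (chart_coord (\val v)).

Lemma unchart_bary (v : chart_image) : bary 4 (chart_coord (\val v)).
Proof. exact/chart_bary/set_valP. Qed.

Lemma unchart_continuous : continuous unchart.
Proof.
apply: point_continuous; first exact: unchart_bary.
move=> w _ v; apply: (@continuous_comp _ _ _ set_val (chart_coord ^~ w)).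
  exact: val_continuous.
exact: chart_coord_continuous.
Qed.

Definition to_double : cells R bool -> double R := to_space (double_gluing).

Definition uncharted (v : chart_image) : double R :=
  to_double (cell (0 <= \val v 0 2%:R) (unchart v)).

Lemma coord_unchart (v : chart_image) : let u := lifted (\val v) in
  [/\ coord (unchart v) j = 1 - (u`_0 + (u`_1 + u`_2)), coord (unchart v) a = u`_0,
      coord (unchart v) b = u`_1 & coord (unchart v) c = u`_2].
Proof.
have [h1 h2 h3 h4] := chart_coordE (\val v).
by rewrite !coord_point ?chart_lt ?inE ?eqxx ?orbT//; exact: unchart_bary.
Qed.

Lemma height0 (x : tet) : height x = 0 -> exists2 i, (i < 4)%N & coord x i = 0.
Proof.
have [_ _ _] := min3P (coord x a) (coord x b) (coord x c); rewrite -/(height x).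
move=> h h0; move: h; rewrite h0 => -[] /esym e.
- by exists a => //; rewrite chart_lt// !inE eqxx ?orbT.
- by exists b => //; rewrite chart_lt// !inE eqxx ?orbT.
- by exists c => //; rewrite chart_lt// !inE eqxx ?orbT.
Qed.

Lemma height_unchart v : height (unchart v) = `|\val v 0 2%:R|.
Proof.
by rewrite -lifted_min /height; have [_ -> -> ->] := coord_unchart v.
Qed.

(** Where the sign of the third coordinate changes, the point lies on the
    boundary and the two halves agree. *)
Lemma uncharted_continuous : continuous uncharted.
Proof.
have cb s : continuous (fun v => to_double (cell s (unchart v))).
  move=> v; apply: (@continuous_comp _ _ _ unchart (fun x => to_double (cell s x))).
    exact: unchart_continuous.
  apply: (@continuous_comp _ _ _ (cell s) to_double); first exact: cell_continuous.
  exact: to_space_continuous.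
have cs : continuous (fun v : chart_image => \val v 0 2%:R).
  move=> v; apply: (@continuous_comp _ _ _ set_val (fun v : 'rV[R]_3 => v 0 2%:R)).
    exact: val_continuous.
  exact: coord_continuous.
have near s v A : nbhs (to_double (cell s (unchart v))) A ->
    nbhs v [set z | A (to_double (cell s (unchart z)))] by exact: cb.
move=> v A nA.
suff : nbhs v [set z | A (uncharted z)] by [].
move: nA; rewrite /uncharted; have [s0|s0|/esym s0] := ltrgtP 0 (\val v 0 2%:R) => nA.
- have /continuousP /(_ _ (@open_gt R 0)) oP := cs.
  have vP : nbhs v [set v : chart_image | 0 < \val v 0 2%:R].
    exact: open_nbhs_nbhs.
  by apply: filterS (filterI (near _ _ _ nA) vP) => z [Az /= /ltW ->].
- have /continuousP /(_ _ (@open_lt R 0)) oP := cs.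
  have vP : nbhs v [set v : chart_image | \val v 0 2%:R < 0].
    exact: open_nbhs_nbhs.
  by apply: filterS (filterI (near _ _ _ nA) vP) => z [Az /=]; rewrite leNgt => ->.
- have e : to_double (cell true (unchart v)) = to_double (cell false (unchart v)).
    apply/to_spaceP/double_same; split => //; right; apply: height0.
    by rewrite height_unchart s0 normr0.
  have nA' := nA; rewrite e in nA'.
  apply: filterS (filterI (near _ _ _ nA) (near _ _ _ nA')) => z [] /=.
  by case: (0 <= _).
Qed.

Lemma height_ge0 x : 0 <= height x.
Proof.
have [_ _ _] := min3P (coord x a) (coord x b) (coord x c); rewrite -/(height x).
by case=> ->; rewrite chart_ge0// !inE eqxx ?orbT.
Qed.

Lemma norm_side s (r : R) : 0 <= r -> `|side R s * r| = r.
Proof. by move=> r0; case: s; rewrite /side ?mul1r ?mulN1r ?normrN ger0_norm. Qed.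

Lemma chart_cellsE s x : 1 / 5 < coord x j ->
  chart_cells (cell s x) =
  row3 (coord x a - coord x b) (coord x b - coord x c) (side R s * height x).
Proof.
move=> xj; rewrite /chart_cells /= (_ : Num.min 1 _ = 1) ?mulr1//.
by apply: min_l; lra.
Qed.

Lemma lifted_chart s x : 1 / 5 < coord x j ->
  lifted (chart_cells (cell s x)) = [:: coord x a; coord x b; coord x c].
Proof.
move=> xj; rewrite chart_cellsE// /lifted !mxE /= norm_side ?height_ge0//.
rewrite (_ : min3 _ _ 0 = height x - coord x c).
  by congr [:: _; _; _]; lra.
have := min3P (coord x a) (coord x b) (coord x c); rewrite -/(height x).
move=> [h1 h2 h3 h4].
have [] := min3P (coord x a - coord x b + (coord x b - coord x c))
  (coord x b - coord x c) 0.
move: (min3 _ _ 0) => m g1 g2 g3 g4.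
by case: h4 => h4; case: g4 => g4; lra.
Qed.

Lemma unchart_lt (v : chart_image) : 1 / 5 < coord (unchart v) j.
Proof.
have [-> _ _ _] := coord_unchart v.
by have := set_valP v; rewrite /chart_image /mkset; lra.
Qed.

Lemma chart_unchart (v : chart_image) :
  chart_cells (cell (0 <= \val v 0 2%:R) (unchart v)) = \val v.
Proof.
rewrite chart_cellsE ?unchart_lt// height_unchart.
have [_ -> -> ->] := coord_unchart v; move: (\val v) => {}v.
apply/rowP => -[[|[|[|//]]] k3]; rewrite !mxE /=.
- by rewrite (_ : Ordinal k3 = 0); [lra|exact: val_inj].
- by rewrite (_ : Ordinal k3 = 1); [lra|exact: val_inj].
- rewrite (_ : Ordinal k3 = 2%:R); last exact: val_inj.
  rewrite /side; case: (leP 0 (v 0 2%:R)) => h; first by rewrite mul1r ger0_norm.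
  by rewrite mulN1r ltr0_norm ?opprK.
Qed.

Lemma uncharted_chart s x (v : chart_image) : 1 / 5 < coord x j ->
  \val v = chart_cells (cell s x) -> uncharted v = to_double (cell s x).
Proof.
move=> xj vx; have [ej ea eb ec] := coord_unchart v.
rewrite vx (lifted_chart s xj) /= in ej ea eb ec.
have ux : unchart v = x.
  apply: coord_inj => w w4; have := mem_iota 0 4 w.
  rewrite add0n /= w4 -(perm_mem jabc) !inE => /or4P[] /eqP-> //.
  by rewrite ej; have := chart_sum x; lra.
rewrite /uncharted ux; apply/to_spaceP/double_same; split => //.
have := height_ge0 x; rewrite le_eqVlt => /predU1P[/esym h0|h0].
  by right; exact: height0.
left; rewrite vx chart_cellsE// mxE /= /side.
by case: s vx => _; rewrite ?mul1r ?(ltW h0)// mulN1r oppr_ge0 leNgt h0.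
Qed.

Lemma double_chart : exists U : set (double R),
  [/\ open U, homeomorphic U chart_image &
      forall s x, 1 / 5 < coord x j -> U (to_double (cell s x))].
Proof.
have [s|x i i4 xi|wt cwt wtE] := @double_map R _ (fun y : cells R bool => coord (tagged y) j).
- exact: coord_continuous4.
- by [].
have hc : continuous height by apply: min3_continuous; exact: coord_continuous4.
have cutc : continuous (fun x : tet => Num.min 1 (5 * coord x j)).
  move=> x; apply: (@continuous_min _ _ (fun=> 1) (fun x : tet => 5 * coord x j)).
    exact: cst_continuous.
  apply: (@continuous_comp _ _ _ (fun x : tet => coord x j) ( *%R 5)).
    exact: coord_continuous4.
  exact: mulrl_continuous.
have [s|x i i4 xi|f cf fE] := @double_map R _ chart_cells.
- apply: row3_continuous.
  + by apply: sub_fun_continuous; exact: coord_continuous4.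
  + by apply: sub_fun_continuous; exact: coord_continuous4.
  + move=> x; apply: (@continuous_comp _ _ _ (fun x => height x * Num.min 1 (5 * coord x j))
      ( *%R (side R s))); last exact: mulrl_continuous.
    exact: cvgM (hc x) (cutc x).
- suff e : height x * Num.min 1 (5 * coord x j) = 0 by rewrite /chart_cells /= e !mulr0.
  have := mem_iota 0 4 i; rewrite add0n /= i4 -(perm_mem jabc) !inE.
  have [h1 h2 h3 _] := min3P (coord x a) (coord x b) (coord x c).
  have := height_ge0 x; rewrite -/(height x) in h1 h2 h3.
  have hE : height x <= 0 -> 0 <= height x -> height x * Num.min 1 (5 * coord x j) = 0.
    by move=> ? ?; rewrite (_ : height x = 0) ?mul0r//; lra.
  move=> h0 /or4P[] /eqP ij; rewrite -ij xi in h1 h2 h3 *; try exact: hE.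
  by rewrite mulr0 (_ : Num.min 1 0 = 0) ?mulr0//; apply: min_r; exact: ler01.
have pE p : p = to_double (generic_quotient.repr p) by rewrite /to_double /to_space reprK.
pose U := [set p | 1 / 5 < wt p].
have fU (p : U) : chart_image (f (\val p)).
  have := set_valP p; rewrite /U /mkset /chart_image /mkset (pE (\val p)).
  case: (generic_quotient.repr _) => s x; rewrite wtE fE => xj.
  by rewrite (lifted_chart s xj) /=; have := chart_sum x; lra.
have gU (v : chart_image) : U (uncharted v).
  by rewrite /U /mkset /uncharted wtE; exact: unchart_lt.
exists U; split; last by move=> s x; rewrite /U /= wtE.
  by have /continuousP := cwt; move=> /(_ _ (@open_gt R (1 / 5))).
exists (fun p => to_subset (fU p)), (fun v => to_subset (gU v)); split.
- apply: continuous_to_subset => p.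
  by apply: (@continuous_comp _ _ _ set_val f); [exact: val_continuous|exact: cf].
- by apply: continuous_to_subset => v; exact: uncharted_continuous.
- move=> p; apply: val_inj; rewrite [RHS]pE.
  have := set_valP p; rewrite /U /mkset [X in wt X](pE (\val p)).
  case E : (generic_quotient.repr (\val p)) => [s x]; rewrite wtE => xj.
  by apply: uncharted_chart => //=; rewrite (pE (\val p)) E fE.
- by move=> v; apply: val_inj => /=; rewrite /uncharted fE chart_unchart.
Qed.

End Chart.
End Charts.

Lemma double_manifold (R : realType) : closed_manifold R 3 (double R).
Proof.
have [f cf fI] := double_embedding R.
split; [|exact: compact_second_countable_inj (@double_compact R) cf fI|exact: double_compact|].
  by apply: hausdorff_inj cf fI; exact: norm_hausdorff.
move=> p; rewrite -[p]reprK; case: (generic_quotient.repr p) => s x.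
have chart j a b c : perm_eq [:: j; a; b; c] (iota 0 4) -> 1 / 5 < coord x j ->
    exists (U : set (double R)) (V : set 'rV[R]_3),
    [/\ open U, U (to_double (cell s x)), open V & homeomorphic U V].
  move=> jabc xj; have [U [oU UV Ux]] := double_chart R jabc.
  by exists U, (chart_image (R:=R)); split => //; [exact: Ux|exact: chart_image_open].
have := (coord_bary x).2; rewrite /= !big_cons big_nil => x1.
(* The coordinates sum to 1, so one of them exceeds 1/5. *)
have [|h0] := ltP (1 / 5) (coord x 0); first by apply: (chart _ 1 2 3)%N.
have [|h1] := ltP (1 / 5) (coord x 1); first by apply: (chart _ 0 2 3)%N.
have [|h2] := ltP (1 / 5) (coord x 2); first by apply: (chart _ 0 1 3)%N.
by apply: (chart 3 0 1 2)%N => //; lra.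
Qed.

(** * Reversible blocks *)

Lemma all_iotaP (a : pred nat) n :
  reflect (forall i, (i < n)%N -> a i) (all a (iota 0 n)).
Proof.
apply: (iffP allP) => H i; first by move=> ?; apply: H; rewrite mem_iota.
by rewrite mem_iota => /andP[_]; exact: H.
Qed.

(** What makes the gluing of a closed block an involution without fixed faces. *)
Record reversible (B : block) : Prop := Reversible {
  entry_back : forall t i k p, (t < size (tets B))%N -> (i < 4)%N ->
    entry B t i = (k.+2, p) ->
    (k, nth 0%N p i) <> (t, i) /\
    exists2 p', entry B k (nth 0%N p i) = (t.+2, p') &
      forall v, (v < 4)%N -> nth 0%N p' (nth 0%N p v) = v;
  entry_port : forall t i b q, (t < size (tets B))%N -> (i < 4)%N ->
    entry B t i = (nat_of_bool b, q) ->
    (port B b).1 = t /\ forall v, (v < 4)%N -> nth 0%N (port B b).2 (nth 0%N q v) = v;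
  port_entry : forall b,
    exists q, entry B (port B b).1 (nth 0%N (port B b).2 0) = (nat_of_bool b, q)
}.

Definition reversible_check (B : block) : bool :=
  all (fun t => all (fun i => let: (k, p) := entry B t i in
    if k is k'.+2 then
      let: (k2, p') := entry B k' (nth 0%N p i) in
      [&& (k', nth 0%N p i) != (t, i), k2 == t.+2 &
          all (fun v => nth 0%N p' (nth 0%N p v) == v) (iota 0 4)]
    else let s := port B (k == 1%N) in
      (s.1 == t) && all (fun v => nth 0%N s.2 (nth 0%N p v) == v) (iota 0 4))
    (iota 0 4)) (iota 0 (size (tets B))) &&
  all (fun b => (entry B (port B b).1 (nth 0%N (port B b).2 0)).1 == nat_of_bool b)
      [:: false; true].

Lemma reversible_checkP B : reversible_check B -> reversible B.
Proof.
case/andP => /all_iotaP H /allP P.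
have {}H t i (tB : (t < size (tets B))%N) := all_iotaP _ _ (H t tB) i.
split.
- move=> t i k p tB i4 E; have := H t i tB i4; rewrite E.
  case E' : (entry B k _) => [k2 p'] /and3P[/eqP ? /eqP -> /all_iotaP pp]; split => //.
  by exists p' => // v v4; apply/eqP/pp.
- move=> t i b q tB i4 E; have := H t i tB i4; rewrite E.
  by case: b E => E /andP[/eqP ? /all_iotaP pp]; split => // v v4; apply/eqP/pp.
- move=> b; have /eqP : (entry B (port B b).1 (nth 0%N (port B b).2 0)).1 == nat_of_bool b.
    by apply: P; case: (b); rewrite !inE.
  by case: (entry _ _ _) => k q /= ->; exists q.
Qed.

Lemma size_stack B S : size (tets (stack B S)) = (size (tets B) + size (tets S))%N.
Proof. by rewrite size_cat !size_map. Qed.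

Lemma inverse4_sym s q : perm_eq s (iota 0 4) ->
  (forall v, (v < 4)%N -> nth 0%N s (nth 0%N q v) = v) -> perm_eq q (iota 0 4) ->
  forall v, (v < 4)%N -> nth 0%N q (nth 0%N s v) = v.
Proof.
move=> s4 sq q4 v v4; have sv := perm4_lt s4 v4.
have : uniq s by rewrite (perm_uniq s4) iota_uniq.
move/(uniqP 0%N); apply; rewrite ?inE ?(perm_size s4) ?sq//.
exact: perm4_lt.
Qed.

Lemma port_entryE B b : block_wf B -> reversible B ->
  exists q, [/\ entry B (port B b).1 (nth 0%N (port B b).2 0) = (nat_of_bool b, q),
    perm_eq q (iota 0 4), forall v, (v < 4)%N -> nth 0%N (port B b).2 (nth 0%N q v) = v &
    forall v, (v < 4)%N -> nth 0%N q (nth 0%N (port B b).2 v) = v].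
Proof.
move=> wf rv; have [tB s4] := block_wf_port b wf.
have [q E] := port_entry rv b; exists q.
have s0 : (nth 0%N (port B b).2 0 < 4)%N by exact: perm4_lt.
have [_ q4 _] := block_wf_entry wf tB s0 E.
have [_ sq] := entry_port rv tB s0 E; split => //.
exact: inverse4_sym.
Qed.

Section StackWf.
Variables B S : block.
Hypotheses (Bwf : block_wf B) (Swf : block_wf S).
Let n := size (tets B).
Let m := size (tets S).

Lemma entry_stack_low t i : (i < 4)%N -> (t < n)%N ->
  entry (stack B S) t i = up_face S B (entry B t i).
Proof.
move=> i4 tn; rewrite /entry /stack /= nth_cat size_map tn.
rewrite (nth_map [::])// (nth_map (0%N, [::]))//.
case/andP: Bwf => _ /allP H.
by rewrite (eqP (H (nth [::] (tets B) t) _))// mem_nth.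
Qed.

Lemma entry_stack_high t i : (i < 4)%N -> (t < m)%N ->
  entry (stack B S) (n + t) i = down_face B (entry S t i).
Proof.
move=> i4 tm; rewrite /entry /stack /= nth_cat size_map ltnNge leq_addr /= addKn.
rewrite (nth_map [::])// (nth_map (0%N, [::]))//.
case/andP: Swf => _ /allP H.
by rewrite (eqP (H (nth [::] (tets S) t) _))// mem_nth.
Qed.

Lemma stack_wf : block_wf (stack B S).
Proof.
have Bp b := block_wf_port b Bwf; have Sp b := block_wf_port b Swf.
apply/andP; split; first (apply/andP; split).
- apply/allP => t; rewrite mem_iota add0n size_stack => /andP[_ tnm].
  apply/allP => i; rewrite mem_iota add0n => /andP[_ i4].
  have [tn|tn] := ltnP t n.
    rewrite entry_stack_low//; case E : (entry B t i) => [k p].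
    have [kB p4 pi] := block_wf_entry Bwf tn i4 E.
    rewrite /up_face /=; case: eqP => [k1|k1]; rewrite ?addn2 /=; apply/and3P; split => //.
    + by rewrite !ltnS addnC ltn_add2l; exact: (Sp false).1.
    + exact: perm4_comp (Sp false).2 p4.
    + by apply: leq_trans kB _; rewrite addn2 !ltnS leq_addr.
    + by apply/implyP => /pi ->.
  have tm : (t - n < m)%N by rewrite ltn_subLR.
  rewrite -(subnKC tn) entry_stack_high//; case E : (entry S (t - n) i) => [k p].
  have [kS p4 pi] := block_wf_entry Swf tm i4 E.
  rewrite /down_face /=; case: eqP => [k0|k0]; last case: eqP => [k1|k1];
    rewrite ?addn2 /=; apply/and3P; split => //.
  + by rewrite !ltnS; apply: leq_trans (Bp true).1 (leq_addr _ _).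
  + exact: perm4_comp (Bp true).2 p4.
  + by rewrite k1.
  + by apply/implyP => /pi ->.
  + by move: kS; rewrite addn2; lia.
  + by case: k k0 k1 {E kS pi} => [|[]].
- apply/allP => -[] _ /=; rewrite size_stack.
    by rewrite addnC ltn_add2l (Sp true).1; exact: (Sp true).2.
  rewrite (leq_trans (Bp false).1 (leq_addr _ _)); exact: (Bp false).2.
- case/andP: Bwf => _ /allP B4; case/andP: Swf => _ /allP S4.
  apply/allP => r; rewrite mem_cat => /orP[] /mapP[r' r'B ->]; rewrite size_map.
    exact: B4.
  exact: S4.
Qed.

Hypotheses (Brev : reversible B) (Srev : reversible S).

Lemma stack_reversible : reversible (stack B S).
Proof.
have Bp b := block_wf_port b Bwf; have Sp b := block_wf_port b Swf.
have Bq b := port_entryE b Bwf Brev; have Sq b := port_entryE b Swf Srev.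
split.
- move=> t i k p; rewrite size_stack => tnm i4.
  have [tn|tn] := ltnP t n.
    rewrite entry_stack_low//; case E : (entry B t i) => [k' q].
    have [kB q4 qi] := block_wf_entry Bwf tn i4 E.
    rewrite /up_face /=; case: eqP => [k1|k1] [].
      rewrite addn2 => -[<- <-]; rewrite k1 in E qi.
      have [tE sq] := entry_port Brev (b := true) tn i4 E.
      have [q' [E' q'4 _ q's]] := Sq false.
      rewrite comp_nth ?(perm_size q4)// qi//.
      split; first by move=> [e _]; move: tn; rewrite -e ltnNge leq_addl.
      rewrite addnC entry_stack_high ?(Sp false).1 ?perm4_lt//; last exact: (Sp false).2.
      rewrite E' /down_face /= tE addn2; eexists => // v v4.
      by rewrite comp_nth ?(perm_size q'4) ?comp_nth ?(perm_size q4) ?q's ?sq ?perm4_lt//;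
        exact: (Sp false).2.
    move=> kk pp; rewrite kk pp in E kB q4.
    have [? [p' E' pp']] := entry_back Brev tn i4 E; split => //.
    have kn : (k < n)%N by move: kB; rewrite addn2.
    by rewrite entry_stack_low// ?E' ?perm4_lt//; exists p'.
  have tm : (t - n < m)%N by rewrite ltn_subLR.
  rewrite -(subnKC tn) entry_stack_high//; case E : (entry S (t - n) i) => [k' q].
  have [kS q4 qi] := block_wf_entry Swf tm i4 E.
  rewrite /down_face /=; case: eqP => [k0|k0]; last case: eqP => [-> []//|k1].
    rewrite addn2 => -[<- <-]; rewrite k0 in E qi.
    have [tE sq] := entry_port Srev (b := false) tm i4 E.
    have [q' [E' q'4 _ q's]] := Bq true.
    rewrite comp_nth ?(perm_size q4)// qi//.
    split; first by move=> [e _]; have := (Bp true).1; rewrite e ltnNge leq_addr.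
    rewrite entry_stack_low ?(Bp true).1 ?perm4_lt//; last exact: (Bp true).2.
    rewrite E' /up_face /= tE addn2 addnC; eexists => // v v4.
    by rewrite comp_nth ?(perm_size q'4) ?comp_nth ?(perm_size q4) ?q's ?sq ?perm4_lt//;
      exact: (Bp true).2.
  case: k' k0 k1 E kS {qi} => [|[|k']] // _ _ E kS [<- <-].
  have [ne [p' E' pp']] := entry_back Srev tm i4 E.
  split; first by move=> [e1 e2]; apply: ne; rewrite e2; congr pair; lia.
  rewrite addnC entry_stack_high ?perm4_lt//; last by move: kS; rewrite addn2.
  rewrite E' /down_face /=; exists p' => //; congr pair; lia.
- move=> t i b q; rewrite size_stack => tnm i4.
  have [tn|tn] := ltnP t n.
    rewrite entry_stack_low//; case E : (entry B t i) => [k' q'].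
    rewrite /up_face /=; case: eqP => [k1|k1] [].
      by rewrite addn2; case: (b).
    by case: b => // kb <-; rewrite kb in E; exact: (entry_port Brev (b := false) tn i4 E).
  have tm : (t - n < m)%N by rewrite ltn_subLR.
  rewrite -(subnKC tn) entry_stack_high//; case E : (entry S (t - n) i) => [k' q'].
  rewrite /down_face /=; case: eqP => [k0|k0]; first by rewrite addn2; case: b => -[].
  case: eqP => [k1|k1] [] /=.
    rewrite k1; case: b => // _ <-; rewrite k1 in E.
    by have [<- ?] := entry_port Srev (b := true) tm i4 E; rewrite addnC.
  by case: k' k0 k1 {E} => [|[|k']] // _ _; case: (b).
- case=> /=.
    have [q [E q4 _ _]] := Sq true; exists q.
    rewrite addnC entry_stack_high ?(Sp true).1 ?perm4_lt ?E//; exact: (Sp true).2.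
  have [q [E q4 _ _]] := Bq false; exists q.
  rewrite entry_stack_low ?(Bp false).1 ?perm4_lt ?E//; exact: (Bp false).2.
Qed.

End StackWf.

(** * Rings *)

(** The context is arbitrary, so that the head of a ring can be shortened while
    the rest of the ring is attached to it. *)
Definition collapses (R : realType) (B : block) : Prop :=
  forall (A : choiceType) (K : context A), context_wf K ->
  homeomorphic (space R (fill B K)) (space R (fill blockF K)).

Lemma plug_size (R : realType) B m (A : choiceType) (K : context A) :
  size (tets B) = m ->
  homeomorphic (space R (fill B K)) (space R (plug (m := m) B K)).
Proof. by move=> <-; exact: homeomorphic_refl. Qed.

Definition fits (B : block) : Prop := [/\ (0 < size (tets B))%N, block_wf B & reversible B].

Lemma fits_stack B S : fits B -> fits S -> fits (stack B S).
Proof.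
move=> [B0 Bwf Brev] [S0 Swf Srev]; split.
- by rewrite size_stack addn_gt0 B0.
- exact: stack_wf.
- exact: stack_reversible.
Qed.

Lemma fits_check B : [&& (0 < size (tets B))%N, block_wf B & reversible_check B] -> fits B.
Proof. by case/and3P => ? ? /reversible_checkP. Qed.

Lemma fits_F : fits blockF. Proof. by apply: fits_check; vm_compute. Qed.
Lemma fits_P : fits blockP. Proof. by apply: fits_check; vm_compute. Qed.
Lemma fits_T : fits blockT. Proof. by apply: fits_check; vm_compute. Qed.

(** One context serves for all [B], so that [B] can be exchanged for [blockF]. *)
Lemma stack_attach (R : realType) S (A : choiceType) (K : context A) :
  fits S -> context_wf K ->
  exists (A' : choiceType) (K' : context A'), context_wf K' /\
    forall B, fits B ->
      homeomorphic (space R (fill (stack B S) K)) (space R (fill B K')).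
Proof.
move=> [S0 Swf _] Kwf; have Sm : size (tets S) = (size (tets S)).-1.+1 by rewrite prednK.
exists _, (attach (size (tets S)).-1 S K); split; first exact: attach_wf Sm Swf Kwf.
move=> B [B0 Bwf _]; have Bn : size (tets B) = (size (tets B)).-1.+1 by rewrite prednK.
apply: homeomorphic_trans (plug_size R K _) _; first by rewrite size_stack Bn Sm.
apply: homeomorphic_trans (stack_homeomorphic Sm Swf Kwf Bn Bwf R) _.
exact/homeomorphic_sym/plug_size.
Qed.

Lemma collapses_stack (R : realType) B S : fits B -> fits S ->
  collapses R B -> collapses R (stack blockF S) -> collapses R (stack B S).
Proof.
move=> Bf Sf BF FS A K Kwf; have [A' [K' [K'wf H]]] := stack_attach R Sf Kwf.
apply: homeomorphic_trans (H B Bf) _.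
apply: homeomorphic_trans (BF _ _ K'wf) _.
apply: homeomorphic_trans (homeomorphic_sym (H _ fits_F)) _.
exact: FS.
Qed.

Lemma collapses_moves (R : realType) B mvs : run_moves check_ports B mvs blockF ->
  collapses R B.
Proof.
move=> h A K Kwf; apply: (run_moves_homeomorphic R Kwf _ h) => B1 B2 rho new.
by move=> ports; left.
Qed.

Lemma collapses_F (R : realType) : collapses R blockF.
Proof. by move=> A K _; exact: homeomorphic_refl. Qed.

Definition opening (w : seq block) : block := foldl stack blockF w.

(** Rotating the bottom port turns each layer against the block below it, without
    which the weights of the three arcs on a port could differ. *)
Definition layer : block := stack (stack blockT blockP) blockF.

Lemma fits_layer : fits layer.
Proof. exact: fits_stack (fits_stack fits_T fits_P) fits_F. Qed.

Definition ring (w : seq block) (j : nat) : block := iter j (stack^~ layer) (opening w).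

Definition untwisted (B : block) : Prop := B = blockF \/ B = blockP.

Lemma opening_collapses (R : realType) w : (forall B, List.In B w -> untwisted B) ->
  fits (opening w) /\ collapses R (opening w).
Proof.
rewrite /opening; have := collapses_F R; have := fits_F.
move: {1 2 3 4}blockF => B0; elim: w B0 => [|S w IH] B0 f0 c0 Sw //=.
have Sf : fits S by case: (Sw S (or_introl erefl)) => ->; [exact: fits_F|exact: fits_P].
apply: IH; last by move=> B Bw; apply: Sw; right.
  exact: fits_stack.
apply: collapses_stack => //; case: (Sw S (or_introl erefl)) => ->.
  exact: collapses_moves FF_F.
exact: collapses_moves FP_F.
Qed.

Lemma collapses_layer (R : realType) : collapses R (stack blockF layer).
Proof.
(* Stacking these blocks is associative, by computation. *)
have -> : stack blockF layer = stack (stack (stack blockF blockT) blockP) blockF.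
  by vm_compute.
have FTf := fits_stack fits_F fits_T; have FTPf := fits_stack FTf fits_P.
apply: collapses_stack => //; [exact: fits_F| |exact: collapses_moves FF_F].
apply: collapses_stack => //; [exact: fits_P| |exact: collapses_moves FP_F].
exact: collapses_moves FT_F.
Qed.

Lemma ring_collapses (R : realType) w j : (forall B, List.In B w -> untwisted B) ->
  fits (ring w j) /\ collapses R (ring w j).
Proof.
move=> /(opening_collapses R) ow; elim: j => [//|j [rf rc]]; rewrite /ring iterS.
split; first exact: fits_stack rf fits_layer.
exact: collapses_stack rf fits_layer rc (@collapses_layer R).
Qed.

(** The rotation by which the top of a ring is glued to its bottom, and its inverse. *)
Definition twist (b : bool) : seq nat := (if b then [:: 0; 2; 3; 1] else [:: 0; 3; 1; 2])%N.

Definition closing : context void :=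
  Context (fun (a : void) _ => match a with end) (fun b => inr (~~ b, twist b)).

Lemma closing_wf : context_wf closing.
Proof. by split=> // b b' p [_ <-]; case: b. Qed.

Lemma closed_double (R : realType) :
  homeomorphic (space R (fill blockF closing)) (double R).
Proof.
apply: (@homeomorphic_trans _ (space R (fill blockC closing))).
  apply: (@space_reindex _ _ _ _ _ id id) => // x [|[|[|[|//]]]] y p _;
    by rewrite /fill !plugP; case: x => [[[|//] ?]|[]].
apply: (@homeomorphic_trans _ (space R (fill blockD closing))).
  apply: (run_moves_homeomorphic R closing_wf _ C_D) => B B' rho new /andP[? ?].
  by right; split => // -[].
pose f (x : 'I_2 + void) : bool := if x is inl t then t == 1%N :> nat else false.
pose g (b : bool) : 'I_2 + void := inl (if b then inord 1 else inord 0).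
apply: (@space_reindex _ _ _ _ _ f g).
- move=> [[[|[|//]] t2]|[]]; rewrite /g /f /=; congr inl; apply: val_inj; by rewrite /= inordK.
- by case; rewrite /g /f /= inordK.
- by move=> [[[|[|//]] ?]|[]] [|[|[|[|//]]]] [[[|[|//]] ?]|[]] p _;
    rewrite /fill plugP /double_gluing /f /=; split=> [[]//|[]//]; try (by move=> <-); move=> _ ->.
Qed.

Theorem ring_double (R : realType) w j : (forall B, List.In B w -> untwisted B) ->
  homeomorphic (space R (fill (ring w j) closing)) (double R).
Proof.
move=> /(ring_collapses R j) [_ rc].
exact: homeomorphic_trans (rc _ _ closing_wf) (closed_double R).
Qed.

(** * The triangulation of a closed block *)

Definition closed_next (B : block) (t i : nat) : face_code :=
  let: (k, q) := entry B t i in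
  if k is k'.+2 then (k', q) else let b := k == 1%N in
  ((port B (~~ b)).1, pcomp (port B (~~ b)).2 (pcomp (twist b) q)).

Lemma twist_perm b : perm_eq (twist b) (iota 0 4). Proof. by case: b. Qed.

Lemma twistK b v : (v < 4)%N -> nth 0%N (twist (~~ b)) (nth 0%N (twist b) v) = v.
Proof. by case: b; case: v => [|[|[|[|]]]]. Qed.

Lemma closed_next_port B t i b q : entry B t i = (nat_of_bool b, q) ->
  closed_next B t i = ((port B (~~ b)).1, pcomp (port B (~~ b)).2 (pcomp (twist b) q)).
Proof. by rewrite /closed_next => ->; case: b. Qed.

Section Closing.
Variable B : block.
Hypothesis Bf : fits B.
Let m := size (tets B).

Lemma closed_nextP t i : (t < m)%N -> (i < 4)%N ->
  let: (k, p) := closed_next B t i in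
  [/\ (k < m)%N, perm_eq p (iota 0 4), (k, nth 0%N p i) <> (t, i) &
  exists2 p', closed_next B k (nth 0%N p i) = (t, p') &
    perm_eq p' (iota 0 4) /\ forall v, (v < 4)%N -> nth 0%N p' (nth 0%N p v) = v].
Proof.
case: Bf => _ wf rv tm i4; case E : (entry B t i) => [k q].
have [km q4 qi] := block_wf_entry wf tm i4 E.
have [[b kb]|[k' kk]] : (exists b, k = nat_of_bool b) \/ exists k', k = k'.+2.
- by case: (k) => [|[|k']]; [left; exists false|left; exists true|right; exists k'].
- rewrite kb in E; rewrite (closed_next_port E).
  have [tE sq] := entry_port rv tm i4 E.
  have {}qi : nth 0%N q i = 0%N by apply: qi; rewrite kb; case: (b).
  have [q' [E' q'4 sq' q's]] := port_entryE (~~ b) wf rv.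
  have [pm s4] := block_wf_port (~~ b) wf; have [_ s4'] := block_wf_port b wf.
  have r4 := perm4_comp (twist_perm b) q4; have p4 := perm4_comp s4 r4.
  have pE v : (v < 4)%N -> nth 0%N (pcomp (port B (~~ b)).2 (pcomp (twist b) q)) v =
      nth 0%N (port B (~~ b)).2 (nth 0%N (twist b) (nth 0%N q v)).
    by move=> v4; rewrite !comp_nth ?size_map ?(perm_size q4).
  have pi : nth 0%N (pcomp (port B (~~ b)).2 (pcomp (twist b) q)) i =
      nth 0%N (port B (~~ b)).2 0 by rewrite pE// qi; case: (b).
  rewrite pi; split => //.
    by move=> [kt si]; move: E; rewrite -kt -si E' => -[]; case: (b).
  rewrite (closed_next_port E') negbK tE; eexists; first by [].
  split; first exact: perm4_comp s4' (perm4_comp (twist_perm _) q'4).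
  move=> v v4; have qv := perm4_lt q4 v4; have tqv := perm4_lt (twist_perm b) qv.
  have sv := perm4_lt s4 tqv.
  rewrite pE// comp_nth ?size_map ?(perm_size q'4)// comp_nth ?(perm_size q'4)//.
  by rewrite q's// twistK// sq.
- rewrite kk in E km; rewrite {1}/closed_next E.
  have [ne [p' E' pp']] := entry_back rv tm i4 E.
  have km' : (k' < m)%N by move: km; rewrite addn2.
  split => //; exists p'; first by rewrite /closed_next E'.
  by split => //; have [] := block_wf_entry wf km' (perm4_lt q4 i4) E'.
Qed.

Definition to_perm (p : seq nat) : 'S_4 :=
  insubd (1%g : {perm 'I_4}) [ffun v : 'I_4 => inord (nth 0%N p v)].

Lemma to_permE p (v : 'I_4) : perm_eq p (iota 0 4) -> to_perm p v = nth 0%N p v :> nat.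
Proof.
move=> p4; have inj : injectiveb [ffun v : 'I_4 => inord (nth 0%N p v) : 'I_4].
  apply/injectiveP => u w; rewrite !ffunE => /(congr1 val).
  rewrite /= !inordK ?perm4_lt// => e; apply: val_inj.
  have : uniq p by rewrite (perm_uniq p4) iota_uniq.
  by move/(uniqP 0%N); apply => //; rewrite inE (perm_size p4); exact: ltn_ord.
have -> : to_perm p v = [ffun v : 'I_4 => inord (nth 0%N p v) : 'I_4] v.
  by rewrite -pvalE; congr (fun_of_fin _ v); exact: insubdK.
by rewrite ffunE inordK ?perm4_lt.
Qed.

Definition face_target (t : 'I_m) (i : 'I_4) : 'I_m * 'S_4 :=
  let z := closed_next B t i in (insubd t z.1, to_perm z.2).

Lemma face_targetE (t : 'I_m) (i : 'I_4) k p : closed_next B t i = (k, p) ->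
  ((face_target t i).1 = k :> nat) * (forall v, (face_target t i).2 v = nth 0%N p v :> nat).
Proof.
move=> E; have := closed_nextP (ltn_ord t) (ltn_ord i); rewrite /face_target E => -[km p4 _ _].
by split => [|v]; rewrite ?to_permE// val_insubd km.
Qed.

Lemma face_targetK (t : 'I_m) (i : 'I_4) :
  face_target (face_target t i).1 ((face_target t i).2 i) =
  (t, ((face_target t i).2^-1)%g).
Proof.
have := closed_nextP (ltn_ord t) (ltn_ord i).
case E : (closed_next B t i) => [k p] [km p4 _ [p' E' [p'4 pp']]].
have [e1 e2] := face_targetE E.
move: (face_target t i).1 (face_target t i).2 e1 e2 => t' s e1 e2.
rewrite -e1 -e2 in E'; have [f1 f2] := face_targetE E'.
rewrite [LHS]surjective_pairing; congr pair; first exact: val_inj.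
apply/permP => w; apply: val_inj; rewrite -{1}(permKV s w).
by rewrite [LHS]f2 e2 pp'.
Qed.

Lemma face_target_neq (t : 'I_m) (i : 'I_4) :
  ((face_target t i).1, (face_target t i).2 i) <> (t, i).
Proof.
have := closed_nextP (ltn_ord t) (ltn_ord i).
case E : (closed_next B t i) => [k p] [_ _ ne _] e; apply: ne.
have [e1 e2] := face_targetE E; move: e1 e2 e.
by case: (face_target t i) => t' s /= <- <- [-> ->].
Qed.

Definition triangulation_of : face_gluing m := FaceGluing face_targetK face_target_neq.

Lemma realization_space (R : realType) :
  homeomorphic (realization R triangulation_of) (space R (fill B closing)).
Proof.
pose G : gluing 'I_m := fun t i t' p => closed_next B t i = (nat_of_ord t', p).
apply: (@homeomorphic_trans _ (space R G)).
  have step (x y : cells R 'I_m) : glued triangulation_of x y <-> face_glued G x y.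
    case: x y => [t x] [t' y]; split.
      move=> [i [xi t'E yx]]; case E : (closed_next B t i) => [k p].
      have [e1 e2] := face_targetE E; exists i, p; split => //.
      - by rewrite /G E -e1; congr pair; rewrite -[LHS]/(val _) -t'E.
      - by rewrite /coord inord_val.
      - move=> v v4; rewrite /coord -(yx (inord v)); congr (\val y _ _).
        apply: val_inj; rewrite -[RHS]/(val ((face_target t i).2 (inord v))) /= inordK.
          by rewrite e2 inordK.
        by have := ltn_ord ((face_target t i).2 (inord v)); rewrite e2 inordK.
    move=> [i [p [i4 Gp xi yx]]]; exists (inord i).
    have E : closed_next B t (inord i : 'I_4) = (nat_of_ord t', p) by rewrite inordK.
    have [e1 e2] := face_targetE E.
    split => //; first exact/val_inj/esym.
    move=> v; have := yx v (ltn_ord v); rewrite /coord -e2 !inord_val; exact.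
  have same (x y : cells R 'I_m) : glue_equiv triangulation_of x y <-> same_point G x y.
    split=> /asboolP xy; apply/asboolP.
    - elim: xy => {x y} [x y /step|x|x y _|x y z _ xy _]; first exact: rst_step.
      + exact: rst_refl.
      + exact: rst_sym.
      + exact: rst_trans xy.
    - elim: xy => {x y} [x y /step|x|x y _|x y z _ xy _]; first exact: rst_step.
      + exact: rst_refl.
      + exact: rst_sym.
      + exact: rst_trans xy.
  apply: (@quotient_homeomorphic _ _ (glue_equiv_rel R triangulation_of)
    (same_point_equiv R G) id id).
  - exact: pi_continuous.
  - exact: pi_continuous.
  - by move=> x y /same.
  - by move=> x y /same.
  - by move=> x; exact: glue_equiv_refl.
  - by move=> x; exact: same_point_refl.
pose f (t : 'I_m) : 'I_m + void := inl t.
pose g (x : 'I_m + void) : 'I_m := match x with inl t => t | inr a => match a with end end.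
apply: (@space_reindex _ _ _ _ _ f g) => //; first by case=> [|[]].
move=> t i t' p i4; rewrite /fill plugP /f /G /plug_next /closed_next /=.
case: (entry B t i) => [[|[|k]] q] /=; split=> -[-> ->] //.
Qed.

End Closing.

(** * Vertices and minimal supports *)

Section Supports.
Variables (R : realType) (I : finType).

Definition under (u x : I -> R) : Prop := forall k, x k = 0 -> u k = 0.

Lemma under_trans u v x : under u v -> under v x -> under u x.
Proof. by move=> uv vx k /vx /uv. Qed.

(** The largest multiple of [v] that leaves [x] nonnegative. *)
Lemma subtract_ray (x v : I -> R) :
  (forall k, 0 <= x k) -> (forall k, 0 <= v k) -> (exists k, v k != 0) -> under v x ->
  exists l, [/\ 0 < l, forall k, 0 <= x k - l * v k &
    exists2 k, x k != 0 & x k - l * v k = 0].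
Proof.
move=> x0 v0 [k0 vk0] vx.
case: (@Order.TotalTheory.arg_minP _ R I k0 (fun k => v k != 0) (fun k => x k / v k) vk0).
move=> k vk kmin; have vk_gt0 : 0 < v k by rewrite lt_def vk v0.
have xk : x k != 0 by apply/eqP => /vx e; rewrite e eqxx in vk.
exists (x k / v k); split.
- by rewrite divr_gt0// lt_def xk x0.
- move=> i; have [->|vi] := eqVneq (v i) 0; first by rewrite mulr0 subr0.
  by rewrite subr_ge0 -ler_pdivlMr ?kmin// lt_def vi v0.
- by exists k => //; rewrite divfK// subrr.
Qed.

Definition support_size (x : I -> R) : nat := #|[pred k | x k != 0]|.

Lemma support_size_lt (x y : I -> R) : under y x ->
  (exists2 k, x k != 0 & y k = 0) -> (support_size y < support_size x)%N.
Proof.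
move=> yx [k xk yk]; apply: proper_card; apply/properP; split.
  by apply/fintype.subsetP => i; rewrite !inE; apply: contra => /eqP /yx ->.
by exists k; rewrite !inE ?xk // yk eqxx.
Qed.

Lemma under_sub (x v : I -> R) l : under v x -> under (fun k => x k - l * v k) x.
Proof. by move=> vx k xk; rewrite (vx k xk) xk mulr0 subrr. Qed.

End Supports.

Section Vertices.
Variables (R : realType) (n : nat) (T : face_gluing n).
Local Notation coordinate := ('I_n * ('I_4 + 'I_3))%type.
Local Notation vec := {ffun coordinate -> R}.
Local Notation PSS := (projective_solution_space R T).

Definition admissible_cone (x : vec) : Prop :=
  [/\ forall c, 0 <= x c, matching_equations T x & quadrilateral_constraints x].

Lemma matching_sub (x v : vec) l : matching_equations T x -> matching_equations T v ->
  matching_equations T [ffun k => x k - l * v k].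
Proof.
move=> xT vT t i w wi /=; have := xT t i w wi; have := vT t i w wi => /=.
by move=> a b; rewrite !ffunE addrACA [RHS]addrACA -!opprD -!mulrDr a b.
Qed.

Lemma matching_scale (x : vec) l : matching_equations T x ->
  matching_equations T [ffun k => l * x k].
Proof. by move=> xT t i w wi /=; rewrite !ffunE -!mulrDr xT. Qed.

Lemma quadrilateral_under (x y : vec) : under y x -> quadrilateral_constraints x ->
  quadrilateral_constraints y.
Proof.
move=> yx xq t q q' yq yq'; apply: (xq t).
  by apply: contra yq => /eqP /yx ->.
by apply: contra yq' => /eqP /yx ->.
Qed.

Lemma cone_sub (x v : vec) l : admissible_cone x -> admissible_cone v -> under v x ->
  (forall k, 0 <= x k - l * v k) -> admissible_cone [ffun k => x k - l * v k].
Proof.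
move=> [x0 xT xq] [v0 vT vq] vx y0; split.
- by move=> k; rewrite ffunE.
- exact: matching_sub.
- by apply: quadrilateral_under xq => k xk; rewrite ffunE (vx k xk) xk mulr0 subrr.
Qed.

Lemma sum_eq0 (x : vec) : (forall k, 0 <= x k) -> \sum_k x k = 0 -> forall k, x k = 0.
Proof.
move=> x0 /eqP; rewrite psumr_eq0// => /allP H k.
by apply/eqP; apply: H; rewrite mem_index_enum.
Qed.

Variables (W : finType) (ray : W -> vec).
Hypothesis ray_cone : forall w, admissible_cone (ray w).
Hypothesis ray_neq0 : forall w, exists k, ray w k != 0.
Hypothesis ray_cover : forall x, admissible_cone x -> (exists k, x k != 0) ->
  exists w, under (ray w) x.
Hypothesis ray_antichain : forall w w', under (ray w) (ray w') -> w = w'.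

Lemma ray_sum_gt0 w : 0 < \sum_k ray w k.
Proof.
have [r0 _ _] := ray_cone w; rewrite lt_def sumr_ge0// andbT.
by apply/eqP => /(sum_eq0 r0) z; have [k] := ray_neq0 w; rewrite z eqxx.
Qed.

Definition vertex (w : W) : vec := [ffun k => (\sum_k ray w k)^-1 * ray w k].

Lemma vertex_under w : under (vertex w) (ray w) /\ under (ray w) (vertex w).
Proof.
split=> k; rewrite ffunE; first by move=> ->; rewrite mulr0.
by move=> /eqP; rewrite mulf_eq0 invr_eq0 (gt_eqF (ray_sum_gt0 w)) /= => /eqP.
Qed.

Lemma vertex_PSS w : PSS (vertex w).
Proof.
have [r0 rT _] := ray_cone w; split.
- by move=> k; rewrite ffunE mulr_ge0// invr_ge0 ltW// ray_sum_gt0.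
- exact: matching_scale.
- under eq_bigr do rewrite ffunE.
  by rewrite -mulr_sumr mulVf// gt_eqF// ray_sum_gt0.
Qed.

Lemma vertex_cone w : admissible_cone (vertex w).
Proof.
have [v0 vT _] := vertex_PSS w; split => //.
by apply: quadrilateral_under (vertex_under w).1 _; have [] := ray_cone w.
Qed.

Lemma PSS_neq0 (x : vec) : PSS x -> exists k, x k != 0.
Proof.
move=> [_ _ x1]; apply: contrapT => h; move: x1; rewrite big1.
  by move=> /eqP; rewrite eq_sym oner_eq0.
by move=> k _; apply/eqP; apply: contrapT => xk; apply: h; exists k; apply/negP.
Qed.

(** Subtract the largest multiple of the vertex from [y].  A nonzero remainder would
    contain the support of a ray, which could only be that of [w]; but a coordinate
    in this support has just become zero. *)
Lemma vertex_unique w y : PSS y -> under y (ray w) -> y = vertex w.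
Proof.
move=> Py yw; have [y0 yT y1] := Py.
have Cy : admissible_cone y.
  by split => //; apply: quadrilateral_under yw _; have [] := ray_cone w.
have [w' w'y] := ray_cover Cy (PSS_neq0 Py).
have ww : w' = w by apply: ray_antichain; exact: under_trans w'y yw.
rewrite ww in w'y; have [vw wv] := vertex_under w.
have vy : under (vertex w) y := under_trans vw w'y.
have [v0 _ _] := vertex_PSS w.
have [l [l0 z0 [k yk zk]]] := subtract_ray y0 v0 (PSS_neq0 (vertex_PSS w)) vy.
pose z : vec := [ffun k => y k - l * vertex w k].
have Cz : admissible_cone z by exact: cone_sub Cy (vertex_cone w) vy z0.
have zy : under z y by move=> i yi; rewrite ffunE (vy i yi) yi mulr0 subrr.
have zz i : z i = 0.
  apply: contrapT => zi.
  have [|w2 w2z] := ray_cover Cz; first by exists i; apply/eqP.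
  have e : w2 = w.
    by apply: ray_antichain; apply: under_trans w2z _; exact: under_trans zy yw.
  rewrite e in w2z; have := w2z k; rewrite ffunE zk => /(_ erefl) rk.
  by move: yk; rewrite (yw k rk) eqxx.
have yE i : y i = l * vertex w i by apply/eqP; rewrite -subr_eq0; have := zz i; rewrite ffunE => ->.
have l1 : l = 1.
  have [_ _ v1] := vertex_PSS w; rewrite -y1; under eq_bigr do rewrite yE.
  by rewrite -mulr_sumr v1 mulr1.
by apply/ffunP => i; rewrite yE l1 mul1r.
Qed.

Lemma vertex_extreme w : admissible_vertices R T (vertex w).
Proof.
have [vw wv] := vertex_under w; have [v0 _ _] := vertex_PSS w.
split; last by have [] := vertex_cone w.
split; first exact: vertex_PSS.
move=> y z s Py Pz /andP[s0 s1] yz.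
have [y0 _ _] := Py; have [z0 _ _] := Pz.
have both k : vertex w k = 0 -> y k = 0 /\ z k = 0.
  rewrite yz => /eqP; rewrite paddr_eq0; last 2 first.
  - by rewrite mulr_ge0 // ltW.
  - by rewrite mulr_ge0 // subr_ge0 ltW.
  rewrite !mulf_eq0 (gt_eqF s0) subr_eq0 (gt_eqF s1) /=.
  by move=> /andP[/eqP ? /eqP ?].
split; apply: vertex_unique => // k wk; have [] := both k => //; exact: vw.
Qed.

(** Subtract from [x] the largest multiple of a vertex under it.  Were there a
    remainder, [x] would be a proper convex combination of this vertex and of the
    normalised remainder. *)
Lemma extreme_vertex x : admissible_vertices R T x -> exists w, x = vertex w.
Proof.
move=> [[Px xext] xq]; have [x0 xT x1] := Px.
have [w wx] := ray_cover (And3 x0 xT xq) (PSS_neq0 Px); exists w.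
have [vw wv] := vertex_under w; have [v0 vT v1] := vertex_PSS w.
have vx : under (vertex w) x := under_trans vw wx.
have [l [l0 z0 _]] := subtract_ray x0 v0 (PSS_neq0 (vertex_PSS w)) vx.
have zsum : \sum_k (x k - l * vertex w k) = 1 - l.
  by rewrite big_split /= sumrN -mulr_sumr x1 v1 mulr1.
have [l1|l1] := ltP l 1; last first.
  apply/ffunP => k; apply/eqP.
  have z1 : \sum_k (x k - l * vertex w k) = 0.
    by apply: le_anti; rewrite sumr_ge0// andbT zsum subr_le0.
  have l_1 : l = 1 by move: zsum; rewrite z1 => /esym/subr0_eq.
  have zE : \sum_k [ffun k => x k - l * vertex w k] k = 0.
    by under eq_bigr do rewrite ffunE.
  have z0' i : 0 <= [ffun k => x k - l * vertex w k] i by rewrite ffunE.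
  have := sum_eq0 z0' zE k; rewrite ffunE l_1 mul1r => /eqP.
  by rewrite subr_eq0.
have d0 : 0 < 1 - l by rewrite subr_gt0.
pose z : vec := [ffun k => (1 - l)^-1 * [ffun k => x k - l * vertex w k] k].
have zE k : z k = (1 - l)^-1 * (x k - l * vertex w k) by rewrite 2!ffunE.
have Pz : PSS z.
  split.
  - by move=> k; rewrite zE mulr_ge0// invr_ge0 ltW.
  - exact/matching_scale/matching_sub.
  - under eq_bigr do rewrite zE.
    by rewrite -mulr_sumr zsum mulVf ?gt_eqF.
have [||vE _] := xext _ z l (vertex_PSS w) Pz; last by [].
  by rewrite l0.
by move=> k; rewrite zE mulrA mulfV ?gt_eqF// mul1r addrC subrK.
Qed.

Lemma vertex_inj : injective vertex.
Proof.
move=> w w' e; apply: ray_antichain; apply: under_trans (vertex_under w).2 _.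
by rewrite e; exact: (vertex_under w').1.
Qed.

Theorem vertex_count : admissible_vertex_count R T #|W|.
Proof.
rewrite /admissible_vertex_count.
have -> : admissible_vertices R T = vertex @` [set: W].
  apply/seteqP; split=> x; first by move=> /extreme_vertex [w ->]; exists w.
  by move=> [w _ <-]; exact: vertex_extreme.
apply: card_eq_trans (inj_card_eq _) _; first by move=> ? ? _ _; exact: vertex_inj.
apply: card_eq_trans _ (card_esym card_II).
have -> : [set: 'I_#|W|] = enum_rank @` [set: W].
  by apply/seteqP; split=> i // _; exists (enum_val i); rewrite ?enum_valK.
by apply/card_esym/inj_card_eq => ? ? _ _; exact: enum_rank_inj.
Qed.

End Vertices.

(** * The double description method *)

Definition equation := ((nat * nat) * (nat * nat))%type.

Definition weight (v : seq nat) (a : nat * nat) : nat :=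
  (nth 0 v a.1 + nth 0 v a.2)%N.

(** Inclusion of the supports.  The nested conditionals stop at the first failure
    even in a call-by-value evaluation; so do those of [some_ray]. *)
Fixpoint below (u v : seq nat) : bool :=
  match u, v with
  | a :: u', b :: v' =>
      if (if b is 0 then if a is 0 then true else false else true)%N then below u' v' else false
  | [::], [::] => true
  | _, _ => false
  end.

Fixpoint some_ray (p : pred (seq nat)) (s : seq (seq nat)) : bool :=
  if s is u :: s' then if p u then true else some_ray p s' else false.

Definition keep_minimal (kept : seq (seq nat)) (v : seq nat) : seq (seq nat) :=
  if some_ray (below^~ v) kept then kept else v :: [seq u <- kept | ~~ below v u].

Definition prune (s : seq (seq nat)) : seq (seq nat) := foldl keep_minimal [::] s.

Definition one_quad (m : nat) (v : seq nat) : bool :=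
  all (fun t => let q j := nth 0%N v (7 * t + 4 + j) in
    if q 0%N is 0%N then (q 1%N == 0%N) || (q 2%N == 0%N)
    else (q 1%N == 0%N) && (q 2%N == 0%N)) (iota 0 m).

(** The positive combination of [p] and [n] on which the two sides of [e] agree. *)
Definition combine (e : equation) (p n : seq nat) : seq nat :=
  let dp := (weight p e.1 - weight p e.2)%N in
  let dn := (weight n e.2 - weight n e.1)%N in
  [seq (dn * x.1 + dp * x.2)%N | x <- zip p n].

(** The hyperplane [e] cuts a cone in the rays that lie on it and in combinations of rays
    from its two sides.  Combinations with two quadrilateral types in one
    tetrahedron cannot lie under an admissible solution. *)
Definition cut (m : nat) (rays : seq (seq nat)) (e : equation) : seq (seq nat) :=
  let pos := [seq v <- rays | weight v e.2 < weight v e.1]%N in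
  let neg := [seq v <- rays | weight v e.1 < weight v e.2]%N in
  if nilp pos && nilp neg then rays else
  let zero := [seq v <- rays | weight v e.1 == weight v e.2] in
  prune (zero ++ [seq v <- [seq combine e p n | p <- pos, n <- neg] | one_quad m v]).

Definition units (m : nat) : seq (seq nat) :=
  [seq [seq nat_of_bool (j == k) | j <- iota 0 (7 * m)] | k <- iota 0 (7 * m)].

(** The number of candidates after a cut.  The equations are taken in a greedy
    order, since the intermediate lists are much longer in other orders. *)
Definition cut_cost (rays : seq (seq nat)) (e : equation) : nat :=
  let pos := count (fun v => weight v e.2 < weight v e.1)%N rays in
  let neg := count (fun v => weight v e.1 < weight v e.2)%N rays in
  let zero := count (fun v => weight v e.1 == weight v e.2) rays in
  (zero + pos * neg)%N.

Definition cheapest (rays : seq (seq nat)) (e : equation) (es : seq equation) : equation :=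
  (foldl (fun best e' => let c := cut_cost rays e' in
    if (c < best.1)%N then (c, e') else best) (cut_cost rays e, e) es).2.

Fixpoint cut_all (m fuel : nat) (rays : seq (seq nat)) (es : seq equation) :
    seq (seq nat) :=
  match fuel, es with
  | fuel'.+1, e :: es' =>
      let e' := cheapest rays e es' in cut_all m fuel' (cut m rays e') (rem e' es)
  | _, _ => rays
  end.

Definition content (v : seq nat) : nat := foldr gcdn 0%N v.

(** Once the content is divided out, the rays of the blocks below have port weights
    0 and 1. *)
Definition primitive (v : seq nat) : seq nat := [seq (a %/ content v)%N | a <- v].

Definition extreme_rays (m : nat) (es : seq equation) : seq (seq nat) :=
  map primitive (cut_all m (size es) (units m) es).

Lemma belowP u v :
  reflect (size u = size v /\ forall k, nth 0%N v k = 0%N -> nth 0%N u k = 0%N) (below u v).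
Proof.
elim: u v => [|a u IH] [|b v] /=; try by constructor => // -[].
case: ifPn => [ab|ab]; last first.
  by constructor => -[_ /(_ 0%N) /=]; case: b a ab => [[]|] // a _ /(_ erefl).
apply: (iffP (IH v)) => -[suv H]; split; rewrite ?suv//.
- by case=> [|k] /=; [case: b a ab => [[]|]|exact: H].
- by case: suv.
- by move=> k; exact: (H k.+1).
Qed.

Lemma below_trans u v w : below u v -> below v w -> below u w.
Proof.
by move=> /belowP[uv H] /belowP[vw H']; apply/belowP; split=> [|k /H' /H //]; rewrite uv.
Qed.

Lemma below_refl u : below u u. Proof. exact/belowP. Qed.

Lemma some_rayP (p : pred (seq nat)) (s : seq (seq nat)) :
  reflect (exists2 u, u \in s & p u) (some_ray p s).
Proof.
rewrite (_ : some_ray p s = has p s); first exact: hasP.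
by elim: s => //= u s ->; case: (p u).
Qed.

Lemma prune_sub s : {subset prune s <= s}.
Proof.
rewrite /prune.
suff H kept v : v \in foldl keep_minimal kept s -> v \in kept ++ s by move=> v /H.
elim: s kept => [|w s IH] kept /=; first by rewrite cats0.
move=> /IH; rewrite !mem_cat inE /keep_minimal; case: ifP => _.
  by case/orP => ->; rewrite ?orbT.
by rewrite inE mem_filter; case/orP => [/predU1P[->|/andP[_ ->]]|->]; rewrite ?eqxx ?orbT.
Qed.

Lemma prune_cover s v : v \in s -> exists2 u, u \in prune s & below u v.
Proof.
rewrite /prune.
have step kept w u : u \in kept -> exists2 u', u' \in keep_minimal kept w & below u' u.
  rewrite /keep_minimal; case: ifP => _ uk; first by exists u => //; exact: below_refl.
  have [wu|wu] := boolP (below w u); first by exists w; rewrite ?mem_head.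
  by exists u; rewrite ?below_refl// inE mem_filter wu uk orbT.
have keep s' : forall kept u, u \in kept -> exists2 u', u' \in foldl keep_minimal kept s' & below u' u.
  elim: s' => [|w s' IH] kept u uk; first by exists u => //; exact: below_refl.
  have [u1 u1k u1u] := step kept w u uk; have [u2 u2k u21] := IH _ _ u1k.
  by exists u2 => //; exact: below_trans u1u.
elim: s [::] => [//|w s IH] kept; rewrite inE => /predU1P[->|vs] /=; last exact: IH.
have [u uk uw] : exists2 u, u \in keep_minimal kept w & below u w.
  rewrite /keep_minimal; case: some_rayP => [[u uk uw]|_]; first by exists u.
  by exists w; rewrite ?mem_head ?below_refl.
have [u' u'k u'u] := keep s _ _ uk; exists u' => //; exact: below_trans uw.
Qed.

Section DoubleDescription.
Variables (R : realType) (m : nat).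
Local Notation N := (7 * m)%N.

Definition ray_fun (v : seq nat) : nat -> R := fun k => (nth 0%N v k)%:R.

Definition on (x : nat -> R) : 'I_N -> R := fun k => x k.

Definition pair_sum (x : nat -> R) (a : nat * nat) : R := x a.1 + x a.2.

Definition holds (x : nat -> R) (e : equation) : Prop := pair_sum x e.1 = pair_sum x e.2.

Record solution (es : seq equation) (x : nat -> R) : Prop := Solution {
  sol_ge0 : forall k, (k < N)%N -> 0 <= x k;
  sol_quad : forall t q q', (t < m)%N -> (q < 3)%N -> (q' < 3)%N ->
    x (7 * t + 4 + q)%N != 0 -> x (7 * t + 4 + q')%N != 0 -> q = q';
  sol_eq : forall e, e \in es -> holds x e
}.

Record ray_ok (es : seq equation) (v : seq nat) : Prop := RayOk {
  ray_size : size v = N;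
  ray_pos : exists2 k, (k < N)%N & nth 0%N v k != 0%N;
  ray_eq : forall e, e \in es -> weight v e.1 = weight v e.2
}.

(** The rays need not generate the cone: for the count it suffices that
    each nonzero admissible solution lies above one of them. *)
Definition describes (rays : seq (seq nat)) (es : seq equation) : Prop :=
  (forall v, v \in rays -> ray_ok es v) /\
  forall x, solution es x -> (exists k, on x k != 0) ->
    exists2 v, v \in rays & under (on (ray_fun v)) (on x).

Lemma pair_sum_ray v a : pair_sum (ray_fun v) a = (weight v a)%:R.
Proof. by rewrite /weight natrD. Qed.

Lemma ray_holds es v e : ray_ok es v -> e \in es -> holds (ray_fun v) e.
Proof. by move=> vok ee; rewrite /holds !pair_sum_ray (ray_eq vok ee). Qed.

Lemma ray_fun_neq0 es v : ray_ok es v -> exists k, on (ray_fun v) k != 0.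
Proof.
by case=> _ [k kN vk] _; exists (Ordinal kN); rewrite /on /ray_fun pnatr_eq0.
Qed.

Lemma solution_sub es x v l : solution es x -> ray_ok es v ->
  under (on (ray_fun v)) (on x) ->
  (forall k, 0 <= on x k - l * on (ray_fun v) k) ->
  solution es (fun k => x k - l * ray_fun v k).
Proof.
move=> [x0 xq xe] vok vx y0; split.
- by move=> k kN; exact: (y0 (Ordinal kN)).
- move=> t q q' tm q3 q'3 yq yq'; apply: (xq t) => //.
  + have kN : (7 * t + 4 + q < N)%N by lia.
    by apply: contra yq => /eqP xk; rewrite (vx (Ordinal kN) xk : ray_fun _ _ = 0) xk mulr0 subrr.
  + have kN : (7 * t + 4 + q' < N)%N by lia.
    by apply: contra yq' => /eqP xk; rewrite (vx (Ordinal kN) xk : ray_fun _ _ = 0) xk mulr0 subrr.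
- move=> e ee; have := xe e ee; have := ray_holds vok ee; rewrite /holds /pair_sum => a b.
  by rewrite addrACA [RHS]addrACA -!opprD -!mulrDr a b.
Qed.

(** Subtract rays from [x] as long as possible.  If [F] were nonnegative at each of them,
    its value would stay negative until the zero vector is reached. *)
Lemma ray_descent rays es (F : (nat -> R) -> R) x : describes rays es ->
  (forall x l v, F (fun k => x k - l * v k) = F x - l * F v) ->
  (forall x, (forall k, on x k = 0) -> F x = 0) ->
  solution es x -> F x < 0 ->
  exists2 v, v \in rays & under (on (ray_fun v)) (on x) /\ F (ray_fun v) < 0.
Proof.
move=> [vok cov] FB F0; have [n] := ubnP (support_size (on x)).
elim: n x => // n IH x; rewrite ltnS => xn xs Fx.
have xn0 : exists k, on x k != 0.
  apply: contrapT => h; move: Fx; rewrite F0 ?ltxx// => k.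
  by apply/eqP; apply: contrapT => xk; apply: h; exists k; apply/negP.
have [v vr vx] := cov x xs xn0.
have [Fv|Fv] := ltP (F (ray_fun v)) 0; first by exists v.
have x0 k : 0 <= on x k by exact: (sol_ge0 xs).
have v0 k : 0 <= on (ray_fun v) k by exact: ler0n.
have [l [l0 y0 yx]] := subtract_ray x0 v0 (ray_fun_neq0 (vok v vr)) vx.
pose y k := x k - l * ray_fun v k.
have yux : under (on y) (on x) := under_sub l vx.
have ys : solution es y := solution_sub xs (vok v vr) vx y0.
have yn : (support_size (on y) < n)%N.
  by apply: leq_trans xn; apply: support_size_lt yux yx.
have Fy : F y < 0.
  by rewrite /y FB subr_lt0; apply: lt_le_trans Fx _; rewrite mulr_ge0// ltW.
have [u ur [uy Fu]] := IH y yn ys Fy.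
by exists u => //; split => //; exact: under_trans yux.
Qed.

Definition in_range (e : equation) : bool :=
  [&& e.1.1 < N, e.1.2 < N, e.2.1 < N & e.2.2 < N]%N.

Definition excess (e : equation) (x : nat -> R) : R := pair_sum x e.1 - pair_sum x e.2.

Lemma excess_sub e x l v :
  excess e (fun k => x k - l * v k) = excess e x - l * excess e v.
Proof. by rewrite /excess /pair_sum; ring. Qed.

Lemma excess0 e x : in_range e -> (forall k, on x k = 0) -> excess e x = 0.
Proof.
move=> /and4P[e1 e2 e3 e4] x0; rewrite /excess /pair_sum.
have xE k : (k < N)%N -> x k = 0 by move=> kN; exact: (x0 (Ordinal kN)).
by rewrite !xE// subrr.
Qed.

Lemma excess_ray e v : excess e (ray_fun v) = (weight v e.1)%:R - (weight v e.2)%:R.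
Proof. by rewrite /excess !pair_sum_ray. Qed.

Lemma solution_cons e es x : solution (e :: es) x <-> solution es x /\ holds x e.
Proof.
split=> [[x0 xq xe]|[[x0 xq xe] xe']].
  by split; [split => // e' ee'|]; apply: xe; rewrite inE ?ee' ?orbT ?eqxx.
by split => // e'; rewrite inE => /predU1P[->//|/xe].
Qed.

Lemma units_describe : describes (units m) [::].
Proof.
split=> [v /mapP[k]|x _ [k xk]].
  rewrite mem_iota => /andP[_ kN] ->; split => //; first by rewrite size_map size_iota.
  by exists k => //; rewrite (nth_map 0%N) ?size_iota// nth_iota// eqxx.
exists [seq nat_of_bool (j == nat_of_ord k) | j <- iota 0 N].
  by apply/mapP; exists (nat_of_ord k) => //; rewrite mem_iota ltn_ord.
move=> i xi; rewrite /on /ray_fun (nth_map 0%N) ?size_iota// nth_iota// add0n.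
case: eqP => // ik; move: xk; rewrite (_ : k = i) ?xi ?eqxx//.
by apply: val_inj; rewrite /= ik.
Qed.

Lemma nth_combine e p n k : size p = size n ->
  nth 0%N (combine e p n) k =
  ((weight n e.2 - weight n e.1) * nth 0 p k + (weight p e.1 - weight p e.2) * nth 0 n k)%N.
Proof.
move=> pn; have [kp|kp] := ltnP k (size p).
  by rewrite (nth_map (0, 0)%N) ?size_zip ?minnn -?pn ?minnn// nth_zip.
by rewrite !nth_default ?muln0// ?size_map ?size_zip -?pn ?minnn.
Qed.

Lemma combine_weight e p n a : size p = size n ->
  weight (combine e p n) a =
  ((weight n e.2 - weight n e.1) * weight p a + (weight p e.1 - weight p e.2) * weight n a)%N.
Proof. by move=> pn; rewrite [LHS]/weight !nth_combine// addnACA -!mulnDr. Qed.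

Lemma one_quad_sub es x v : solution es x -> under (on (ray_fun v)) (on x) -> one_quad m v.
Proof.
move=> xs vx; apply/all_iotaP => t tm.
have nz q : (q < 3)%N -> nth 0%N v (7 * t + 4 + q) != 0%N -> x (7 * t + 4 + q)%N != 0.
  move=> q3; apply: contra => /eqP xk; have kN : (7 * t + 4 + q < N)%N by lia.
  by have /eqP := vx (Ordinal kN) xk; rewrite pnatr_eq0.
have H q q' : (q < 3)%N -> (q' < 3)%N -> q != q' ->
    (nth 0%N v (7 * t + 4 + q) == 0%N) || (nth 0%N v (7 * t + 4 + q') == 0%N).
  move=> q3 q'3; apply: contraNT; rewrite negb_or => /andP[vq vq'].
  by apply/eqP; apply: (sol_quad xs tm) => //; exact: nz.
have := H 0%N 1%N isT isT isT; have := H 0%N 2%N isT isT isT; have := H 1%N 2%N isT isT isT.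
by rewrite /=; case: (nth 0%N v (7 * t + 4 + 0)) => //= k _ -> ->.
Qed.

(** Let the old ray [v] lie under the solution [x] of the new system.  If [v] is off the
    hyperplane, subtracting the largest multiple of [v] from [x] leads to the other side, so
    [ray_descent] finds a ray on that side, still under [x].  Combine it with [v]. *)
Lemma cut_describe rays es e : in_range e -> describes rays es ->
  describes (cut m rays e) (e :: es).
Proof.
move=> eN des; have [vok cov] := des.
rewrite /cut; set pos := [seq v <- rays | _]; set neg := [seq v <- rays | _].
set zero := [seq v <- rays | _].
have okz v : v \in rays -> weight v e.1 = weight v e.2 -> ray_ok (e :: es) v.
  move=> vr vz; have [vs vp ve] := vok v vr; split => // e'.
  by rewrite inE => /predU1P[->|/ve].
case: ifP => [/andP[/nilP pos0 /nilP neg0]|_].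
  split=> [v vr|x /solution_cons[xs _]]; last exact: cov.
  apply: okz => //; apply/eqP; rewrite eqn_leq; apply/andP; split; rewrite leqNgt; apply/negP => h.
    by have : v \in pos by [rewrite mem_filter h vr]; rewrite pos0.
  by have : v \in neg by [rewrite mem_filter h vr]; rewrite neg0.
split=> [v /prune_sub|x /solution_cons[xs xe] xn0].
  rewrite mem_cat => /orP[].
    by rewrite mem_filter => /andP[/eqP vz vr]; exact: okz.
  rewrite mem_filter => /andP[_ /allpairsP[[p n] /= [+ + ->]]].
  rewrite !mem_filter => /andP[pe pr] /andP[ne nr].
  have [ps [k kN pk] pes] := vok p pr; have [ns _ nes] := vok n nr.
  have pn : size p = size n by rewrite ps ns.
  split; first by rewrite size_map size_zip ps ns minnn.
    by exists k => //; rewrite nth_combine// -lt0n ltn_addr// muln_gt0 subn_gt0 ne lt0n pk.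
  move=> e'; rewrite inE => /predU1P[->|ee']; rewrite !combine_weight//.
    move: (weight p e.1) (weight p e.2) (weight n e.1) (weight n e.2) pe ne.
    move=> a b c d /ltnW ba /ltnW cd; rewrite -(subnKC ba) -(subnKC cd) !addKn !mulnDr.
    by rewrite [((a - b) * (d - c))%N]mulnC -addnA [(_ + (a - b) * c)%N]addnC.
  by rewrite (pes e')// (nes e').
suff [v vl vx] : exists2 v, v \in zero ++
    [seq v <- [seq combine e p n | p <- pos, n <- neg] | one_quad m v] &
    under (on (ray_fun v)) (on x).
  have [u ul /belowP[_ uv]] := prune_cover vl; exists u => //.
  by apply: under_trans vx => k /eqP; rewrite pnatr_eq0 => /eqP /uv; rewrite /on /ray_fun => ->.
have [v vr vx] := cov x xs xn0.
have [vz|vz] := eqVneq (weight v e.1) (weight v e.2).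
  by exists v => //; rewrite mem_cat mem_filter vz vr eqxx.
have x0 k : 0 <= on x k by exact: (sol_ge0 xs).
have v0 k : 0 <= on (ray_fun v) k by exact: ler0n.
have [l [l0 y0 yx]] := subtract_ray x0 v0 (ray_fun_neq0 (vok v vr)) vx.
pose y k := x k - l * ray_fun v k.
have yux : under (on y) (on x) := under_sub l vx.
have ys : solution es y := solution_sub xs (vok v vr) vx y0.
have Fy : excess e y = - (l * excess e (ray_fun v)).
  by rewrite excess_sub [X in X - _](_ : _ = 0) ?add0r//; apply/eqP; rewrite subr_eq0; apply/eqP.
have mix p n : p \in pos -> n \in neg -> under (on (ray_fun p)) (on x) ->
    under (on (ray_fun n)) (on x) ->
    exists2 v, v \in zero ++
      [seq v <- [seq combine e p n | p <- pos, n <- neg] | one_quad m v] &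
      under (on (ray_fun v)) (on x).
  move=> pp nn px nx; have pr : p \in rays by move: pp; rewrite mem_filter => /andP[].
  have nr : n \in rays by move: nn; rewrite mem_filter => /andP[].
  have cx : under (on (ray_fun (combine e p n))) (on x).
    move=> k xk; have /eqP := px k xk; have /eqP := nx k xk.
    rewrite /on /ray_fun nth_combine ?(ray_size (vok _ pr)) ?(ray_size (vok _ nr))//.
    by rewrite !pnatr_eq0 => /eqP-> /eqP->; rewrite !muln0.
  exists (combine e p n) => //; rewrite mem_cat; apply/orP; right.
  by rewrite mem_filter (one_quad_sub xs cx); apply/allpairsP; exists (p, n).
move: vz; rewrite neq_ltn => /orP[vlt|vgt].
  have Fyp : - excess e y < 0.
    by rewrite Fy opprK excess_ray pmulr_rlt0// subr_lt0 ltr_nat.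
  have [|z z0|p pr [py pe]] := ray_descent (F := fun x => - excess e x) des _ _ ys Fyp.
  - by move=> x' l' v'; rewrite excess_sub opprD mulrN.
  - by rewrite excess0 ?oppr0.
  apply: (mix p v) => //; last exact: under_trans yux.
    by rewrite mem_filter pr andbT; move: pe; rewrite excess_ray oppr_lt0 subr_gt0 ltr_nat.
  by rewrite mem_filter vlt.
have Fyn : excess e y < 0.
  by rewrite Fy oppr_lt0 excess_ray pmulr_rgt0// subr_gt0 ltr_nat.
have [|z z0|n nr [ny ne]] := ray_descent (F := excess e) des _ _ ys Fyn.
- exact: excess_sub.
- exact: excess0.
apply: (mix v n) => //; last exact: under_trans yux.
  by rewrite mem_filter vgt.
by rewrite mem_filter nr andbT; move: ne; rewrite excess_ray subr_lt0 ltr_nat.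
Qed.

Lemma describes_eq_mem rays es es' : es =i es' -> describes rays es -> describes rays es'.
Proof.
move=> ee [vok cov]; split=> [v /vok[vs vp ve]|x [x0 xq xe]].
  by split => // e; rewrite -ee; exact: ve.
by apply: cov; split => // e; rewrite ee; exact: xe.
Qed.

Lemma cheapest_mem rays e es : cheapest rays e es \in e :: es.
Proof.
rewrite /cheapest; move: (cut_cost rays e) => c.
elim: es e c => [|e' es IH] e c; first by rewrite mem_head.
move: IH => /=; case: ifP => _ IH.
  by rewrite inE; apply/orP; right; exact: IH.
by have := IH e c; rewrite !inE orbCA => /orP[->//|->]; rewrite !orbT.
Qed.

Lemma primitiveE v k : (nth 0 (primitive v) k * content v)%N = nth 0%N v k.
Proof.
have [kv|kv] := ltnP k (size v); last by rewrite !nth_default ?size_map.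
rewrite (nth_map 0%N)// divnK//; elim: v k kv => //= a v IH [|k] kv.
  exact: dvdn_gcdl.
exact: dvdn_trans (dvdn_gcdr _ _) (IH k kv).
Qed.

Lemma primitive_describe rays es : describes rays es -> describes (map primitive rays) es.
Proof.
move=> [vok cov]; split=> [_ /mapP[v vr ->]|x xs xn0].
  have [vs [k kN vk] ve] := vok v vr; split; first by rewrite size_map.
    by exists k => //; apply: contra vk => /eqP pk; rewrite -primitiveE pk.
  have c0 : (0 < content v)%N.
    by rewrite lt0n; apply: contra vk => /eqP c0; rewrite -primitiveE c0 muln0.
  move=> e ee; apply/eqP; rewrite -(eqn_pmul2r c0) /weight !mulnDl !primitiveE.
  exact/eqP/ve.
have [v vr vx] := cov x xs xn0; exists (primitive v); first exact: map_f.
apply: under_trans vx => k; have [_ [i _ vi] _] := vok v vr.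
rewrite /on /ray_fun -(primitiveE v k) => /eqP; rewrite pnatr_eq0 muln_eq0 => /orP[/eqP-> //|/eqP c0].
by move: vi; rewrite -primitiveE c0 muln0.
Qed.

Theorem extreme_rays_describe es : all in_range es -> describes (extreme_rays m es) es.
Proof.
move=> esN; apply: primitive_describe.
suff H k rays es0 es1 : (size es1 <= k)%N -> all in_range es1 -> describes rays es0 ->
    describes (cut_all m k rays es1) (es1 ++ es0).
  by have := H (size es) _ _ es (leqnn _) esN units_describe; rewrite cats0.
elim: k rays es0 es1 => [|k IH] rays es0 [|e es1] //= es1k es1N des.
set c := cheapest rays e es1; have cin : c \in e :: es1 := cheapest_mem _ _ _.
have cN : in_range c by apply: (allP _ _ cin); exact: es1N.
have := IH (cut m rays c) (c :: es0) (rem c (e :: es1)).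
rewrite size_rem//= => /(_ es1k) H.
apply: describes_eq_mem (H _ (cut_describe cN des)) => [e'|].
  have /perm_mem H' := perm_to_rem cin.
  by rewrite -[RHS]/(e' \in (e :: es1) ++ es0) !mem_cat H' !inE orbCA orbA.
apply/allP => e' h; apply: (allP (es1N : all in_range (e :: es1))).
exact: (mem_rem (h : e' \in rem c (e :: es1))).
Qed.

End DoubleDescription.
Arguments on {R} m x k.

(** * The solution cone of a block *)

(** The quadrilateral type that pairs [v] with [w]. *)
Definition quad_code (v w : nat) : nat :=
  (if v == 0 then w.-1 else if w == 0 then v.-1 else 5 - v - w)%N.

(** The coordinates of the two types whose discs meet face [i] of [t] in an arc around the
    corner [v]: a triangle and a quadrilateral. *)
Definition arc (t i v : nat) : nat * nat := (7 * t + v, 7 * t + 4 + quad_code v i)%N.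

Definition port_arc (B : block) (b : bool) (w : nat) : nat * nat :=
  arc (port B b).1 (nth 0%N (port B b).2 0) (nth 0%N (port B b).2 w).

Definition face_equations (B : block) (t i : nat) : seq equation :=
  let: (k, p) := entry B t i in
  if k is k'.+2 then
    [seq (arc t i v, arc k' (nth 0%N p i) (nth 0%N p v)) | v <- iota 0 4 & v != i]
  else [::].

Definition block_equations (B : block) : seq equation :=
  flatten [seq flatten [seq face_equations B t i | i <- iota 0 4] | t <- iota 0 (size (tets B))].

Definition port_equations (B : block) : seq equation :=
  [seq (port_arc B b 1%N, port_arc B b w) | b <- [:: false; true], w <- [:: 2; 3]%N].

Definition cone_equations (B : block) : seq equation :=
  block_equations B ++ port_equations B.

Definition cone_rays (B : block) : seq (seq nat) :=
  extreme_rays (size (tets B)) (cone_equations B).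

Definition incomparable (u v : seq nat) : bool := ~~ below u v && ~~ below v u.

(** A single computation, so that the rays are enumerated only once. *)
Definition certificate (B : block) (opens closeds : nat) : bool :=
  let rays := cone_rays B in
  let bottom v := weight v (port_arc B false 1) in
  [&& all (in_range (size (tets B))) (cone_equations B),
      all (one_quad (size (tets B))) rays,
      all (fun v => bottom v == weight v (port_arc B true 1)) rays,
      all (fun v => bottom v <= 1)%N rays,
      pairwise incomparable rays,
      count (fun v => bottom v == 1%N) rays == opens &
      count (fun v => bottom v == 0%N) rays == closeds].

(** Sealed in an inductive type, so that unification never evaluates the enumeration. *)
Variant certified (B : block) (opens closeds : nat) : Prop :=
  Certified of certificate B opens closeds.

(** The pieces of the four heads above the first [blockF]. *)
Definition word4 : seq block := [:: blockP; blockF].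
Definition word6 : seq block := [:: blockP; blockP; blockF].
Definition word7 : seq block := [:: blockP; blockF; blockP; blockF].
Definition word9 : seq block := [:: blockP; blockF; blockP; blockP; blockF].

Lemma layer_certificate : certified layer 17 1.
Proof. by split; vm_compute. Qed.
Lemma certificate4 : certified (opening word4) 17 1.
Proof. by split; vm_compute. Qed.
Lemma certificate6 : certified (opening word6) 69 1.
Proof. by split; vm_compute. Qed.
Lemma certificate7 : certified (opening word7) 141 3.
Proof. by split; vm_compute. Qed.
Lemma certificate9 : certified (opening word9) 581 3.
Proof. by split; vm_compute. Qed.

Section BlockCone.
Variables (R : realType) (B : block) (opens closeds : nat).
Hypothesis Bcert : certified B opens closeds.
Let m := size (tets B).

Definition bottom (v : seq nat) : nat := weight v (port_arc B false 1).
Definition open_rays : seq (seq nat) := [seq v <- cone_rays B | bottom v == 1%N].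
Definition closed_rays : seq (seq nat) := [seq v <- cone_rays B | bottom v == 0%N].

Lemma size_open_rays : size open_rays = opens.
Proof. by rewrite size_filter; case: Bcert => /and5P[_ _ _ _ /and3P[_ /eqP]]. Qed.

Lemma size_closed_rays : size closed_rays = closeds.
Proof. by rewrite size_filter; case: Bcert => /and5P[_ _ _ _ /and3P[_ _ /eqP]]. Qed.

Lemma cone_in_range e : e \in cone_equations B -> in_range m e.
Proof. by case: Bcert => /and5P[/allP H _ _ _ _]; exact: H. Qed.

Lemma cone_describe : describes R m (cone_rays B) (cone_equations B).
Proof. by apply: extreme_rays_describe; case: Bcert => /and5P[]. Qed.

Lemma ray_one_quad v : v \in cone_rays B -> one_quad m v.
Proof. by case: Bcert => /and5P[_ /allP H _ _ _]; exact: H. Qed.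

Lemma ray_bottom_top v : v \in cone_rays B -> bottom v = weight v (port_arc B true 1).
Proof. by case: Bcert => /and5P[_ _ /allP H _ _ /H /eqP]. Qed.

Lemma ray_bottom_le1 v : v \in cone_rays B -> (bottom v <= 1)%N.
Proof. by case: Bcert => /and5P[_ _ _ /allP H _ /H]. Qed.

Lemma rays_incomparable : pairwise incomparable (cone_rays B).
Proof. by case: Bcert => /and5P[_ _ _ _ /and3P[]]. Qed.

Lemma rays_uniq : uniq (cone_rays B).
Proof.
have := rays_incomparable; elim: (cone_rays B) => //= v s IH /andP[/allP vs /IH ->].
by rewrite andbT; apply/negP => /vs; rewrite /incomparable below_refl.
Qed.

Lemma below_ray_eq u v : u \in cone_rays B -> v \in cone_rays B -> below u v -> u = v.
Proof.
have := rays_incomparable; elim: (cone_rays B) => //= w s IH /andP[/allP ws sp].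
rewrite !inE => /predU1P[->|us] /predU1P[->|vs] //; last exact: IH.
  by move=> wv; have := ws v vs; rewrite /incomparable wv.
by move=> uw; have := ws u us; rewrite /incomparable uw andbF.
Qed.

Lemma block_ray_ok v : v \in cone_rays B -> ray_ok m (cone_equations B) v.
Proof. exact: cone_describe.1. Qed.

Lemma bottom_arc_in_range : ((port_arc B false 1).1 < 7 * m)%N /\ ((port_arc B false 1).2 < 7 * m)%N.
Proof.
have : (port_arc B false 1%N, port_arc B false 2%N) \in cone_equations B.
  by rewrite mem_cat !inE eqxx orbT.
by move/cone_in_range/and4P => [].
Qed.

Lemma top_arc_in_range : ((port_arc B true 1).1 < 7 * m)%N /\ ((port_arc B true 1).2 < 7 * m)%N.
Proof.
have : (port_arc B true 1%N, port_arc B true 2%N) \in cone_equations B.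
  by rewrite mem_cat !inE eqxx !orbT.
by move/cone_in_range/and4P => [].
Qed.

Section BlockSolution.
Variable x : nat -> R.
Hypothesis xs : solution m (cone_equations B) x.

(** The difference of the two weights vanishes on the rays; by [ray_descent] it can
    then be neither negative nor positive at a solution. *)
Lemma bottom_top : pair_sum x (port_arc B false 1) = pair_sum x (port_arc B true 1).
Proof.
pose e : equation := (port_arc B false 1, port_arc B true 1)%N.
have eN : in_range m e.
  by have [? ?] := bottom_arc_in_range; have [? ?] := top_arc_in_range; apply/and4P.
have ray0 v : v \in cone_rays B -> excess e (ray_fun R v) = 0.
  by move=> vr; rewrite excess_ray -(ray_bottom_top vr) subrr.
apply/eqP; rewrite -subr_eq0 -/(excess e x); case: ltgtP => // h.
- have [||v vr [_]] := ray_descent (F := excess e) cone_describe _ _ xs h.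
  + exact: excess_sub.
  + by move=> z; exact: excess0.
  by rewrite ray0// ltxx.
- have h' : - excess e x < 0 by rewrite oppr_lt0.
  have [||v vr [_]] := ray_descent (F := fun z => - excess e z) cone_describe _ _ xs h'.
  + by move=> z l v; rewrite excess_sub opprD mulrN.
  + by move=> z z0; rewrite (excess0 eN z0) oppr0.
  by rewrite ray0// oppr0 ltxx.
Qed.

Lemma open_ray_under : 0 < pair_sum x (port_arc B false 1) ->
  exists2 v, v \in open_rays & under (on m (ray_fun R v)) (on m x).
Proof.
move=> h; pose F (z : nat -> R) := - pair_sum z (port_arc B false 1).
have h' : F x < 0 by rewrite /F oppr_lt0.
have [||v vr [vx Fv]] := ray_descent (F := F) cone_describe _ _ xs h'.
- by move=> z l v; rewrite /F /pair_sum; ring.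
- move=> z z0; rewrite /F /pair_sum; have [a1 a2] := bottom_arc_in_range.
  by rewrite (z0 (Ordinal a1) : z _ = 0) (z0 (Ordinal a2) : z _ = 0) addr0 oppr0.
exists v => //; rewrite mem_filter vr andbT eqn_leq ray_bottom_le1//=.
by move: Fv; rewrite /F pair_sum_ray oppr_lt0 ltr0n.
Qed.

Lemma closed_ray_under : pair_sum x (port_arc B false 1) = 0 ->
  (exists k, on m x k != 0) ->
  exists2 v, v \in closed_rays & under (on m (ray_fun R v)) (on m x).
Proof.
move=> h xn0; have [v vr vx] := cone_describe.2 x xs xn0.
exists v => //; rewrite mem_filter vr andbT.
have [a1 a2] := bottom_arc_in_range.
have /eqP := h; rewrite /pair_sum paddr_eq0 ?(sol_ge0 xs)// => /andP[/eqP x1 /eqP x2].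
have /eqP := vx (Ordinal a1) x1; have /eqP := vx (Ordinal a2) x2.
by rewrite /on /ray_fun !pnatr_eq0 /bottom /weight => /eqP-> /eqP->.
Qed.

End BlockSolution.

Lemma under_ray_eq u v : u \in cone_rays B -> v \in cone_rays B ->
  under (on m (ray_fun R u)) (on m (ray_fun R v)) -> u = v.
Proof.
move=> ur vr uv; apply: below_ray_eq => //; apply/belowP.
have us := ray_size (block_ray_ok ur); have vs := ray_size (block_ray_ok vr).
split=> [|k vk]; first by rewrite us vs.
have [km|km] := ltnP k (7 * m); last by rewrite nth_default// us.
have := uv (Ordinal km); rewrite /on /ray_fun vk => /(_ erefl) /eqP.
by rewrite pnatr_eq0 => /eqP.
Qed.

Lemma ray_solution v : v \in cone_rays B -> solution m (cone_equations B) (ray_fun R v).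
Proof.
move=> vr; split.
- by move=> k _; exact: ler0n.
- move=> t q q' tm q3 q'3; rewrite !pnatr_eq0.
  have /all_iotaP /(_ t tm) := ray_one_quad vr; rewrite /=.
  move: q q' q3 q'3 => [|[|[|//]]] [|[|[|//]]] _ _ //=;
    by case: (nth 0%N v (7 * t + 4 + 0)) => [|?]; case: (nth 0%N v (7 * t + 4 + 1)) => [|?];
      case: (nth 0%N v (7 * t + 4 + 2)) => [|?].
- by move=> e ee; exact: ray_holds (block_ray_ok vr) ee.
Qed.

End BlockCone.

(** * The matching equations of a stack *)

Section RingEquations.
Variable R : realType.
Implicit Types (B S : block) (x : nat -> R).

Definition shift (k : nat) x : nat -> R := fun i => x (7 * k + i)%N.

Definition block_eqs B x : Prop := forall t i v k p,
  (t < size (tets B))%N -> (i < 4)%N -> (v < 4)%N -> v != i -> entry B t i = (k.+2, p) ->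
  holds x (arc t i v, arc k (nth 0%N p i) (nth 0%N p v)).

Lemma block_equationsP B x :
  block_eqs B x <-> forall e, e \in block_equations B -> holds x e.
Proof.
split=> [H e /flattenP[_ /mapP[t + ->]]|H t i v k p tB i4 v4 vi E].
  rewrite mem_iota => /andP[_ tB] /flattenP[_ /mapP[i + ->]].
  rewrite mem_iota => /andP[_ i4]; rewrite /face_equations.
  case E : (entry B t i) => [[|[|k]] p] // /mapP[v].
  rewrite mem_filter mem_iota => /andP[vi /andP[_ v4]] ->; exact: H.
apply: H; apply/flattenP; exists (flatten [seq face_equations B t i | i <- iota 0 4]).
  by apply/mapP; exists t => //; rewrite mem_iota.
apply/flattenP; exists (face_equations B t i).
  by apply/mapP; exists i => //; rewrite mem_iota.
by rewrite /face_equations E; apply/mapP; exists v; rewrite // mem_filter vi mem_iota.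
Qed.

Lemma pair_sum_shift n t i v x :
  pair_sum x (arc (n + t) i v) = pair_sum (shift n x) (arc t i v).
Proof. by rewrite /pair_sum /shift /arc /= mulnDr !addnA. Qed.

Definition port_sum B b w x : R := pair_sum x (port_arc B b w).

Lemma port_sum_stack_top B S w x :
  port_sum (stack B S) true w x = port_sum S true w (shift (size (tets B)) x).
Proof. by rewrite /port_sum /port_arc /= addnC pair_sum_shift. Qed.

Lemma port_label_neq B b w : block_wf B -> (0 < w < 4)%N ->
  (nth 0 (port B b).2 w != nth 0 (port B b).2 0)%N.
Proof.
move=> wf /andP[w0 w4]; have [_ s4] := block_wf_port b wf.
have su : uniq (port B b).2 by rewrite (perm_uniq s4) iota_uniq.
by rewrite (nth_uniq 0%N)// ?(perm_size s4)// -lt0n.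
Qed.

Lemma entry_port_label B t i v b q : block_wf B -> reversible B ->
  (t < size (tets B))%N -> (i < 4)%N -> (v < 4)%N -> v != i ->
  entry B t i = (nat_of_bool b, q) ->
  [/\ (0 < nth 0%N q v < 4)%N, perm_eq q (iota 0 4), nth 0%N q i = 0%N &
      arc t i v = port_arc B b (nth 0%N q v)].
Proof.
move=> wf rv tB i4 v4 vi E; have [_ q4 qi] := block_wf_entry wf tB i4 E.
have {}qi : nth 0%N q i = 0%N by apply: qi; case: (b).
have [tE sq] := entry_port rv tB i4 E.
split => //; last first.
  by have e0 := sq i i4; rewrite qi in e0; rewrite /port_arc tE sq// e0.
rewrite perm4_lt// andbT lt0n; apply: contra vi => /eqP e.
by rewrite -(sq v v4) -(sq i i4) e qi.
Qed.

Section StackEquations.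
Variables B S : block.
Hypotheses (Bf : fits B) (Sf : fits S).
Let n := size (tets B).

(** The only new equations compare the arcs on the two ports that are glued. *)
Lemma stack_eqs x : block_eqs (stack B S) x <->
  [/\ block_eqs B x, block_eqs S (shift n x) &
      forall w, (0 < w < 4)%N -> port_sum B true w x = port_sum S false w (shift n x)].
Proof.
have [_ Bwf Brev] := Bf; have [_ Swf Srev] := Sf.
split=> [H|[HB HS HP] t i v k p].
  split.
  - move=> t i v k p tn i4 v4 vi E; apply: H => //.
      by rewrite size_stack (leq_trans tn)// leq_addr.
    by rewrite entry_stack_low// E.
  - move=> t i v k p tm i4 v4 vi E.
    have := H (n + t)%N i v (k + n)%N p; rewrite size_stack ltn_add2l entry_stack_high// E.
    rewrite /down_face /= => /(_ tm i4 v4 vi erefl).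
    by rewrite /holds /= (addnC _ n) !pair_sum_shift.
  - move=> w w03; have [q [E q4 _ qs]] := port_entryE true Bwf Brev.
    have [Bn s4] := block_wf_port true Bwf; have /andP[w0 w4] := w03.
    have := H (port B true).1 (nth 0 (port B true).2 0)%N (nth 0 (port B true).2 w)%N
      ((port S false).1 + n)%N (pcomp (port S false).2 q).
    rewrite size_stack entry_stack_low ?perm4_lt// E /up_face /= addn2.
    rewrite (leq_trans Bn) ?leq_addr// => /(_ isT isT isT).
    rewrite port_label_neq// => /(_ isT erefl).
    rewrite /holds /= !comp_nth ?(perm_size q4) ?perm4_lt// !qs//.
    by rewrite (addnC _ n) pair_sum_shift.
rewrite size_stack => tnm i4 v4 vi.
have [tn|tn] := ltnP t n.
  rewrite entry_stack_low//; case E : (entry B t i) => [k' q]; rewrite /up_face /=.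
  case: eqP => [k1|k1] [].
    rewrite addn2 => -[<- <-]; rewrite k1 -[1%N]/(nat_of_bool true) in E.
    have [qv q4 qi aE] := entry_port_label Bwf Brev tn i4 v4 vi E.
    rewrite !comp_nth ?(perm_size q4)// qi /holds /= aE (addnC _ n) pair_sum_shift.
    exact: HP.
  by move=> kk pp; rewrite kk pp in E; exact: HB E.
have tm : (t - n < size (tets S))%N by rewrite ltn_subLR.
rewrite -(subnKC tn) entry_stack_high//; case E : (entry S (t - n) i) => [k' q].
rewrite /down_face /=; case: eqP => [k0|k0]; last case: eqP => [-> []//|k1].
  rewrite addn2 => -[<- <-]; rewrite k0 -[0%N]/(nat_of_bool false) in E.
  have [qv q4 qi aE] := entry_port_label Swf Srev tm i4 v4 vi E.
  rewrite !comp_nth ?(perm_size q4)// qi /holds /= pair_sum_shift aE.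
  exact/esym/HP.
case: k' k0 k1 E => [|[|k']] // _ _ E [<- <-].
by rewrite /holds /= (addnC _ n) !pair_sum_shift; exact: HS E.
Qed.

End StackEquations.

Definition closed_eqs B x : Prop := forall t i v,
  (t < size (tets B))%N -> (i < 4)%N -> (v < 4)%N -> v != i ->
  let: (k, p) := closed_next B t i in
  holds x (arc t i v, arc k (nth 0%N p i) (nth 0%N p v)).

Lemma closed_eqsP B x : fits B -> closed_eqs B x <->
  block_eqs B x /\ forall w, (0 < w < 4)%N ->
    port_sum B false w x = port_sum B true (nth 0%N (twist false) w) x.
Proof.
move=> [_ wf rv]; split=> [H|[HB HP] t i v tB i4 v4 vi].
  split.
    move=> t i v k p tB i4 v4 vi E; have := H t i v tB i4 v4 vi.
    by rewrite /closed_next E.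
  move=> w w03; have [q [E q4 _ qs]] := port_entryE false wf rv.
  have [Bn s4] := block_wf_port false wf; have /andP[w0 w4] := w03.
  have := H (port B false).1 (nth 0 (port B false).2 0)%N (nth 0 (port B false).2 w)%N Bn
    (perm4_lt s4 (isT : 0 < 4)%N) (perm4_lt s4 w4) (port_label_neq _ wf w03).
  rewrite (closed_next_port E).
  rewrite /holds /= !comp_nth ?size_map ?(perm_size q4) ?perm4_lt// !qs//.
case E : (entry B t i) => [k q].
have [[b kb]|[k' kk]] : (exists b, k = nat_of_bool b) \/ exists k', k = k'.+2.
- by case: (k) => [|[|k']]; [left; exists false|left; exists true|right; exists k'].
- rewrite kb in E; rewrite (closed_next_port E).
  have [qv q4 qi aE] := entry_port_label wf rv tB i4 v4 vi E.
  rewrite !comp_nth ?size_map ?(perm_size q4)// qi /holds /= aE.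
  case: b {E kb aE} => /=; last exact: HP.
  have tw : (0 < nth 0 (twist true) (nth 0 q v) < 4)%N.
    by move: qv; case: (nth 0%N q v) => [|[|[|[|]]]].
  have := HP _ tw; rewrite (twistK true (andP qv).2) => e.
  exact/esym/e.
- by rewrite kk in E; rewrite /closed_next E; exact: HB E.
Qed.

End RingEquations.

(** * The common weight around a ring *)

Section Folds.
Variable R : realType.

Definition fold_bottom B (a b : nat) : Prop :=
  forall x : nat -> R, block_eqs B x -> port_sum B false a x = port_sum B false b x.

Definition fold_top B : Prop :=
  forall x : nat -> R, block_eqs B x -> port_sum B true 1 x = port_sum B true 2 x.

Lemma fold_bottom_stack B S a b : fits B -> fits S ->
  fold_bottom B a b -> fold_bottom (stack B S) a b.
Proof. by move=> Bf Sf FB x /(stack_eqs Bf Sf)[/FB]. Qed.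

Lemma fold_top_stack B S : fits B -> fits S -> fold_top S -> fold_top (stack B S).
Proof.
by move=> Bf Sf FS x /(stack_eqs Bf Sf)[_ /FS e _]; rewrite !port_sum_stack_top.
Qed.

(** The matching equations of the fold at the vertices 0 and 2. *)
Lemma fold_F x : block_eqs blockF x -> x 4%N = x 5%N /\ x 1%N = x 2%N :> R.
Proof.
move=> H; have H1 v p := H 0%N 1%N v 0%N p isT isT.
have h1 : x 0%N + x 4%N = x 0%N + x 5%N := H1 0%N _ isT isT erefl.
have h2 : x 2%N + x 6%N = x 1%N + x 6%N := H1 2%N _ isT isT erefl.
by split; lra.
Qed.

Lemma fold_bottom_F : fold_bottom blockF 1 2.
Proof.
move=> x /fold_F [h1 h2]; rewrite -[LHS]/(x 1%N + x 4%N) -[RHS]/(x 2%N + x 5%N).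
by rewrite h1 h2.
Qed.

Lemma fold_top_F : fold_top blockF.
Proof.
move=> x /fold_F [h1 h2]; rewrite -[LHS]/(x 1%N + x 5%N) -[RHS]/(x 2%N + x 4%N).
by rewrite h1 h2.
Qed.

Lemma fold_bottom_layer : fold_bottom layer 1 3.
Proof.
do 2!(apply: fold_bottom_stack; [by do ?apply: fits_stack; do ?[exact: fits_T|exact: fits_P|exact: fits_F]|by do ?[exact: fits_P|exact: fits_F]|]).
move=> x H; have H1 v p := H 0%N 1%N v 0%N p isT isT.
have h1 : x 0%N + x 4%N = x 0%N + x 5%N := H1 0%N _ isT isT erefl.
have h2 : x 2%N + x 6%N = x 1%N + x 6%N := H1 2%N _ isT isT erefl.
rewrite -[LHS]/(x 2%N + x 5%N) -[RHS]/(x 1%N + x 4%N); lra.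
Qed.

Lemma fold_top_layer : fold_top layer.
Proof.
apply: fold_top_stack fold_top_F; last exact: fits_F.
exact: fits_stack fits_T fits_P.
Qed.

End Folds.

Section Ring.
Variables (R : realType) (w : seq block) (j : nat).
Hypothesis ws : forall B, List.In B w -> untwisted B.
Local Notation head := (opening w).
Local Notation r := (size (tets head)).

Definition block_at (b : nat) : block := if b is 0 then head else layer.
Definition offset (b : nat) : nat := if b is b'.+1 then (r + 4 * b')%N else 0%N.
Definition part (b : nat) (x : nat -> R) : nat -> R := shift (offset b) x.

Lemma head_fits : fits head.
Proof. exact: (opening_collapses R ws).1. Qed.

Lemma ring_fits k : fits (ring w k).
Proof. exact: (ring_collapses R k ws).1. Qed.

Lemma size_ring k : size (tets (ring w k)) = (r + 4 * k)%N.
Proof.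
elim: k => [|k IH]; first by rewrite muln0 addn0.
by rewrite /ring iterS size_stack -/(ring w k) IH -addnA -mulnSr.
Qed.

Lemma head_fold_bottom : fold_bottom R head 1 2.
Proof.
rewrite /opening; have := fold_bottom_F (R := R); have := fits_F; move: ws.
elim: w (blockF) => [|S s IH] B //= sU Bf FB; have Sf : fits S.
  by case: (sU S (or_introl erefl)) => ->; [exact: fits_F|exact: fits_P].
apply: IH => //; first by move=> C Cs; apply: sU; right.
  exact: fits_stack.
exact: fold_bottom_stack.
Qed.

Lemma port_sum_ring_top k v x :
  port_sum (ring w k) true v x = port_sum (block_at k) true v (part k x).
Proof. by case: k => [|k] //; rewrite /ring iterS port_sum_stack_top -/(ring w k) size_ring. Qed.

Lemma port_sum_ring_bottom k v x :
  port_sum (ring w k) false v x = port_sum head false v (part 0 x).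
Proof. by elim: k. Qed.

Lemma ring_eqs k x : block_eqs (ring w k) x <->
  (forall b, (b <= k)%N -> block_eqs (block_at b) (part b x)) /\
  (forall b v, (b < k)%N -> (0 < v < 4)%N ->
    port_sum (block_at b) true v (part b x) = port_sum layer false v (part b.+1 x)).
Proof.
elim: k => [|k IH].
  split=> [H|[H _]]; last exact: (H 0%N).
  by split => // -[|b].
rewrite /ring iterS -/(ring w k); split.
  move=> /(stack_eqs (ring_fits k) fits_layer) [/IH[H1 H2] H3 H4]; rewrite size_ring in H3 H4.
  split=> [b|b v]; rewrite ?ltnS leq_eqVlt => /predU1P[->|bk] //; first exact: H1.
    by rewrite -port_sum_ring_top; exact: H4.
  exact: H2.
move=> [H1 H2]; apply/(stack_eqs (ring_fits k) fits_layer); rewrite size_ring.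
split; last by move=> v v4; rewrite port_sum_ring_top; exact: H2.
  apply/IH; split=> [b bk|b v bk]; first by apply: H1; exact: leqW.
  by apply: H2; exact: leqW.
exact: (H1 k.+1).
Qed.

Lemma ring_join (x : nat -> R) c :
  (forall b, (b <= j)%N -> block_eqs (block_at b) (part b x)) ->
  (forall b s v, (b <= j)%N -> (0 < v < 4)%N -> port_sum (block_at b) s v (part b x) = c) ->
  closed_eqs (ring w j) x.
Proof.
move=> H1 H2; apply/(closed_eqsP _ (ring_fits j)); split.
  apply/ring_eqs; split => // b v bj v4.
  by rewrite H2 ?(ltnW bj)// (H2 b.+1).
move=> v v4; rewrite port_sum_ring_top port_sum_ring_bottom (H2 0%N)// H2//.
by case: v v4 => [|[|[|[|]]]].
Qed.

Lemma port_equationsP B (x : nat -> R) :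
  (forall s, port_sum B s 1 x = port_sum B s 2 x /\ port_sum B s 1 x = port_sum B s 3 x) <->
  forall e, e \in port_equations B -> holds x e.
Proof.
split=> [H e|H s].
  by rewrite !inE => /or4P[] /eqP->; rewrite /holds /=; [case: (H false)|case: (H false)|case: (H true)|case: (H true)].
by case: s; split; apply: (H (_, _)); rewrite !inE eqxx ?orbT.
Qed.

Hypothesis head_fold_top : fold_top R head.

Section Split.
Variable x : nat -> R.
Hypothesis x0 : forall k, (k < 7 * size (tets (ring w j)))%N -> 0 <= x k.
Hypothesis xq : forall t q q', (t < size (tets (ring w j)))%N -> (q < 3)%N -> (q' < 3)%N ->
    x (7 * t + 4 + q)%N != 0 -> x (7 * t + 4 + q')%N != 0 -> q = q'.
Hypothesis xe : closed_eqs (ring w j) x.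

Local Notation bot b v := (port_sum (block_at b) false v (part b x)).
Local Notation top b v := (port_sum (block_at b) true v (part b x)).

Lemma block_at_fold_top b : (b <= j)%N -> top b 1 = top b 2.
Proof.
have /(closed_eqsP _ (ring_fits j)) [/ring_eqs[H _] _] := xe.
by case: b => [|b] bj; [apply: head_fold_top (H 0%N bj)|apply: fold_top_layer (H b.+1 bj)].
Qed.

(** On the top port of a block the arcs 1 and 2 are equal, on the bottom port of a layer
    the arcs 1 and 3: the rotation makes all three of them equal. *)
Lemma interface b : (b < j)%N ->
  [/\ top b 1 = top b 2, top b 1 = top b 3, bot b.+1 1 = bot b.+1 2,
      bot b.+1 1 = bot b.+1 3 & top b 1 = bot b.+1 1].
Proof.
move=> bj; have /(closed_eqsP _ (ring_fits j)) [/ring_eqs[H1 H2] _] := xe.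
have t12 := block_at_fold_top (ltnW bj).
have b13 : bot b.+1 1 = bot b.+1 3 := fold_bottom_layer (H1 b.+1 bj).
have tb v : (0 < v < 4)%N -> top b v = bot b.+1 v := H2 b v bj.
have := tb 1%N isT; have := tb 2%N isT; have := tb 3%N isT => e3 e2 e1.
by rewrite e1 e2 e3 in t12 *; rewrite -b13 -t12.
Qed.

Lemma closing_interface :
  [/\ bot 0 1 = bot 0 2, bot 0 1 = bot 0 3, top j 1 = top j 2 & top j 1 = top j 3].
Proof.
have /(closed_eqsP _ (ring_fits j)) [/ring_eqs[H1 H2] H3] := xe.
have t12 := block_at_fold_top (leqnn j).
have b12 : bot 0 1 = bot 0 2 := head_fold_bottom (H1 0%N (leq0n j)).
have tb v : (0 < v < 4)%N -> bot 0 v = top j (nth 0%N (twist false) v).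
  by move=> v4; rewrite -(port_sum_ring_bottom j) H3// port_sum_ring_top.
have := tb 1%N isT; have := tb 2%N isT; have := tb 3%N isT => /= e3 e2 e1.
by rewrite e1 e2 e3 in b12 *; rewrite b12 t12.
Qed.

Variables (o1 z1 o2 z2 : nat).
Hypothesis head_cert : certified head o1 z1.
Hypothesis layer_cert : certified layer o2 z2.

Lemma part_solution b : (b <= j)%N ->
  solution (size (tets (block_at b))) (cone_equations (block_at b)) (part b x).
Proof.
move=> bj; have /(closed_eqsP _ (ring_fits j)) [/ring_eqs[H1 H2] _] := xe.
have szb : (offset b + size (tets (block_at b)) <= size (tets (ring w j)))%N.
  rewrite size_ring; case: b bj => [|b] bj; first exact: leq_addr.
  by rewrite -[size _]/4%N -[offset _]/(r + 4 * b)%N -addnA leq_add2l -mulnSr leq_mul2l.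
split.
- move=> k kb; apply: x0; apply: leq_trans (_ : 7 * (offset b + size (tets (block_at b))) <= _)%N.
    by rewrite mulnDr ltn_add2l.
  by rewrite leq_mul2l.
- move=> t q q' tb q3 q'3; have pE i : part b x (7 * t + 4 + i)%N = x (7 * (offset b + t) + 4 + i)%N.
    by rewrite /part /shift mulnDr !addnA.
  have tr : (offset b + t < size (tets (ring w j)))%N.
    by apply: leq_trans szb; rewrite ltn_add2l.
  by rewrite !pE; exact: xq tr q3 q'3.
- move=> e; rewrite mem_cat => /orP[|].
    by move: e; apply/block_equationsP; exact: H1.
  move: e; apply/port_equationsP => -[].
    have [->|bj'] := eqVneq b j.
      by have [_ _ h1 h2] := closing_interface; exact: (conj h1 h2).
    have blt : (b < j)%N by rewrite ltn_neqAle bj' bj.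
    by have [h1 h2 _ _ _] := interface blt; exact: (conj h1 h2).
  move: bj {szb}; case: b => [|b] bj.
    by have [h1 h2 _ _] := closing_interface; exact: (conj h1 h2).
  by have [_ _ h1 h2 _] := interface bj; exact: (conj h1 h2).
Qed.

Lemma bottoms_equal b : (b <= j)%N -> bot b 1 = bot 0 1.
Proof.
elim: b => [_|b IH bj]; first exact: erefl.
have [_ _ _ _ e] := interface bj; apply: etrans (esym e) _.
apply: etrans _ (IH (ltnW bj)); have xs := part_solution (ltnW bj).
move: xs; move: (part b x) => y; case: b {IH bj e} => [|b] ys.
  exact/esym/(bottom_top head_cert ys).
exact/esym/(bottom_top layer_cert ys).
Qed.

End Split.
End Ring.

(** * Counting the vertices of a ring *)

Section Flatten.
Variables (R : realType) (B : block) (Bf : fits B).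
Local Notation m := (size (tets B)).
Local Notation coordinate := ('I_m * ('I_4 + 'I_3))%type.
Local Notation vec := {ffun coordinate -> R}.

Definition code (c : coordinate) : nat :=
  (7 * c.1 + match c.2 with inl v => nat_of_ord v | inr q => 4 + q end)%N.

Lemma code_type_lt (s : 'I_4 + 'I_3) :
  (match s with inl v => nat_of_ord v | inr q => 4 + q end < 7)%N.
Proof. by case: s => [v|q]; [have := ltn_ord v; lia|have := ltn_ord q; lia]. Qed.

Lemma code_lt c : (code c < 7 * m)%N.
Proof.
case: c => t s; apply: (@leq_trans (7 * t.+1)); last by rewrite leq_mul2l ltn_ord.
by rewrite /code mulnS addnC ltn_add2r; exact: code_type_lt.
Qed.

Lemma code_inj : injective code.
Proof.
move=> [t s] [t' s'] e; have d := code_type_lt s; have d' := code_type_lt s'.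
have : (code (t, s) %/ 7 = code (t', s') %/ 7)%N /\ (code (t, s) %% 7 = code (t', s') %% 7)%N.
  by rewrite e.
rewrite /code /= !(mulnC 7) !divnMDl// !modnMDl !(divn_small d) !(divn_small d').
rewrite !(modn_small d) !(modn_small d') !addn0 => -[/val_inj-> ss]; congr pair.
case: s s' {e d d'} ss => [v|q] [v'|q'].
- by move=> /val_inj ->.
- by have := ltn_ord v => /[swap] ->; rewrite ltnNge leq_addr.
- by have := ltn_ord v' => /[swap] <-; rewrite ltnNge leq_addr.
- by move=> /addnI /val_inj ->.
Qed.

Lemma code_surj k : (k < 7 * m)%N -> exists c, code c = k.
Proof.
move=> km; have t_lt : (k %/ 7 < m)%N by rewrite ltn_divLR// mulnC.
have [s sE] : exists s : 'I_4 + 'I_3,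
    (match s with inl v => nat_of_ord v | inr q => 4 + q end = k %% 7)%N.
  have := ltn_pmod k (isT : 0 < 7)%N; move: (k %% 7)%N => d d7.
  have [d4|d4] := ltnP d 4; first by exists (inl (Ordinal d4)).
  have d3 : (d - 4 < 3)%N by rewrite ltn_subLR.
  by exists (inr (Ordinal d3)); exact: subnKC.
by exists (Ordinal t_lt, s); rewrite /code /= sE mulnC -divn_eq.
Qed.

Definition weights (x : vec) : nat -> R :=
  fun k => if [pick c | code c == k] is Some c then x c else 0.

Definition of_weights (f : nat -> R) : vec := [ffun c => f (code c)].

Lemma weights_code x c : weights x (code c) = x c.
Proof.
rewrite /weights; case: pickP => [c' /eqP /code_inj -> //|/(_ c)].
by rewrite eqxx.
Qed.

Lemma weights_of_weights f k : (k < 7 * m)%N -> weights (of_weights f) k = f k.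
Proof. by move=> /code_surj [c <-]; rewrite weights_code ffunE. Qed.

Lemma quad_code_lt (v w : nat) : (v < 4)%N -> (w < 4)%N -> v != w -> (quad_code v w < 3)%N.
Proof. by case: v => [|[|[|[|]]]] // _; case: w => [|[|[|[|]]]]. Qed.

Lemma pair_sum_weights x (t : 'I_m) (i v : 'I_4) : v != i ->
  pair_sum (weights x) (arc t i v) = x (t, inl v) + x (t, inr (quad_type v i)).
Proof.
move=> vi; rewrite /pair_sum /arc -(weights_code x (t, inl v)).
rewrite -(weights_code x (t, inr (quad_type v i))) /code /=; congr (_ + weights x _).
rewrite -addnA; congr (_ + (_ + _))%N.
by rewrite /quad_type inordK//; exact: quad_code_lt.
Qed.

Lemma matchingP x : matching_equations (triangulation_of Bf) x <-> closed_eqs B (weights x).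
Proof.
have step (t : 'I_m) (i v : 'I_4) : v != i ->
    (let: (k, p) := closed_next B t i in
     holds (weights x) (arc t i v, arc k (nth 0%N p i) (nth 0%N p v))) <->
    x (t, inl v) + x (t, inr (quad_type v i)) =
    x ((face_target t i).1, inl ((face_target t i).2 v)) +
    x ((face_target t i).1, inr (quad_type ((face_target t i).2 v) ((face_target t i).2 i))).
  move=> vi; case E : (closed_next B t i) => [k p].
  have [e1 e2] := face_targetE Bf E.
  rewrite /holds -e1 -!e2 [pair_sum _ _]pair_sum_weights// [X in _ = X]pair_sum_weights//.
  by rewrite (inj_eq perm_inj).
split=> [H t i v tm i4 v4 vi|H t i v vi].
  have vi' : Ordinal v4 != Ordinal i4 by [].
  exact: (proj2 (step (Ordinal tm) _ _ vi') (H (Ordinal tm) _ _ vi')).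
by apply: (proj1 (step t i v vi)); apply: H.
Qed.

Lemma quadrilateralP x : quadrilateral_constraints x <->
  forall t q q', (t < m)%N -> (q < 3)%N -> (q' < 3)%N ->
    weights x (7 * t + 4 + q)%N != 0 -> weights x (7 * t + 4 + q')%N != 0 -> q = q'.
Proof.
have E (t : 'I_m) (q : 'I_3) : weights x (7 * t + 4 + q)%N = x (t, inr q).
  by rewrite -weights_code /code /= addnA.
split=> [H t q q' tm q3 q'3|H t q q' tq tq'].
  rewrite (E (Ordinal tm) (Ordinal q3)) (E (Ordinal tm) (Ordinal q'3)) => a b.
  by have [] := H _ _ _ a b.
rewrite -E in tq; rewrite -E in tq'.
exact: val_inj (H t q q' (ltn_ord t) (ltn_ord q) (ltn_ord q') tq tq').
Qed.

End Flatten.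
Arguments of_weights {R} B f.

Section RingCount.
Variables (R : realType) (w : seq block) (j : nat).
Hypothesis ws : forall B, List.In B w -> untwisted B.
Local Notation head := (opening w).
Local Notation r := (size (tets head)).
Local Notation blk := (block_at w).
Local Notation off := (offset w).
Local Notation width b := (7 * size (tets (blk b)))%N.

Definition glue (f : nat -> nat -> R) : nat -> R := fun k =>
  if (k < 7 * r)%N then f 0%N k
  else f ((k - 7 * r) %/ 28).+1 ((k - 7 * r) %% 28)%N.

Lemma part_glue f b k : (k < width b)%N -> part w b (glue f) k = f b k.
Proof.
rewrite /part /shift /glue; case: b => [|b] kb; first by rewrite muln0 add0n ifT.
have k28 : (k < 28)%N by exact: kb.
rewrite -[off b.+1]/(r + 4 * b)%N mulnDr -addnA ltnNge leq_addr /= addKn.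
rewrite mulnA -[(7 * 4)%N]/28%N (mulnC 28) divnMDl// modnMDl divn_small// modn_small//.
by rewrite addn0.
Qed.

Lemma coordinate_block k : (k < 7 * size (tets (ring w j)))%N ->
  exists b k', [/\ (b <= j)%N, (k' < width b)%N & k = (7 * off b + k')%N].
Proof.
rewrite size_ring => kj; have [kr|kr] := ltnP k (7 * r).
  by exists 0%N, k; split => //; rewrite muln0.
exists ((k - 7 * r) %/ 28).+1, ((k - 7 * r) %% 28)%N; split.
- by rewrite ltn_divLR// ltn_subLR//; apply: leq_trans kj _; rewrite mulnDr mulnA (mulnC j).
- exact: (ltn_pmod _ (isT : 0 < 28)%N).
- rewrite -[off _]/(r + 4 * _)%N mulnDr mulnA -[(7 * 4)%N]/28%N -addnA (mulnC 28) -divn_eq.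
  by rewrite subnKC.
Qed.

Lemma block_coordinate b k : (b <= j)%N -> (k < width b)%N ->
  (7 * off b + k < 7 * size (tets (ring w j)))%N.
Proof.
rewrite size_ring => bj kb.
apply: (@leq_trans (7 * (off b + size (tets (blk b))))).
  by rewrite mulnDr ltn_add2l.
rewrite leq_mul2l /=; case: b bj {kb} => [|b] bj; first exact: leq_addr.
by rewrite -[size _]/4%N -[off _]/(r + 4 * b)%N -addnA leq_add2l -mulnSr leq_mul2l.
Qed.


Local Notation tri := (triangulation_of (ring_fits R ws j)).
Local Notation vec := {ffun 'I_(size (tets (ring w j))) * ('I_4 + 'I_3) -> R}.
Local Notation section b x := (on (size (tets (blk b))) (part w b x)).

Lemma under_parts (x y : vec) :
  under x y <-> forall b, (b <= j)%N -> under (section b (weights x)) (section b (weights y)).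
Proof.
split=> [xy b bj k|xy c yc].
  rewrite /on /part /shift; have [c <-] := code_surj (block_coordinate bj (ltn_ord k)).
  by rewrite !weights_code; exact: xy.
have [b [k [bj kb ck]]] := coordinate_block (code_lt c).
have := xy b bj (Ordinal kb); rewrite /on /part /shift /= -ck !weights_code.
exact.
Qed.

Lemma part_of_weights f b (k : 'I_(width b)) : (b <= j)%N ->
  section b (weights (of_weights (ring w j) (glue f))) k = f b k.
Proof.
move=> bj; rewrite -(part_glue f (ltn_ord k)) /on /part /shift.
by rewrite weights_of_weights//; exact: block_coordinate.
Qed.

Hypothesis head_fold_top : fold_top R head.
Variables (o1 z1 o2 z2 : nat).
Hypothesis head_cert : certified head o1 z1.
Hypothesis layer_cert : certified layer o2 z2.

(** An open ray for the head and one for each layer, or a closed ray of the head, or a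
    layer with one of its closed rays. *)
Definition ring_index : finType :=
  (('I_o1 * {ffun 'I_j -> 'I_o2}) + ('I_z1 + 'I_j * 'I_z2))%type.

Definition level (a : ring_index) : nat := if a is inl _ then 1%N else 0%N.

Definition block_ray (a : ring_index) (b : nat) : seq nat :=
  match a, b with
  | inl (h, l), 0%N => nth [::] (open_rays head) h
  | inl (h, l), b'.+1 =>
      if insub b' is Some i then nth [::] (open_rays layer) (l i) else [::]
  | inr (inl h), 0%N => nth [::] (closed_rays head) h
  | inr (inr (i, l)), b'.+1 => if b' == i then nth [::] (closed_rays layer) l else [::]
  | _, _ => [::]
  end.

Definition ring_ray (a : ring_index) : vec :=
  of_weights (ring w j) (glue (fun b => ray_fun R (block_ray a b))).

Lemma section_ring_ray a b (k : 'I_(width b)) : (b <= j)%N ->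
  section b (weights (ring_ray a)) k = ray_fun R (block_ray a b) k.
Proof. exact: part_of_weights. Qed.

Lemma mem_open B o z (i : 'I_o) : certified B o z ->
  nth [::] (open_rays B) i \in cone_rays B /\ bottom B (nth [::] (open_rays B) i) = 1%N.
Proof.
move=> cert; have : nth [::] (open_rays B) i \in open_rays B.
  by rewrite mem_nth// (size_open_rays cert).
by rewrite mem_filter => /andP[/eqP-> ->].
Qed.

Lemma mem_closed B o z (i : 'I_z) : certified B o z ->
  nth [::] (closed_rays B) i \in cone_rays B /\ bottom B (nth [::] (closed_rays B) i) = 0%N.
Proof.
move=> cert; have : nth [::] (closed_rays B) i \in closed_rays B.
  by rewrite mem_nth// (size_closed_rays cert).
by rewrite mem_filter => /andP[/eqP-> ->].
Qed.

Lemma block_cert b : exists o z, certified (blk b) o z.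
Proof. by case: b => [|b]; [exists o1, z1|exists o2, z2]. Qed.

Lemma block_rayP a b : (b <= j)%N ->
  block_ray a b \in cone_rays (blk b) /\ bottom (blk b) (block_ray a b) = level a \/
  block_ray a b = [::] /\ level a = 0%N.
Proof.
case: a => [[h l]|[h|[i l]]]; case: b => [|b] bj; rewrite /block_ray /level.
- left; exact: mem_open head_cert.
- by left; rewrite (insubT (fun i => i < j)%N bj); exact: mem_open layer_cert.
- left; exact: mem_closed head_cert.
- by right.
- by right.
- case: eqP => _; last by right.
  left; exact: mem_closed layer_cert.
Qed.

Lemma block_ray_solution a b : (b <= j)%N ->
  solution (size (tets (blk b))) (cone_equations (blk b)) (ray_fun R (block_ray a b)) /\
  forall s, port_sum (blk b) s 1 (ray_fun R (block_ray a b)) = (level a)%:R.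
Proof.
move=> bj; have [k1 [k2 cert]] := block_cert b.
case: (block_rayP a bj) => -[].
  move=> ar lv; split; first exact: ray_solution cert _ ar.
  move=> s; rewrite /port_sum pair_sum_ray -lv; congr _%:R.
  case: s => //; exact/esym/(ray_bottom_top cert ar).
move=> -> ->; have z0 k : ray_fun R [::] k = 0 by rewrite /ray_fun nth_nil.
split; last by move=> s; rewrite /port_sum /pair_sum !z0 addr0.
split; first by move=> k _; rewrite z0.
  by move=> t q q' _ _ _; rewrite z0 eqxx.
by move=> e _; rewrite /holds /pair_sum !z0.
Qed.

Lemma glue_ge0 a k : 0 <= glue (fun b => ray_fun R (block_ray a b)) k.
Proof. by rewrite /glue; case: ifP => _; exact: ler0n. Qed.

Lemma holds_ext m e (x y : nat -> R) : in_range m e ->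
  (forall k, (k < 7 * m)%N -> x k = y k) -> holds x e -> holds y e.
Proof. by move=> /and4P[a b c d] xy; rewrite /holds /pair_sum !xy. Qed.

Lemma ring_ray_cone a : admissible_cone tri (ring_ray a).
Proof.
have flatE b k : (b <= j)%N -> (k < width b)%N ->
    part w b (weights (ring_ray a)) k = ray_fun R (block_ray a b) k.
  by move=> bj kb; exact: (section_ring_ray a (Ordinal kb) bj).
have sol b (bj : (b <= j)%N) e : e \in cone_equations (blk b) ->
    holds (part w b (weights (ring_ray a))) e.
  move=> ee; have [k1 [k2 cert]] := block_cert b.
  apply: holds_ext (cone_in_range cert ee) _ (sol_eq (block_ray_solution a bj).1 ee).
  by move=> k kb; rewrite flatE.
split.
- by move=> c; rewrite ffunE; exact: glue_ge0.
- apply/matchingP; apply: (@ring_join R w j ws _ (level a)%:R) => [b bj|b s v bj v4].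
    by apply/block_equationsP => e ee; apply: sol => //; rewrite mem_cat ee.
  have P : forall e, e \in port_equations (blk b) ->
      holds (part w b (weights (ring_ray a))) e.
    by move=> e ee; apply: sol => //; rewrite mem_cat ee orbT.
  have [p2 p3] := (proj2 (port_equationsP _ _) P) s.
  have p1 : port_sum (blk b) s 1 (part w b (weights (ring_ray a))) = (level a)%:R.
    have [k1 [k2 cert]] := block_cert b.
    rewrite -((block_ray_solution a bj).2 s) /port_sum /pair_sum.
    have [lo hi] : ((port_arc (blk b) s 1).1 < width b)%N /\ ((port_arc (blk b) s 1).2 < width b)%N.
      by case: s {p2 p3}; [exact: top_arc_in_range cert|exact: bottom_arc_in_range cert].
    by rewrite !flatE.
  by move: v4; case: v => [|[|[|[|]]]] // _; rewrite -?p2 -?p3 p1.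
- apply/quadrilateralP => t q q' tm q3 q'3.
  have kn : (7 * t < 7 * size (tets (ring w j)))%N by rewrite ltn_pmul2l.
  have [b [k [bj kb tk]]] := coordinate_block kn.
  have [t' kt'] : exists t', k = (7 * t')%N.
    have : (7 %| 7 * off b + k)%N by rewrite -tk dvdn_mulr.
    by rewrite dvdn_addr ?dvdn_mulr// => /dvdnP[t' ->]; exists t'; rewrite mulnC.
  have t'b : (t' < size (tets (blk b)))%N by move: kb; rewrite kt' ltn_pmul2l.
  have E i : (i < 3)%N -> weights (ring_ray a) (7 * t + 4 + i)%N =
      ray_fun R (block_ray a b) (7 * t' + 4 + i)%N.
    move=> i3; rewrite -flatE//; last first.
      apply: (@leq_trans (7 * t'.+1)); last by rewrite leq_mul2l.
      by rewrite mulnS (addnC 7) -addnA ltn_add2l; move: i i3 => [|[|[|]]].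
    by rewrite /part /shift tk kt' !addnA.
  rewrite !E//; exact: (sol_quad (block_ray_solution a bj).1).
Qed.


Lemma block_ray_neq0 b o z v : certified (blk b) o z -> v \in cone_rays (blk b) ->
  exists k : 'I_(width b), ray_fun R v k != 0.
Proof.
move=> cert vr; have [k vk] := ray_fun_neq0 R (block_ray_ok R cert vr).
by exists k.
Qed.

Definition ray_site (a : ring_index) : nat :=
  match a with inr (inr (i, _)) => i.+1 | _ => 0%N end.

Lemma ray_site_le a : (ray_site a <= j)%N.
Proof. by case: a => [[h l]|[h|[i l]]] //; exact: ltn_ord. Qed.

Lemma ray_site_mem a : block_ray a (ray_site a) \in cone_rays (blk (ray_site a)).
Proof.
case: a => [[h l]|[h|[i l]]].
- exact: (mem_open h head_cert).1.
- exact: (mem_closed h head_cert).1.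
- rewrite /= eqxx; exact: (mem_closed l layer_cert).1.
Qed.

Lemma section_under_ray a b (u : 'I_(width b) -> R) : (b <= j)%N ->
  under (section b (weights (ring_ray a))) u <->
  under (on (size (tets (blk b))) (ray_fun R (block_ray a b))) u.
Proof.
by move=> bj; split=> H k uk; have := H k uk; rewrite section_ring_ray.
Qed.

Lemma under_section_ray a b (u : 'I_(width b) -> R) : (b <= j)%N ->
  under u (section b (weights (ring_ray a))) <->
  under u (on (size (tets (blk b))) (ray_fun R (block_ray a b))).
Proof.
move=> bj; split=> H k uk; apply: H; first by rewrite section_ring_ray.
by rewrite section_ring_ray in uk.
Qed.

Lemma ring_ray_neq0 a : exists c, ring_ray a c != 0.
Proof.
have [k1 [k2 cert]] := block_cert (ray_site a).
have [k kn] := block_ray_neq0 cert (ray_site_mem a).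
have := section_ring_ray a k (ray_site_le a); rewrite /on /part /shift.
have [c <-] := code_surj (block_coordinate (ray_site_le a) (ltn_ord k)).
by rewrite weights_code => e; exists c; rewrite e.
Qed.

Lemma open_ray_inj B o z (i i' : 'I_o) : certified B o z ->
  nth [::] (open_rays B) i = nth [::] (open_rays B) i' -> i = i'.
Proof.
move=> cert /eqP; rewrite nth_uniq ?(size_open_rays cert)//; first by move=> /eqP/val_inj.
exact: filter_uniq (rays_uniq cert).
Qed.

Lemma closed_ray_inj B o z (i i' : 'I_z) : certified B o z ->
  nth [::] (closed_rays B) i = nth [::] (closed_rays B) i' -> i = i'.
Proof.
move=> cert /eqP; rewrite nth_uniq ?(size_closed_rays cert)//; first by move=> /eqP/val_inj.
exact: filter_uniq (rays_uniq cert).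
Qed.

(** On a block where the first ray is nonzero both are rays of the block, and equal
    by incomparability.  In particular an open and a closed ray of the ring are never comparable,
    since the weights at the ports of their blocks differ. *)
Lemma ring_ray_antichain a a' : under (ring_ray a) (ring_ray a') -> a = a'.
Proof.
move=> /under_parts aa'.
have H b : (b <= j)%N ->
    under (on (size (tets (blk b))) (ray_fun R (block_ray a b)))
          (on (size (tets (blk b))) (ray_fun R (block_ray a' b))).
  by move=> bj; apply/(under_section_ray _ _ bj)/(section_under_ray _ _ bj)/aa'.
have E b : (b <= j)%N -> block_ray a b \in cone_rays (blk b) ->
    block_ray a b = block_ray a' b.
  move=> bj ar; have [k1 [k2 cert]] := block_cert b.
  case: (block_rayP a' bj) => -[]; first by move=> a'r _; exact: (@under_ray_eq R _ _ _ cert _ _ ar a'r (H b bj)).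
  move=> a'0 _; have [k kn] := block_ray_neq0 cert ar.
  have := H b bj k; rewrite a'0 /on {1}/ray_fun nth_nil => /(_ erefl) k0.
  by rewrite k0 eqxx in kn.
have nn b : (b <= j)%N -> [::] \in cone_rays (blk b) -> False.
  move=> bj r0; have [k1 [k2 cert]] := block_cert b; have [k] := block_ray_neq0 cert r0.
  by rewrite /ray_fun nth_nil eqxx.
have L : level a = level a'.
  have sj := ray_site_le a; have e := E _ sj (ray_site_mem a); have sm := ray_site_mem a.
  case: (block_rayP a sj) => -[]; last by move=> a0; rewrite a0 in sm; case: (nn _ sj sm).
  move=> _ <-; rewrite e in sm *.
  by case: (block_rayP a' sj) => -[]; last by move=> a0; rewrite a0 in sm; case: (nn _ sj sm).
case: a a' {aa' H} E L => [[h l]|[h|[i l]]] [[h' l']|[h'|[i' l']]] //= E _.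
- rewrite (open_ray_inj head_cert (E 0%N isT (mem_open h head_cert).1)).
  congr (inl (_, _)); apply/ffunP => i; have := E i.+1 (ltn_ord i).
  rewrite /= valK => /(_ (mem_open (l i) layer_cert).1); exact: open_ray_inj layer_cert.
- by rewrite (closed_ray_inj head_cert (E 0%N isT (mem_closed h head_cert).1)).
- have := E 0%N isT (mem_closed h head_cert).1 => /= e.
  by have := (mem_closed h head_cert).1; rewrite e => /(nn 0%N isT).
- have := E i.+1 (ltn_ord i); rewrite /= eqxx => /(_ (mem_closed l layer_cert).1) e.
  by have := (mem_closed l layer_cert).1; rewrite e => /(nn i.+1 (ltn_ord i)).
- have := E i.+1 (ltn_ord i); rewrite /= eqxx => /(_ (mem_closed l layer_cert).1).
  case: eqP => [/val_inj -> /(closed_ray_inj layer_cert) -> //|_ e].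
  by have := (mem_closed l layer_cert).1; rewrite e => /(nn i.+1 (ltn_ord i)).
Qed.

Lemma open_index B o z v : certified B o z -> v \in open_rays B ->
  exists i : 'I_o, nth [::] (open_rays B) i = v.
Proof.
move=> cert /(nthP [::]) [i]; rewrite (size_open_rays cert) => io <-.
by exists (Ordinal io).
Qed.

Lemma closed_index B o z v : certified B o z -> v \in closed_rays B ->
  exists i : 'I_z, nth [::] (closed_rays B) i = v.
Proof.
move=> cert /(nthP [::]) [i]; rewrite (size_closed_rays cert) => iz <-.
by exists (Ordinal iz).
Qed.

(** If the common weight of the arcs is positive, there is an open ray under the
    solution in each block.  If it is zero, there is a closed ray under it in
    any block where it does not vanish. *)
Lemma ring_ray_cover x : admissible_cone tri x -> (exists c, x c != 0) ->
  exists a, under (ring_ray a) x.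
Proof.
move=> [x0 /matchingP xe /quadrilateralP xq] [c0 xc0].
have fx0 k : (k < 7 * size (tets (ring w j)))%N -> 0 <= weights x k.
  by move=> /code_surj [c <-]; rewrite weights_code.
have sol := part_solution ws head_fold_top fx0 xq xe.
have bots b (bj : (b <= j)%N) : port_sum (blk b) false 1 (part w b (weights x)) =
    port_sum (blk 0) false 1 (part w 0 (weights x)) :=
  bottoms_equal ws head_fold_top fx0 xq xe head_cert layer_cert bj.
have nil_under b : under (on (size (tets (blk b))) (ray_fun R [::])) (section b (weights x)).
  by move=> k _; rewrite /on /ray_fun nth_nil.
have bot0 : 0 <= port_sum (blk 0) false 1 (part w 0 (weights x)).
  have [lo hi] := bottom_arc_in_range head_cert.
  by rewrite /port_sum /pair_sum addr_ge0// (sol_ge0 (sol 0%N isT)).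
have := bot0; rewrite le_eqVlt => /predU1P[/esym bot_eq0|bot_gt0].
  have [b [k [bj kb ck]]] := coordinate_block (code_lt c0).
  have sn0 : exists k, section b (weights x) k != 0.
    by exists (Ordinal kb); rewrite /on /part /shift /= -ck weights_code.
  have bb : port_sum (blk b) false 1 (part w b (weights x)) = 0 by rewrite bots.
  case: b {k kb ck} bj sn0 bb => [|b] bj sn0 bb.
    have [v vr vx] := closed_ray_under head_cert (sol 0%N bj) bb sn0.
    have [h hv] := closed_index head_cert vr; exists (inr (inl h)).
    apply/under_parts => -[|b] bj'; apply/(section_under_ray _ _ bj').
      by rewrite /block_ray hv.
    exact: nil_under.
  have [v vr vx] := closed_ray_under layer_cert (sol b.+1 bj) bb sn0.
  have [l lv] := closed_index layer_cert vr; exists (inr (inr (Ordinal bj, l))).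
  apply/under_parts => -[|b'] bj'; apply/(section_under_ray _ _ bj'); first exact: nil_under.
  rewrite /block_ray; case: eqP => [e|_]; last exact: nil_under.
  by move: bj'; rewrite lv [b']e => bj'; exact: vx.
have [v vr vx] := open_ray_under head_cert (sol 0%N isT) bot_gt0.
have [h hv] := open_index head_cert vr.
have [l lP] : exists l : 'I_j -> 'I_o2, forall i : 'I_j,
    under (on (size (tets layer)) (ray_fun R (nth [::] (open_rays layer) (l i))))
          (section i.+1 (weights x)).
  apply: (@fin_all_exists _ (fun=> 'I_o2) (fun (i : 'I_j) (y : 'I_o2) =>
    under (on (size (tets layer)) (ray_fun R (nth [::] (open_rays layer) y)))
          (section i.+1 (weights x)))) => i.
  have bi : 0 < port_sum (blk i.+1) false 1 (part w i.+1 (weights x)).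
    by rewrite (bots i.+1 (ltn_ord i)).
  have [u ur ux] := open_ray_under layer_cert (sol i.+1 (ltn_ord i)) bi.
  by have [y yu] := open_index layer_cert ur; exists y; rewrite yu.
exists (inl (h, finfun l)); apply/under_parts => -[|b] bj; apply/(section_under_ray _ _ bj).
  by rewrite /block_ray hv.
by rewrite /block_ray (insubT (fun i => i < j)%N bj) ffunE; exact: (lP (Ordinal bj)).
Qed.

Theorem ring_vertex_count :
  admissible_vertex_count R tri (o1 * o2 ^ j + (z1 + j * z2)).
Proof.
have := vertex_count ring_ray_cone ring_ray_neq0 ring_ray_cover ring_ray_antichain.
by rewrite card_sum card_prod card_ffun card_sum card_prod !card_ord.
Qed.

End RingCount.

(** * The four families *)

Lemma opening_fold_top (R : realType) w : (forall B, List.In B w -> untwisted B) ->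
  fold_top R (opening (rcons w blockF)).
Proof.
move=> ws; rewrite /opening foldl_rcons.
exact: fold_top_stack (head_fits R ws) fits_F (@fold_top_F R).
Qed.

(** The head ends with [blockF], whose fold is needed at its top port. *)
Lemma ring_triangulation (R : realType) w j o z :
  (forall B, List.In B (rcons w blockF) -> untwisted B) ->
  certified (opening (rcons w blockF)) o z ->
  exists T : face_gluing (size (tets (opening (rcons w blockF))) + 4 * j),
    closed_3manifold_triangulation R T /\
    admissible_vertex_count R T (o * 17 ^ j + (z + j)).
Proof.
move=> ws cert; rewrite -size_ring.
exists (triangulation_of (ring_fits R ws j)); split.
  apply: closed_manifold_homeomorphic _ (double_manifold R).
  exact: homeomorphic_trans (realization_space _ R) (ring_double R j ws).
rewrite -[X in (z + X)%N]muln1; apply: ring_vertex_count cert layer_certificate.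
apply: opening_fold_top => B Bw; apply: ws; move: Bw.
by elim: (w) => //= C s IH [->|/IH]; [left|right].
Qed.

Theorem theorem8 (R : realType) (n : nat) (n_gt0 : (0 < n)%N)
    (n_neq : n \notin [:: 1; 2; 3; 5]%N) :
  exists T : face_gluing n, closed_3manifold_triangulation R T /\
    exists sigma : nat, admissible_vertex_count R T sigma /\
      (forall k : nat, (1 <= k)%N -> n = (4 * k)%N ->
         sigma = (17 ^ k + k)%N) /\
      (forall k : nat, (2 <= k)%N -> n = (4 * k + 1)%N ->
         sigma = (581 * 17 ^ (k - 2) + k + 1)%N) /\
      (forall k : nat, (1 <= k)%N -> n = (4 * k + 2)%N ->
         sigma = (69 * 17 ^ (k - 1) + k)%N) /\
      (forall k : nat, (1 <= k)%N -> n = (4 * k + 3)%N ->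
         sigma = (141 * 17 ^ (k - 1) + k + 2)%N).
Proof.
have words w B :
    List.In B (rcons [seq (if b then blockF else blockP) | b <- w] blockF) -> untwisted B.
  elim: w => [|b w IH] /= [].
  - by move=> <-; left.
  - by [].
  - by case: b => <-; [left|right].
  - exact: IH.
(* The heads have 4, 9, 6 and 7 tetrahedra, one size for each residue modulo 4. *)
have [q qP] : exists q, [\/ n = 4 + 4 * q, n = 9 + 4 * q, n = 6 + 4 * q | n = 7 + 4 * q]%N.
  move: n_gt0 n_neq; rewrite !inE !negb_or => n0 /and4P[/eqP n1 /eqP n2 /eqP n3 /eqP n5].
  have := divn_eq n 4; have := ltn_pmod n (isT : 0 < 4)%N.
  move: (n %/ 4)%N (n %% 4)%N => a [|[|[|[|//]]]] _ nE.
  - by exists a.-1; apply: Or41; lia.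
  - by exists a.-2; apply: Or42; lia.
  - by exists a.-1; apply: Or43; lia.
  - by exists a.-1; apply: Or44; lia.
case: qP => nE.
- have [T [Tm Tc]] := ring_triangulation R q (@words [:: false]) certificate4.
  rewrite nE; exists T; split => //; eexists; split; first exact: Tc.
  split=> [k k1 e|]; first by have -> : k = q.+1 by [lia]; rewrite expnS; lia.
  by split=> [k k1 e|]; [lia|split=> k k1 e; lia].
- have [T [Tm Tc]] := ring_triangulation R q (@words [:: false; true; false; false]) certificate9.
  rewrite nE; exists T; split => //; eexists; split; first exact: Tc.
  split=> [k k1 e|]; first lia.
  split=> [k k1 e|]; first by have -> : k = q.+2 by [lia]; rewrite subn2 /=; lia.
  by split=> k k1 e; lia.
- have [T [Tm Tc]] := ring_triangulation R q (@words [:: false; false]) certificate6.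
  rewrite nE; exists T; split => //; eexists; split; first exact: Tc.
  split=> [k k1 e|]; first lia.
  split=> [k k1 e|]; first lia.
  by split=> k k1 e; [have -> : k = q.+1 by [lia]; rewrite subn1 /=; lia|lia].
- have [T [Tm Tc]] := ring_triangulation R q (@words [:: false; true; false]) certificate7.
  rewrite nE; exists T; split => //; eexists; split; first exact: Tc.
  split=> [k k1 e|]; first lia.
  split=> [k k1 e|]; first lia.
  by split=> k k1 e; [lia|have -> : k = q.+1 by [lia]; rewrite subn1 /=; lia].
Qed.
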